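(* Let $\mathcal{R}$ be a punctured Riemann surface with $n\ge1$ cusps and let $D_1,D_2$ be Delaunay decompositions of $\mathcal{R}$. 1. If $C(D_1)\cap C(D_2)\neq\emptyset$, then there is a unique finest common coarsening $D_3$ of $D_1$ and $D_2$ among all Delaunay decompositions of $\mathcal{R}$, and $C(D_1)\cap C(D_2)=C(D_3)$. 2. Conversely, if $D_3$ is a finest common coarsening of $D_1$ and $D_2$ among all Delaunay decompositions of $\mathcal{R}$, then $C(D_1)\cap C(D_2)=C(D_3)$.
   Context: **Surface.** $\mathbb{R}^{2,1}$ is $\mathbb{R}^3$ with $\langle x,x'\rangle=x_1x_1'+x_2x_2'-x_3x_3'$; $\mathbb{H}=\{x:\langle x,x\rangle=-1,\ x_3>0\}$ is the hyperboloid model of the hyperbolic plane; $L^+=\{v:\langle v,v\rangle=0,\ v_3>0\}$ is the positive light cone, whose rays are the ideal points. Each $v\in L^+$ defines the horocycle $h(v)=\{x\in\mathbb{H}:\langle x,v\rangle=-1\}$ centered at the ideal point $\mathbb{R}_{>0}v$. A punctured Riemann surface is $\mathcal{R}=\mathbb{H}/\Gamma$, where $\Gamma\subset SO^+(2,1)$ is a discrete subgroup acting freely on $\mathbb{H}$, such that $\mathcal{R}$ has finite area and $n\ge1$ cusps. The cusps $1,\dots,n$ correspond to the $\Gamma$-orbits of ideal points fixed by parabolic elements of $\Gamma$. A horocycle at cusp $i$ is a $\Gamma$-orbit of horocycles $h(v)$ centered at the ideal points of the $i$th orbit; its length is the hyperbolic length of $h(v)/\mathrm{Stab}_\Gamma(v)$.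 **Delaunay decompositions.** Let $\omega\in\mathbb{R}_{\ge0}^n\setminus\{0\}$ (a weight vector). For $\omega_i>0$ let $\mathcal{B}_i\subset L^+$ be the $\Gamma$-orbit of points whose horocycles form the horocycle of length $\omega_i$ at cusp $i$; for $\omega_i=0$ (undecorated cusp) put $\mathcal{B}_i=\emptyset$. Let $\mathcal{B}=\bigcup_i\mathcal{B}_i$ and $\mathcal{C}=\mathrm{conv}(\mathcal{B})$. The Delaunay decomposition $D(\omega)$ is the $\Gamma$-invariant decomposition of $\mathbb{H}$ (equivalently, the decomposition of $\mathcal{R}$) obtained by projecting the boundary faces of $\mathcal{C}$ radially from the origin to $\mathbb{H}$: its 2-cells are the radial projections to $\mathbb{H}$ of the sets $\mathrm{conv}(\mathcal{B}\cap E)$, where $E$ is an affine plane not through $0$, containing at least three points of $\mathcal{B}$, such that $\mathcal{B}$ is contained in the closed half-space bounded by $E$ not containing $0$. (By Epstein–Penner and Akiyoshi this is a decomposition of $\mathcal{R}$ into ideal polygons, except that for each $i$ with $\omega_i=0$ there is one punctured face, containing the $i$th cusp in its interior; it lifts to infinite-sided ideal polygons.) A Delaunay decomposition of $\mathcal{R}$ is one of the form $D(\omega)$ for some $\omega\in\mathbb{R}_{\ge0}^n\setminus\{0\}$. **Refinement and secondary cones.** Write $S_1\preceq S_2$ if $S_1$ refines $S_2$ (equivalently, $S_2$ coarsens $S_1$), i.e. every cell of $S_1$ is contained in some cell of $S_2$. A common coarsening of $D_1,D_2$ among all Delaunay decompositions is a Delaunay decomposition $D_3$ of $\mathcal{R}$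 with $D_1\preceq D_3$ and $D_2\preceq D_3$; it is finest if it is minimal with respect to $\preceq$ among all such common coarsenings. The secondary cone of $S$ is $C(S)=\{\omega\in\mathbb{R}^n_{\ge0}\setminus\{0\}: S\preceq D(\omega)\}$. *)

(* Defs.v *)
From HB Require Import structures.
From mathcomp Require Import all_boot all_order all_algebra.
From mathcomp Require Import all_classical all_reals all_analysis.

Set Implicit Arguments.
Unset Strict Implicit.
Unset Printing Implicit Defensive.

Import Order.TTheory GRing.Theory Num.Theory.
Import numFieldNormedType.Exports.

Local Open Scope classical_set_scope.
Local Open Scope ring_scope.

Section Minkowski.
Context {R : realType}.
Implicit Types (x y v w : 'cV[R]_3) (g : 'M[R]_3) (G : set 'M[R]_3).

Definition form x y : R := x 0 0 * y 0 0 + x 1 0 * y 1 0 - x 2 0 * y 2 0.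

Definition hyperboloid : set 'cV[R]_3 := [set x | form x x = -1 /\ 0 < x 2 0].

Definition light_cone : set 'cV[R]_3 := [set v | form v v = 0 /\ 0 < v 2 0].

(* The ideal point of a light-like vector v is its ray. *)
Definition ray v : set 'cV[R]_3 := [set t *: v | t in [set t : R | 0 < t]].

Definition horocycle v : set 'cV[R]_3 :=
  [set x | hyperboloid x /\ form x v = -1].

Definition SOplus : set 'M[R]_3 :=
  [set g | [/\ forall x y, form (g *m x) (g *m y) = form x y,
               \det g = 1
             & forall x, hyperboloid x -> hyperboloid (g *m x)]].

Definition gorbit G x : set 'cV[R]_3 := [set g *m x | g in G].

Definition stab G v : set 'M[R]_3 := [set g | G g /\ g *m v = v].

Definition fixes_ideal g v : Prop := light_cone v /\ ray v (g *m v).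

Definition parabolic g : Prop :=
  [/\ SOplus g,
      forall x, hyperboloid x -> g *m x <> x
    & exists2 v, fixes_ideal g v & forall w, fixes_ideal g w -> ray v w].

(* The cusp of v is recorded as the union of the rays in the orbit of the
   ideal point of v. *)
Definition cusp_of G v : set 'cV[R]_3 := \bigcup_(g in G) ray (g *m v).

Definition cusps G : set (set 'cV[R]_3) :=
  [set cusp_of G v | v in [set v | exists g, [/\ G g, parabolic g
                                              & fixes_ideal g v]]].

(* The hyperboloid is the graph of x_3 = sqrt (1 + x_1^2 + x_2^2); in this
   chart the hyperbolic area element is dx_1 dx_2 / x_3. *)
Definition hyp_chart (p : R * R) : 'cV[R]_3 :=
  \col_i [:: p.1; p.2; Num.sqrt (1 + p.1 ^+ 2 + p.2 ^+ 2)]`_i.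

Definition hyp_area (F : set 'cV[R]_3) : \bar R :=
  \int[(lebesgue_measure \x lebesgue_measure)%E]_(p in hyp_chart @^-1` F)
    ((hyp_chart p 2 0)^-1)%:E.

Definition fundamental_domain G (F : set 'cV[R]_3) : Prop :=
  [/\ F `<=` hyperboloid,
      measurable (hyp_chart @^-1` F)
    & forall x, hyperboloid x -> exists! y, F y /\ gorbit G x y].

(* G is the group of a punctured surface hyperboloid / G of finite area whose
   cusps are labelled, bijectively, by K : 'I_n -> cusps G. *)
Record punctured_surface (n : nat) G (K : 'I_n -> set 'cV[R]_3) : Prop := {
  ps_SOplus : G `<=` SOplus;
  ps_one : G 1%:M;
  ps_mul : forall g h, G g -> G h -> G (g *m h);
  ps_inv : forall g, G g -> G (invmx g);
  ps_discrete : G `<=` isolated G;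
  ps_free : forall g x, G g -> hyperboloid x -> g *m x = x -> g = 1%:M;
  ps_area : exists2 F, fundamental_domain G F & (hyp_area F < +oo)%E;
  ps_cusps : set_bij [set: 'I_n] (cusps G) K }.

Definition curve_length (c : R -> 'cV[R]_3) (a b : R) : \bar R :=
  \int[lebesgue_measure]_(t in `[a, b])
    (Num.sqrt (form (derive1 c t) (derive1 c t)))%:E.

(* horocycle v / stab G v has length l: it is a simple closed curve of length
   l, traced once by a continuously differentiable c : [0, 1] -> horocycle v. *)
Definition horocycle_length G v (l : R) : Prop :=
  exists c : R -> 'cV[R]_3,
    [/\ (forall t, derivable c t 1) /\ continuous (derive1 c),
        forall t, 0 <= t <= 1 -> horocycle v (c t),
        gorbit (stab G v) (c 0) (c 1),
        forall x, horocycle v x ->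
          exists! t : R, 0 <= t < 1 /\ gorbit (stab G v) x (c t)
      & curve_length c 0 1 = l%:E].

End Minkowski.

Section Delaunay.
Context {R : realType} {n : nat}.
Variables (G : set 'M[R]_3) (K : 'I_n -> set 'cV[R]_3).
Implicit Types (w : 'rV[R]_n) (S T D : set (set 'cV[R]_3)).

Definition weight : set 'rV[R]_n :=
  [set w | (forall i, 0 <= w 0 i) /\ w <> 0].

Definition horo_points w (i : 'I_n) : set 'cV[R]_3 :=
  [set v | [/\ 0 < w 0 i, K i v & horocycle_length G v (w 0 i)]].

Definition all_horo_points w : set 'cV[R]_3 :=
  \bigcup_(i in [set: 'I_n]) horo_points w i.

(* The affine planes not through 0 are the sets plane a with a <> 0; the closed
   half-space bounded by plane a and not containing 0 is a x >= 1. *)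
Definition plane (a : 'rV[R]_3) : set 'cV[R]_3 := [set x | (a *m x) 0 0 = 1].

Definition conv_hull (A : set 'cV[R]_3) : set 'cV[R]_3 :=
  smallest (@convex_set R 'cV[R]_3) A.

Definition radial_proj (A : set 'cV[R]_3) : set 'cV[R]_3 :=
  [set x | hyperboloid x /\ exists2 t : R, 0 < t & A (t *: x)].

(* A decomposition is given by its set of 2-cells, lifted to the hyperboloid. *)
Definition delaunay w : set (set 'cV[R]_3) :=
  let B := all_horo_points w in
  [set radial_proj (conv_hull (B `&` plane a)) | a in
    [set a | (exists x y z, [/\ (B `&` plane a) x, (B `&` plane a) y,
                                (B `&` plane a) z
                              & [/\ x <> y, y <> z & x <> z]])
             /\ (forall x, B x -> 1 <= (a *m x) 0 0)]].

Definition is_delaunay D : Prop := exists2 w, weight w & D = delaunay w.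

(* There are no vertices in the hyperboloid, so the remaining cells are the
   edges; these are the nonempty intersections of two distinct 2-cells. *)
Definition cells S : set (set 'cV[R]_3) :=
  S `|` [set A | exists P Q, [/\ S P, S Q, P <> Q, A = P `&` Q & A !=set0]].

Definition refines S T : Prop :=
  forall P, cells S P -> exists2 Q, cells T Q & P `<=` Q.

Definition common_coarsening S T D : Prop :=
  [/\ is_delaunay D, refines S D & refines T D].

Definition finest_common_coarsening S T D : Prop :=
  common_coarsening S T D /\
  forall D', common_coarsening S T D' -> refines D' D -> D' = D.

Definition secondary_cone S : set 'rV[R]_n :=
  [set w | weight w /\ refines S (delaunay w)].

End Delaunay.

(* Main.v *)
Require Import Defs.
From HB Require Import structures.
From mathcomp Require Import all_boot all_order all_algebra.
From mathcomp Require Import all_classical all_reals all_analysis.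
From mathcomp Require Import measurable_realfun.
From mathcomp Require Import ring lra.

Set Implicit Arguments.
Unset Strict Implicit.
Unset Printing Implicit Defensive.

Import Order.TTheory GRing.Theory Num.Theory.
Import numFieldNormedType.Exports.

Import Defs.
Local Open Scope classical_set_scope.
Local Open Scope ring_scope.

(* Write [V i] for the light-like vectors at cusp i whose horocycle has length 1,
   and call a linear functional q feasible for a weight w if q >= w i on every
   [V i].  The faces of the convex hull are the sets where a feasible q is tight,
   so a 2-cell of D(w) is the set of points of the hyperboloid in the cone over
   [tight w q]: it is where q minimises x |-> q x among the feasible functionals.
   If q, q' are feasible for w, w' then q + q' is feasible for w + w' and its
   tight set is the intersection of the two tight sets.  Hence a common
   refinement of D(w) and D(w') by a Delaunay decomposition refines D(w + w'),
   and, as its cells cover the hyperboloid, D(w + w') refines both D(w) and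
   D(w').  So C(D1) /\ C(D2) is a convex cone, and a weight w in its relative
   interior gives the D(w) that refines all the other common coarsenings.

   Minimising functionals need not be positive definite: they can vanish at an
   undecorated cusp.  That a light-like direction is either a cusp or is
   approximated by every horocycle orbit rests on finite area: along a
   geodesic ray to a direction v whose orbit stays away from 0, finite area
   forces ever smaller elements of the group; the smallest ones commute with
   their successors, so they share an axis, which contracts to v and is thus
   parabolic. *)

(** * Lorentz geometry *)

Section Lorentz.
Context {R : realType}.
Implicit Types (x y z u v : 'cV[R]_3) (g h : 'M[R]_3).

(** Normalising by horocycle length makes the weight enter linearly: v has horocycle length [w 0 i]
    exactly when [w 0 i *: v] lies in [V i], so the condition a v >= 1 on the horocycle points turns
    into q u >= w i on a set independent of w. That is why functionals for different weights can be
    added. The group is known only through discreteness and finite area; no fundamental polygon or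
    horoball neighbourhood is at hand. Compactness therefore comes from the functionals: a positive
    lower bound at the vertices of one decorated cusp forces a functional to be nonnegative on the
    light cone, hence causal, and a causal functional is bounded by its value at a single point of
    the hyperboloid. Minimisers exist for this reason, and the sign on the light cone is where the
    dichotomy for light-like directions is used. Area is given by a density in a chart, so its
    invariance is proved by writing an isometry as a product of two rotations and a boost. For the
    converse claim, a finest common coarsening is itself the decomposition of some weight in both
    cones, so the first claim applies and uniqueness identifies it. *)

Lemma ord3P (P : 'I_3 -> Prop) : P 0 -> P 1 -> P 2 -> forall i, P i.
Proof.
move=> P0 P1 P2 [[|[|[|//]]] Hi].
- by rewrite (_ : Ordinal _ = 0) //; apply/val_inj.
- by rewrite (_ : Ordinal _ = 1) //; apply/val_inj.
- by rewrite (_ : Ordinal _ = 2) //; apply/val_inj.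
Qed.

Lemma cV3P x y :
  x 0 0 = y 0 0 -> x 1 0 = y 1 0 -> x 2 0 = y 2 0 -> x = y.
Proof. by move=> *; apply/colP; apply: ord3P. Qed.

Lemma sum3E (F : 'I_3 -> R) : \sum_i F i = F 0 + F 1 + F 2.
Proof.
rewrite !big_ord_recr big_ord0 /= add0r; congr (F _ + F _ + F _);
  exact/val_inj.
Qed.

Lemma mulmx3E m n (A : 'M[R]_(m, 3)) (B : 'M[R]_(3, n)) i j :
  (A *m B) i j = A i 0 * B 0 j + A i 1 * B 1 j + A i 2 * B 2 j.
Proof. by rewrite mxE sum3E. Qed.

Definition vec3 (a b c : R) : 'cV[R]_3 := \col_i [:: a; b; c]`_i.

Lemma vec3E a b c :
  (vec3 a b c 0 0 = a) * (vec3 a b c 1 0 = b) * (vec3 a b c 2 0 = c).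
Proof. by rewrite !mxE. Qed.

(* The Lorentzian cross product: form (cross v x) y is the determinant of
   (v, x, y). *)
Definition cross v x : 'cV[R]_3 :=
  vec3 (v 1 0 * x 2 0 - v 2 0 * x 1 0) (v 2 0 * x 0 0 - v 0 0 * x 2 0)
       (v 1 0 * x 0 0 - v 0 0 * x 1 0).

Definition det3 x y z : R :=
  x 0 0 * (y 1 0 * z 2 0 - y 2 0 * z 1 0)
  + x 1 0 * (y 2 0 * z 0 0 - y 0 0 * z 2 0)
  + x 2 0 * (y 0 0 * z 1 0 - y 1 0 * z 0 0).

Lemma formC x y : form x y = form y x. Proof. rewrite /form; ring. Qed.
Lemma formDl x y z : form (x + y) z = form x z + form y z.
Proof. rewrite /form !mxE; ring. Qed.
Lemma formZl a x y : form (a *: x) y = a * form x y.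
Proof. rewrite /form !mxE; ring. Qed.
Lemma formNl x y : form (- x) y = - form x y.
Proof. rewrite /form !mxE; ring. Qed.
Lemma formDr x y z : form x (y + z) = form x y + form x z.
Proof. by rewrite formC formDl !(formC x). Qed.
Lemma formZr a x y : form x (a *: y) = a * form x y.
Proof. by rewrite formC formZl formC. Qed.
Lemma formNr x y : form x (- y) = - form x y.
Proof. by rewrite formC formNl formC. Qed.
Definition formE := (formDl, formDr, formNl, formNr, formZl, formZr).

Lemma form_inj x y : (forall z, form x z = form y z) -> x = y.
Proof.
move=> H; move: (H (vec3 1 0 0)) (H (vec3 0 1 0)) (H (vec3 0 0 1)).
rewrite /form !vec3E => H0 H1 H2; apply: cV3P; lra.
Qed.

Lemma form_cross v x y : form (cross v x) y = det3 v x y.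
Proof. rewrite /form /det3 !vec3E; ring. Qed.

Lemma crossDr v x y : cross v (x + y) = cross v x + cross v y.
Proof. by apply: cV3P; rewrite !mxE /=; ring. Qed.
Lemma crossZr v a x : cross v (a *: x) = a *: cross v x.
Proof. by apply: cV3P; rewrite !mxE /=; ring. Qed.
Lemma crossZl v a x : cross (a *: v) x = a *: cross v x.
Proof. by apply: cV3P; rewrite !mxE /=; ring. Qed.
Lemma crossC v x : cross v x = - cross x v.
Proof. by apply: cV3P; rewrite !mxE /=; ring. Qed.
Lemma crossvv v : cross v v = 0.
Proof. by apply: cV3P; rewrite !mxE /=; ring. Qed.

Lemma cross_cross v x y :
  cross v (cross x y) = form v x *: y - form v y *: x.
Proof. by apply: cV3P; rewrite !mxE /form /=; ring. Qed.

Lemma form_cross2 u v x y :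
  form (cross u v) (cross x y) = form u y * form v x - form u x * form v y.
Proof. rewrite /form !vec3E; ring. Qed.

Lemma form_crossl v x : form (cross v x) v = 0.
Proof. rewrite form_cross /det3; ring. Qed.
Lemma form_crossr v x : form (cross v x) x = 0.
Proof. rewrite form_cross /det3; ring. Qed.

Lemma det_mx33 g : \det g =
  g 0 0 * (g 1 1 * g 2 2 - g 1 2 * g 2 1)
  - g 0 1 * (g 1 0 * g 2 2 - g 1 2 * g 2 0)
  + g 0 2 * (g 1 0 * g 2 1 - g 1 1 * g 2 0).
Proof.
rewrite (expand_det_row _ 0) sum3E /cofactor.
rewrite !(expand_det_row _ 0) !big_ord_recl !big_ord0 /cofactor !det_mx11 !mxE.
pose gg (a b : nat) := g (inord a) (inord b).
have gE i j : g i j = gg i j by rewrite /gg !inord_val.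
rewrite !gE /= /bump /=; ring.
Qed.

Lemma mulmx3vE g x i : (g *m x) i 0 = g i 0 * x 0 0 + g i 1 * x 1 0 + g i 2 * x 2 0.
Proof. exact: mulmx3E. Qed.

Lemma det3_mul g x y z : det3 (g *m x) (g *m y) (g *m z) = \det g * det3 x y z.
Proof. rewrite det_mx33 /det3 !mulmx3vE; ring. Qed.

Definition lorentz g : Prop :=
  (forall x y, form (g *m x) (g *m y) = form x y) /\ \det g = 1.

Lemma SOplus_lorentz g : SOplus g -> lorentz g. Proof. by case. Qed.

Lemma lorentz_unit g : lorentz g -> g \in unitmx.
Proof. by case=> _ d1; rewrite unitmxE d1 unitr1. Qed.

Lemma lorentzM g h : lorentz g -> lorentz h -> lorentz (g *m h).
Proof.
move=> [gf gd] [hf hd]; split=> [x y|].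
  by rewrite -!mulmxA gf hf.
by rewrite det_mulmx gd hd mulr1.
Qed.

Lemma lorentzV g : lorentz g -> lorentz (invmx g).
Proof.
move=> lg; have [gf gd] := lg; have gu := lorentz_unit lg; split=> [x y|].
  by rewrite -gf !mulKVmx.
by rewrite det_inv gd invr1.
Qed.

Lemma lorentz_cross g v x : lorentz g ->
  g *m cross v x = cross (g *m v) (g *m x).
Proof.
move=> lg; have [gf gd] := lg; apply: form_inj => y.
rewrite -[y](mulKVmx (lorentz_unit lg)) gf !form_cross det3_mul gd mul1r.
by [].
Qed.

Definition mJ : 'M[R]_3 := \matrix_(i, j) (if i == j then (if i == 2 then -1 else 1) else 0).

(** Invariance of the form says that [mJ *m g^T *m mJ *m g] is the identity, tested here on basis
    vectors. *)
Lemma lorentz_inv g : lorentz g -> invmx g = mJ *m g^T *m mJ.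
Proof.
move=> lg; have [gf gd] := lg; have gu := lorentz_unit lg.
have K : mJ *m g^T *m mJ *m g = 1%:M.
  have H i j : form (g *m delta_mx i 0) (g *m delta_mx j 0) = form (delta_mx i 0) (delta_mx j 0) by rewrite gf.
  have E i j : (g *m delta_mx i 0) j (0 : 'I_1) = g j i.
    by rewrite -colE mxE.
  apply/matrixP => i j; move: (H i j); rewrite /form !E.
  elim/ord3P: i; elim/ord3P: j; rewrite !mxE !sum3E !mxE !sum3E !mxE !sum3E !mxE /=; lra.
by rewrite -[RHS]mulmx1 -(mulmxV gu) mulmxA K mul1mx.
Qed.
End Lorentz.

(** * Causal vectors and parabolic one-parameter groups *)

Section Causal.
Context {R : realType}.
Implicit Types (x y z u v w : 'cV[R]_3) (g h : 'M[R]_3).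

(** The identity behind the reversed Cauchy-Schwarz inequality: for causal x and y the left side is
    nonnegative, and for null x and y of positive height it vanishes only when they are parallel. *)
Lemma causal_form x y :
  (x 2 0 * y 0 0 - y 2 0 * x 0 0) ^+ 2 + (x 2 0 * y 1 0 - y 2 0 * x 1 0) ^+ 2
  - (y 2 0) ^+ 2 * form x x - (x 2 0) ^+ 2 * form y y
  = - 2 * x 2 0 * y 2 0 * form x y.
Proof. rewrite /form; ring. Qed.

Lemma form_causal_le0 x y : form x x <= 0 -> 0 < x 2 0 ->
  form y y <= 0 -> 0 < y 2 0 -> form x y <= 0.
Proof.
move=> xx x2 yy y2.
have := causal_form x y.
set S0 := (X in X ^+ 2 + _); set S1 := (X in _ + X ^+ 2 - _) => E.
have : 0 <= - 2 * x 2 0 * y 2 0 * form x y.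
  rewrite -E; have := sqr_ge0 S0; have := sqr_ge0 S1.
  have := sqr_ge0 (y 2 0); have := sqr_ge0 (x 2 0); nra.
have p : 0 < x 2 0 * y 2 0 by exact: mulr_gt0.
by rewrite -!mulrA mulNr oppr_ge0 pmulr_rle0 // mulrA pmulr_rle0.
Qed.

(** Controls the height of a causal vector by its pairing with one point of the hyperboloid, so that
    sublevel sets of this pairing are bounded. *)
Lemma form_hyp_causal x y : hyperboloid x -> form y y <= 0 -> 0 < y 2 0 ->
  y 2 0 <= - 2 * x 2 0 * form x y.
Proof.
move=> [xx x2] yy y2.
have := causal_form x y; rewrite xx.
set S0 := (X in X ^+ 2 + _); set S1 := (X in _ + X ^+ 2 - _) => E.
rewrite -(ler_pM2l y2).
have -> : y 2 0 * (- 2 * x 2 0 * form x y) = - 2 * x 2 0 * y 2 0 * form x y by ring.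
rewrite -E; have := sqr_ge0 S0; have := sqr_ge0 S1.
have := sqr_ge0 (x 2 0); nra.
Qed.

Lemma form_hyp_lt0 x y : hyperboloid x -> form y y <= 0 -> 0 < y 2 0 -> form x y < 0.
Proof.
move=> hx yy y2; have := form_hyp_causal hx yy y2; case: hx => _ x2 H.
rewrite -(pmulr_rlt0 _ x2); nra.
Qed.

Lemma light_le0 u v : light_cone u -> light_cone v -> form u v <= 0.
Proof. by move=> [uu u2] [vv v2]; apply: form_causal_le0; rewrite ?uu ?vv. Qed.

Lemma form_hyp_light x v : hyperboloid x -> light_cone v -> form x v < 0.
Proof. by move=> hx [vv v2]; apply: form_hyp_lt0; rewrite ?vv. Qed.

Lemma light_parallel u v : light_cone u -> light_cone v -> form u v = 0 ->
  u = (u 2 0 / v 2 0) *: v.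
Proof.
move=> [uu u2] [vv v2] uv; have := causal_form u v.
rewrite uu vv uv !mulr0 !subr0 => /eqP; rewrite paddr_eq0 ?sqr_ge0 // !sqrf_eq0.
rewrite !subr_eq0 => /andP[/eqP E0 /eqP E1].
have v0 : v 2 0 != 0 by rewrite gt_eqF.
by apply: cV3P; rewrite !mxE -mulrAC; apply: (mulIf v0); rewrite mulfVK // ?E0 ?E1 mulrC.
Qed.

Lemma light_neq0 v : light_cone v -> v <> 0.
Proof. by move=> [_ v2] v0; move: v2; rewrite v0 mxE ltxx. Qed.

Lemma lightZ c v : 0 < c -> light_cone v -> light_cone (c *: v).
Proof.
by move=> c0 [vv v2]; split; rewrite ?formE ?vv ?mulr0 // mxE mulr_gt0.
Qed.

Lemma hyp_scale x : form x x < 0 -> 0 < x 2 0 ->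
  hyperboloid ((Num.sqrt (- form x x))^-1 *: x).
Proof.
move=> xx x2; have s0 : 0 < Num.sqrt (- form x x) by rewrite sqrtr_gt0 oppr_gt0.
split; last by rewrite mxE mulr_gt0 // invr_gt0.
rewrite !formE mulrA -expr2 exprVn sqr_sqrtr ?oppr_ge0 ?ltW //.
by rewrite invrN mulNr mulVf // lt_eqF.
Qed.

Lemma neg_hyp_form x y : form x x = -1 -> x 2 0 <= 0 -> light_cone y -> 0 < form x y.
Proof.
move=> xx x2 ly.
have x2' : x 2 0 != 0.
  apply/eqP => x0; move: xx; rewrite /form x0; have := sqr_ge0 (x 0 0); have := sqr_ge0 (x 1 0); nra.
have hx : hyperboloid (- x).
  by split; rewrite ?formE ?opprK ?mxE // oppr_gt0 lt_neqAle x2' x2.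
by have := form_hyp_light hx ly; rewrite formE oppr_lt0.
Qed.

(** A form-preserving map either keeps or exchanges the two sheets, and pairing with a null vector
    has a definite sign on each, so a single null vector decides. *)
Lemma lorentz_SOplus g v : lorentz g -> light_cone v -> light_cone (g *m v) -> SOplus g.
Proof.
move=> [gf gd] lv lgv; split=> // x hx; have [xx x2] := hx; split; first by rewrite gf.
rewrite ltNge; apply/negP => n.
have := neg_hyp_form (etrans (gf x x) xx) n lgv.
by rewrite gf => /lt_trans/(_ (form_hyp_light hx lv)); rewrite ltxx.
Qed.

Definition e3 : 'cV[R]_3 := vec3 0 0 1.

Lemma hyp_e3 : hyperboloid e3.
Proof. by split; rewrite ?/form !vec3E; [ring|exact: ltr01]. Qed.

Definition e_null : 'cV[R]_3 := vec3 1 0 1.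

Lemma light_e_null : light_cone e_null.
Proof. by split; rewrite ?/form !vec3E; [ring|exact: ltr01]. Qed.

Lemma SOplus_light g v : SOplus g -> light_cone v -> light_cone (g *m v).
Proof.
move=> [gf gd gh] lv; have [vv v2] := lv; split; first by rewrite gf.
have lt := form_hyp_light hyp_e3 lv.
have := form_hyp_light (gh _ hyp_e3) lv => _.
rewrite ltNge; apply/negP => n.
have : form (g *m e3) (g *m v) < 0 by rewrite gf.
case: (ltgtP ((g *m v) 2 0) 0) n => // [n _|n _].
  have := @form_hyp_light (g *m e3) (- (g *m v)) (gh _ hyp_e3).
  rewrite formE oppr_lt0 => H L; have := lt_trans L (H _); rewrite ltxx => H'.
  by suff: false by []; apply: H'; split; rewrite ?formE ?opprK ?gf // mxE oppr_gt0.
have := gf v v; rewrite vv {1}/form n mulr0 subr0 => /eqP.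
rewrite -!expr2 paddr_eq0 ?sqr_ge0 // !sqrf_eq0 => /andP[/eqP a /eqP b].
by rewrite {1}/form a b n !mulr0 addr0 subr0 ltxx.
Qed.

Lemma SOplusM g h : SOplus g -> SOplus h -> SOplus (g *m h).
Proof.
move=> sg sh; have lg := SOplus_lorentz sg; have lh := SOplus_lorentz sh.
have [f d] := lorentzM lg lh; split=> // x hx; rewrite -mulmxA.
by case: sg => _ _; apply; case: sh => _ _; apply.
Qed.

Lemma SOplusV g : SOplus g -> SOplus (invmx g).
Proof.
move=> sg; have lg := SOplus_lorentz sg; have [f d] := lorentzV lg.
split=> // x hx; have [xx x2] := hx; split; first by rewrite f.
rewrite ltNge; apply/negP => n.
have nn : hyperboloid (- (invmx g *m x)).
  split; rewrite ?formE ?opprK ?f // mxE oppr_gt0 lt_neqAle n andbT.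
  apply/eqP => z; have := f x x; rewrite xx {1}/form z.
  by have := sqr_ge0 ((invmx g *m x) 0 0); have := sqr_ge0 ((invmx g *m x) 1 0); nra.
have : hyperboloid (g *m - (invmx g *m x)) by case: sg => _ _; apply.
rewrite mulmxN mulKVmx ?(lorentz_unit lg) // => -[_]; rewrite mxE oppr_gt0.
by move=> /lt_trans/(_ x2); rewrite ltxx.
Qed.

Lemma mulmx_ext g h : (forall x, g *m x = h *m x) -> g = h.
Proof.
move=> H; apply/matrixP => i j; have := congr1 (fun A : 'cV_3 => A i 0) (H (delta_mx j 0)).
by rewrite -!colE !mxE.
Qed.

(** The identification of Minkowski space with the Lie algebra of its isometry group. *)
Definition mcross v : 'M[R]_3 :=
  \matrix_(i, j) (cross v (delta_mx j 0)) i 0.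

Lemma mcross_entry v :
  ((mcross v 0 0 = 0) * (mcross v 0 1 = - v 2 0) * (mcross v 0 2 = v 1 0) *
   (mcross v 1 0 = v 2 0) * (mcross v 1 1 = 0) * (mcross v 1 2 = - v 0 0) *
   (mcross v 2 0 = v 1 0) * (mcross v 2 1 = - v 0 0) * (mcross v 2 2 = 0))%type.
Proof. by do 8?[split; last by rewrite !mxE /= ?mxE /=; ring]; rewrite !mxE /= ?mxE /=; ring. Qed.

Lemma mcrossE v x : mcross v *m x = cross v x.
Proof.
by apply: cV3P; rewrite mulmx3E !mcross_entry vec3E; ring.
Qed.

(* The exponential series of t * mcross v, which stops here when v is light-like. *)
Definition par v (t : R) : 'M[R]_3 :=
  1%:M + t *: mcross v + (t ^+ 2 / 2) *: (mcross v *m mcross v).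

Lemma parE v t x : form v v = 0 ->
  par v t *m x = x + t *: cross v x - (t ^+ 2 / 2 * form v x) *: v.
Proof.
move=> vv; rewrite /par !mulmxDl mul1mx -!scalemxAl -mulmxA !mcrossE cross_cross vv scale0r.
by rewrite sub0r scalerN scalerA.
Qed.

Lemma par0 v : par v 0 = 1%:M.
Proof. by rewrite /par expr0n mul0r !scale0r !addr0. Qed.

Lemma mcrossZ c v : mcross (c *: v) = c *: mcross v.
Proof. by apply: mulmx_ext => x; rewrite mcrossE -scalemxAl mcrossE crossZl. Qed.

Lemma parZ c v t : par (c *: v) t = par v (c * t).
Proof.
rewrite /par mcrossZ -scalemxAl -scalemxAr !scalerA; congr (_ + _ *: _ + _ *: _); ring.
Qed.

Lemma parD v s t : form v v = 0 -> par v s *m par v t = par v (s + t).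
Proof.
move=> vv; apply: mulmx_ext => x; rewrite -mulmxA !parE //.
rewrite !formE vv mulr0 oppr0 addr0 !crossDr -scaleNr !crossZr crossvv scaler0 addr0.
rewrite cross_cross vv scale0r sub0r (formC v (cross v x)) form_crossl mulr0 addr0.
by apply: cV3P; rewrite !mxE; field.
Qed.

Lemma par_fix v t : form v v = 0 -> par v t *m v = v.
Proof. by move=> vv; rewrite parE // crossvv vv mulr0 scaler0 scale0r subr0 addr0. Qed.

Lemma lorentz_par v t : form v v = 0 -> lorentz (par v t).
Proof.
move=> vv; split=> [x y|].
  rewrite !parE // !formE form_cross2 form_crossl (formC v (cross _ _)) form_crossl vv.
  rewrite (form_cross v x) (formC x (cross _ _)) form_cross (formC x v) /det3; by field.
have -> : \det (par v t) = 1 + t ^+ 4 / 4 * (form v v) ^+ 2.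
  rewrite det_mx33 /form /par; do ![rewrite [in LHS]mxE ?mcross_entry | rewrite [in LHS]mulmx3E].
  rewrite ?sum3E !mcross_entry /=; by field.
by rewrite vv expr0n mulr0 addr0.
Qed.

Lemma SOplus_par v t : light_cone v -> SOplus (par v t).
Proof.
move=> lv; have [vv _] := lv.
by apply: (lorentz_SOplus (lorentz_par t vv) lv); rewrite par_fix.
Qed.

Lemma par_conj g v t : lorentz g -> g *m par v t = par (g *m v) t *m g.
Proof.
move=> lg; have [gf gd] := lg.
suff E : g *m mcross v = mcross (g *m v) *m g.
  rewrite /par !mulmxDl !mulmxDr mulmx1 mul1mx -!scalemxAr -!scalemxAl E mulmxA E.
  by rewrite -!mulmxA E.
by apply: mulmx_ext => x; rewrite -!mulmxA !mcrossE lorentz_cross.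
Qed.

Lemma mcross_inj v w : mcross v = mcross w -> v = w.
Proof.
move=> /matrixP E; move: (E 1 0) (E 2 0) (E 2 1); rewrite !mcross_entry => H1 H2 H3.
apply: cV3P; lra.
Qed.

Lemma invmxM n (A B : 'M[R]_n) : A \in unitmx -> B \in unitmx ->
  invmx (A *m B) = invmx B *m invmx A.
Proof.
move=> uA uB; have uAB : A *m B \in unitmx by rewrite unitmx_mul uA.
by rewrite -[RHS]mulmx1 -(mulmxV uAB) !mulmxA mulmxKV // mulVmx // mul1mx.
Qed.

(** For a Lorentz matrix, g - g^-1 is skew for the form, hence given by a vector. That vector is
    fixed by g, and for [par v t] it is 2 t v. *)
Definition axis g : 'cV[R]_3 :=
  let D := g - invmx g in vec3 (- D 1 2) (D 0 2) (D 1 0).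

Lemma axisP g : lorentz g -> g - invmx g = mcross (axis g).
Proof.
move=> lg; rewrite /axis lorentz_inv //.
apply/matrixP; apply: ord3P; apply: ord3P;
 rewrite mcross_entry ?vec3E !mxE !sum3E !mxE !sum3E !mxE /=; ring.
Qed.

Lemma axis_conj s g : lorentz s -> lorentz g ->
  axis (s *m g *m invmx s) = s *m axis g.
Proof.
move=> ls lg; have us := lorentz_unit ls; have ug := lorentz_unit lg.
have lc : lorentz (s *m g *m invmx s).
  by apply: lorentzM; [exact: lorentzM|exact: lorentzV].
apply: mcross_inj; rewrite -axisP //.
have -> : invmx (s *m g *m invmx s) = s *m invmx g *m invmx s.
  have uc := lorentz_unit lc.
  by rewrite !invmxM ?invmxK ?mulmxA // ?unitmx_inv // unitmx_mul us.
rewrite -mulmxBl -mulmxBr axisP //.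
apply: mulmx_ext => x; rewrite -!mulmxA !mcrossE lorentz_cross //.
by rewrite mulKVmx.
Qed.

(** Cayley-Hamilton for a Lorentz matrix, whose inverse has the same trace. It expresses g through
    its axis and its trace as long as tr g + 1 is not 0. *)
Lemma axis_CH g : lorentz g ->
  mcross (axis g) *m mcross (axis g) =
  (\tr g + 1) *: (g + invmx g - 2 *: 1%:M).
Proof.
move=> lg; have [_ d] := lg; have ug := lorentz_unit lg.
have CH (h : 'M[R]_3) : lorentz h -> h *m h = \tr h *: h - \tr h *: 1%:M + invmx h.
  move=> lh; have [_ dh] := lh; have uh := lorentz_unit lh.
  have E : \adj h = invmx h by rewrite /invmx uh dh invr1 scale1r.
  have T : \tr (invmx h) = \tr h.
    by rewrite lorentz_inv // /mxtrace !sum3E !mxE !sum3E !mxE !sum3E !mxE /=; ring.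
  rewrite -E -[X in _ - X *: _]T -E.
  apply/matrixP; apply: ord3P; apply: ord3P.
  1-9: rewrite !mxE !sum3E /mxtrace ?sum3E.
  1-9: rewrite !mxE /cofactor !(expand_det_row _ 0) !big_ord_recl !big_ord0 /cofactor !det_mx11 !mxE.
  1-9: pose gg (a b : nat) := h (inord a) (inord b).
  1-9: have gE i j : h i j = gg i j by rewrite /gg !inord_val.
  1-9: rewrite !gE /= /bump /=; ring.
have T : \tr (invmx g) = \tr g.
  by rewrite lorentz_inv // /mxtrace !sum3E !mxE !sum3E !mxE !sum3E !mxE /=; ring.
rewrite -axisP // mulmxBl !mulmxBr mulmxV // mulVmx // (CH g) // (CH (invmx g)) ?T ?invmxK //; last exact: lorentzV.
by apply/matrixP => i j; rewrite !mxE; ring.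
Qed.

End Causal.

(** * Invariance of hyperbolic area *)

Section Densities.
Context {R : realType}.
Notation mu := (@lebesgue_measure R).
Local Open Scope ereal_scope.

Lemma density_measure d (T : measurableType d) (m : {measure set T -> \bar R})
    (f : T -> \bar R) : measurable_fun setT f -> (forall x, 0 <= f x) ->
  exists m' : {measure set T -> \bar R}, forall A, m' A = \int[m]_(x in A) f x.
Proof.
move=> mf f0; pose m' (A : set T) := \int[m]_(x in A) f x.
have m'0 : m' set0 = 0 by rewrite /m' integral_set0.
have m'ge0 A : 0 <= m' A by apply: integral_ge0.
have m'add : semi_sigma_additive m'.
  move=> A mA tA mUA; rewrite /m' ge0_integral_bigcup //; last exact: measurable_funTS.
  by apply: is_cvg_ereal_nneg_natsum_cond => n _ _; apply: integral_ge0.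
pose M := isMeasure.Build _ _ _ m' m'0 m'ge0 m'add.
by exists (HB.pack m' M : {measure set T -> \bar R}).
Qed.

(** By uniqueness of Lebesgue measure, which its pushforward under a translation matches on
    half-open intervals. *)
Lemma ge0_integral_translation (f : R -> \bar R) (k : R) :
  measurable_fun setT f -> (forall x, 0 <= f x) ->
  \int[mu]_x f (x + k)%R = \int[mu]_x f x.
Proof.
move=> mf f0; pose phi (x : measurableTypeR R) : measurableTypeR R := (x + k)%R.
have mphi : measurable_fun setT phi by apply: measurable_funD.
have mT A : measurable A -> mu A = pushforward mu phi A.
  pose Hm := isMeasurableFun.Build _ _ _ _ _ mphi.
  pose phi' : {mfun _ >-> _} := HB.pack phi Hm.
  apply: (@lebesgue_measure_unique R (pushforward mu phi')) => _ [[a b] _ <-].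
  rewrite /= /pushforward /=.
  have -> : phi @^-1` `]a, b] = `](a - k)%R, (b - k)%R]%classic.
    by apply/seteqP; split=> x /=; rewrite /phi !in_itv /= ltrBlDr lerBrDr.
  by rewrite !lebesgue_measure_itv /= !lte_fin ltrD2r; case: ifP => // _; rewrite -!EFinB; congr (_ %:E); ring.
transitivity (\int[mu]_(x in phi @^-1` setT) (f \o phi) x); first by rewrite preimage_setT.
rewrite -(ge0_integral_pushforward mphi mu) //.
by apply: eq_measure_integral => A mA _; rewrite /= -mT.
Qed.

End Densities.

(** * The invariant measure on a slice of the chart *)

Section Boost1.
Context {R : realType}.
Notation mu := (@lebesgue_measure R).
Variables (m c s : R).
Hypotheses (m0 : 0 < m) (c0 : 0 < c) (cs : c ^+ 2 - s ^+ 2 = 1).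

Let r (x : R) : R := Num.sqrt (m + x ^+ 2).
(** A boost seen on the slice of the chart where the second coordinate is y: there m = 1 + y^2 and
    [r x] is the third coordinate. *)
Definition boost1 (c s x : R) : R := c * x + s * r x.

Let r2 x : r x ^+ 2 = m + x ^+ 2.
Proof. by rewrite sqr_sqrtr // addr_ge0 ?sqr_ge0 // ltW. Qed.
Let r0 x : 0 < r x.
Proof. by rewrite sqrtr_gt0 ltr_pwDl // sqr_ge0. Qed.
Let absx x : `|x| < r x.
Proof. by rewrite -sqrtr_sqr ltr_sqrt ?ltrDr // ltr_pwDl // sqr_ge0. Qed.

Let sc : `|s| < c.
Proof. by rewrite -[c]gtr0_norm // -!sqrtr_sqr ltr_sqrt ?exprn_gt0 // -subr_gt0 cs.
Qed.

Let pos x : 0 < s * x + c * r x.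
Proof.
have := absx x; have := sc; rewrite !ltr_norml => /andP[a b] /andP[a' b'].
have := r0 x => rx; nra.
Qed.

Lemma r_boost1 x : r (boost1 c s x) = s * x + c * r x.
Proof.
apply/eqP; rewrite -(eqrXn2 (n := 2)) // ?ltW ?r0 //; apply/eqP.
rewrite r2 /boost1; have := r2 x; move: (r x) => y Hy.
have -> : m = y ^+ 2 - x ^+ 2 by rewrite Hy addrK.
have -> : (c * x + s * y) ^+ 2 = (s * x + c * y) ^+ 2 - (c ^+ 2 - s ^+ 2) * (y ^+ 2 - x ^+ 2) by ring.
by rewrite cs; ring.
Qed.

Lemma boost1K x : boost1 c (- s) (boost1 c s x) = x.
Proof.
rewrite {1}/boost1 r_boost1 /boost1.
have -> : c * (c * x + s * r x) + - s * (s * x + c * r x) = (c ^+ 2 - s ^+ 2) * x by ring.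
by rewrite cs mul1r.
Qed.

Lemma is_derive_boost1 (x : R) :
  is_derive x 1 (boost1 c s) ((s * x + c * r x) / r x).
Proof.
have rx := r0 x.
have H : is_derive x 1 r (x / r x).
  have d1 : is_derive x 1 (fun x : R => m + x ^+ 2) (2 * x).
    apply: is_derive_eq; rewrite /GRing.scale /=. ring.
  have -> : x / r x = (2 * r x)^-1 * (2 * x) by field; rewrite gt_eqF.
  have p : 0 < m + x ^+ 2 by rewrite ltr_pwDl // sqr_ge0.
  have d2 := is_derive1_sqrt p.
  by apply: is_derive1_comp.
have d3 : is_derive x 1 (boost1 c s) (c * 1 + s * (x / r x)).
  by rewrite /boost1; apply: is_derive_eq.
apply: is_derive_eq d3 _; field; by rewrite gt_eqF.
Qed.

Lemma boost1_mono x y : x < y -> boost1 c s x < boost1 c s y.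
Proof.
move=> xy.
have rx := r0 x; have ry := r0 y.
have E : (r y - r x) * (r x + r y) = (y - x) * (x + y).
  have -> : (r y - r x) * (r x + r y) = r y ^+ 2 - r x ^+ 2 by ring.
  by rewrite !r2; ring.
have := absx x; have := absx y; have := sc.
rewrite !ltr_norml => /andP[a b] /andP[a' b'] /andP[a'' b''].
rewrite -subr_gt0 /boost1.
have -> : c * y + s * r y - (c * x + s * r x) = c * (y - x) + s * (r y - r x) by ring.
rewrite -(pmulr_lgt0 _ (addr_gt0 rx ry)).
have -> : (c * (y - x) + s * (r y - r x)) * (r x + r y) = (y - x) * (c * (r x + r y) + s * (x + y)).
  by rewrite mulrDl -(mulrA s) E; ring.
by apply: mulr_gt0; [rewrite subr_gt0|nra].
Qed.

Let cont_r : continuous r.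
Proof.
move=> x; apply: continuous_comp; last exact: sqrt_continuous.
by apply: cvgD; [exact: cvg_cst|exact: exprn_continuous].
Qed.

Let cont_w : continuous (fun x => (r x)^-1).
Proof. by move=> x; apply: cvgV; [rewrite gt_eqF|exact: cont_r]. Qed.

Let D1 : (boost1 c s)^`()%classic = (fun x => (s * x + c * r x) / r x).
Proof.
apply/funext => x; have H := is_derive_boost1 x.
by rewrite derive1E; case: H.
Qed.

Lemma cont_boost1 : continuous (boost1 c s).
Proof.
move=> x; apply: differentiable_continuous; apply/derivable1_diffP.
by case: (is_derive_boost1 x).
Qed.

Let cont_D1 : continuous (boost1 c s)^`()%classic.
Proof.
rewrite D1 => x; apply: cvgM; last exact: cont_w.
by apply: cvgD; apply: cvgM; try exact: cvg_cst; [exact: cvg_id|exact: cont_r].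
Qed.

(** The derivative of the boost is the value of [r] at the image divided by its value at the point,
    so substitution preserves dx / r. *)
Lemma integral_boost1_itv a b : a <= b ->
  (\int[mu]_(x in `[boost1 c s a, boost1 c s b]) ((r x)^-1)%:E
   = \int[mu]_(x in `[a, b]) ((r x)^-1)%:E)%E.
Proof.
move=> ab; rewrite (@integration_by_substitution_increasing R (boost1 c s)) //.
- apply: eq_integral => x _; congr EFin; rewrite fctE /= D1 r_boost1.
  by have p := pos x; have q := r0 x; field; rewrite !gt_eqF.
- by move=> x y _ _; exact: boost1_mono.
- apply/cvg_ex; exists ((boost1 c s)^`()%classic a); apply: cvg_at_right_filter; exact: cont_D1.
- apply/cvg_ex; exists ((boost1 c s)^`()%classic b); apply: cvg_at_left_filter; exact: cont_D1.
- split.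
  + by move=> x _; case: (is_derive_boost1 x).
  + by apply: cvg_at_right_filter; exact: cont_boost1.
  + by apply: cvg_at_left_filter; exact: cont_boost1.
- by apply: continuous_subspaceT => x; exact: cont_w.
Qed.

Let mw : measurable_fun setT (fun x : R => ((r x)^-1)%:E).
Proof. by apply/measurable_EFinP; apply: continuous_measurable_fun; exact: cont_w. Qed.

End Boost1.

Section Boost2.
Context {R : realType}.
Notation mu := (@lebesgue_measure R).

Lemma boost1_inv (m c s x : R) : 0 < m -> 0 < c -> c ^+ 2 - s ^+ 2 = 1 ->
  boost1 m c s (boost1 m c (- s) x) = x.
Proof.
by move=> m0 c0 cs; have := @boost1K R m c (- s) m0 c0; rewrite opprK sqrrN; apply.
Qed.

(** Passes from intervals to measurable sets: both sides are measures of A that agree on half-open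
    intervals, and they are finite on bounded intervals because the density is continuous. *)
Lemma integral_boost1 (m c s : R) (A : set R) : 0 < m -> 0 < c -> c ^+ 2 - s ^+ 2 = 1 ->
  measurable A ->
  (\int[mu]_(x in boost1 m c s @^-1` A) ((Num.sqrt (m + x ^+ 2))^-1)%:E
   = \int[mu]_(x in A) ((Num.sqrt (m + x ^+ 2))^-1)%:E)%E.
Proof.
move=> m0 c0 cs mA.
pose r (x : R) := Num.sqrt (m + x ^+ 2).
have r0 x : 0 < r x by rewrite sqrtr_gt0 ltr_pwDl // sqr_ge0.
have cr : continuous r.
  move=> x; apply: continuous_comp; last exact: sqrt_continuous.
  by apply: cvgD; [exact: cvg_cst|exact: exprn_continuous].
have mw : measurable_fun setT (fun x : R => ((r x)^-1)%:E).
  apply/measurable_EFinP; apply: continuous_measurable_fun => x.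
  by apply: cvgV; [rewrite gt_eqF|exact: cr].
have w0 x : (0 <= ((r x)^-1)%:E)%E by rewrite lee_fin invr_ge0 ltW.
pose phi (x : measurableTypeR R) : measurableTypeR R := boost1 m c s x.
have mphi : measurable_fun setT phi.
  by apply: continuous_measurable_fun; exact: cont_boost1.
have [m1 m1E] := density_measure mu mw w0.
pose Hm := isMeasurableFun.Build _ _ _ _ _ mphi.
pose phi' : {mfun _ >-> _} := HB.pack phi Hm.
have inc x y : (boost1 m c s x < boost1 m c s y) = (x < y).
  have M z t : z < t -> boost1 m c s z < boost1 m c s t by exact: boost1_mono.
  apply/idP/idP => [|/M //]; apply: contraTT; rewrite -!leNgt le_eqVlt => /orP[/eqP->//|/M/ltW //].
pose g k := `](- k%:R : R), k%:R]%classic.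
suff H : m1 A = pushforward m1 phi' A by move: H; rewrite /pushforward !m1E.
have incl x y : (boost1 m c s x <= boost1 m c s y) = (x <= y) by rewrite !leNgt inc.
apply: (@measure_unique _ R (measurableTypeR R) (@ocitv R) g) => //.
- exact: ocitvI.
- by move=> k; exists (- k%:R, k%:R).
- by rewrite /g bigcup_itvT.
- move=> _ [[a b] _ <-]; rewrite [RHS]m1E m1E /=.
  set a' := boost1 m c (- s) a; set b' := boost1 m c (- s) b.
  have Ea : boost1 m c s a' = a by exact: boost1_inv.
  have Eb : boost1 m c s b' = b by exact: boost1_inv.
  have E : phi @^-1` `]a, b] = `]a', b']%classic.
    by apply/seteqP; split=> x /=; rewrite /phi !in_itv /= -{1}Ea -{1}Eb inc incl.
  rewrite E; have [ab|ba] := leP a' b'; last first.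
    rewrite !set_itv_ge ?integral_set0 // -leNgt bnd_simp ?(ltW ba) //.
    by rewrite -Ea -Eb incl ltW.
  rewrite !integral_itv_obnd_cbnd; last 2 first.
    by apply: measurable_funTS.
    by apply: measurable_funTS.
  by rewrite -Ea -Eb integral_boost1_itv.
- move=> k; rewrite m1E /g integral_itv_obnd_cbnd; last by apply: measurable_funTS.
  have I : mu.-integrable `[(- k%:R : R), k%:R] (EFin \o (fun x => (r x)^-1)).
    apply: continuous_compact_integrable; first exact: segment_compact.
    by apply: continuous_subspaceT => x; apply: cvgV; [rewrite gt_eqF|exact: cr].
  have := integrable_fin_num _ I; rewrite fin_numE => /(_ (measurable_itv _)) /andP[_].
  by rewrite ltey.
Qed.
End Boost2.

(** * Rotations and boosts of the chart *)

Section PlaneMeasure.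
Context {R : realType}.
Notation mu := (@lebesgue_measure R).
Notation mu2 := (mu \x mu)%E.

Definition shear1 (k : R) (p : R * R) : R * R := (p.1 + k * p.2, p.2).
Definition shear2 (k : R) (p : R * R) : R * R := (p.1, p.2 + k * p.1).

Lemma measurable_shear1 k : measurable_fun setT (shear1 k).
Proof.
apply: measurable_fun_pair; last exact: measurable_snd.
by apply: measurable_funD => //; apply: measurable_funM => //.
Qed.

Lemma measurable_shear2 k : measurable_fun setT (shear2 k).
Proof.
apply: measurable_fun_pair; first exact: measurable_fst.
by apply: measurable_funD => //; apply: measurable_funM => //.
Qed.

Lemma tonelli1 (f : R * R -> \bar R) :
  measurable_fun setT f -> (forall p, 0 <= f p)%E ->
  (\int[mu2]_p f p = \int[mu]_x \int[mu]_y f (x, y))%E.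
Proof. by move=> mf f0; rewrite fubini_tonelli1. Qed.

Lemma tonelli2 (f : R * R -> \bar R) :
  measurable_fun setT f -> (forall p, 0 <= f p)%E ->
  (\int[mu2]_p f p = \int[mu]_y \int[mu]_x f (x, y))%E.
Proof. by move=> mf f0; rewrite tonelli1 //; exact: fubini_tonelli. Qed.

Lemma mem_preimg (T U : Type) (f : T -> U) (A : set U) x :
  (x \in f @^-1` A) = (f x \in A).
Proof. by apply/idP/idP; rewrite !inE. Qed.

Lemma patch_ge0 (T : Type) (f : T -> \bar R) (A : set T) x :
  (forall y, 0 <= f y)%E -> (0 <= (f \_ A) x)%E.
Proof. by move=> f0; rewrite /patch; case: ifP. Qed.

Lemma ge0_integral_shear1 (f : R * R -> \bar R) k :
  measurable_fun setT f -> (forall p, 0 <= f p)%E ->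
  (\int[mu2]_p f (shear1 k p) = \int[mu2]_p f p)%E.
Proof.
move=> mf f0.
have mfs : measurable_fun setT (f \o shear1 k).
  exact: measurableT_comp mf (measurable_shear1 k).
rewrite -[LHS]/(\int[mu2]_p (f \o shear1 k) p)%E.
rewrite (tonelli2 mfs) => [|p]; last exact: f0.
rewrite (tonelli2 mf) //.
apply: eq_integral => y _; rewrite /shear1 /=.
rewrite (@ge0_integral_translation R (fun x => f (x, y))) //.
exact: measurable_fun_pair1.
Qed.

Lemma ge0_integral_shear2 (f : R * R -> \bar R) k :
  measurable_fun setT f -> (forall p, 0 <= f p)%E ->
  (\int[mu2]_p f (shear2 k p) = \int[mu2]_p f p)%E.
Proof.
move=> mf f0.
have mfs : measurable_fun setT (f \o shear2 k).
  exact: measurableT_comp mf (measurable_shear2 k).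
rewrite -[LHS]/(\int[mu2]_p (f \o shear2 k) p)%E.
rewrite (tonelli1 mfs) => [|p]; last exact: f0.
rewrite (tonelli1 mf) //.
apply: eq_integral => x _; rewrite /shear2 /=.
rewrite (@ge0_integral_translation R (fun y => f (x, y))) //.
exact: measurable_fun_pair2.
Qed.

Definition rot2 (c s : R) (p : R * R) : R * R := (c * p.1 - s * p.2, s * p.1 + c * p.2).

(* Rotations are products of shears, for which Fubini and translation invariance suffice. *)
Lemma rot2E (c s : R) : s != 0 -> c ^+ 2 + s ^+ 2 = 1 ->
  rot2 c s = shear1 ((c - 1) / s) \o shear2 s \o shear1 ((c - 1) / s).
Proof.
move=> s0 cs; apply/funext => -[x y]; rewrite /rot2 /shear1 /shear2 /=; congr pair.
  have E : (c - 1) / s * (1 + c) = - s.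
    by apply: (mulIf s0); rewrite mulrAC divfK // mulNr -expr2 -[s ^+ 2](addKr (c ^+ 2)) cs; ring.
  have -> : x + (c - 1) / s * y + (c - 1) / s * (y + s * (x + (c - 1) / s * y)) =
     c * x + (c - 1) / s * (1 + c) * y by field.
  by rewrite E; ring.
by field.
Qed.

Lemma ge0_integral_rot2 (f : R * R -> \bar R) c s : c ^+ 2 + s ^+ 2 = 1 ->
  measurable_fun setT f -> (forall p, 0 <= f p)%E ->
  (\int[mu2]_p f (rot2 c s p) = \int[mu2]_p f p)%E.
Proof.
move=> cs mf f0.
have H (g : R * R -> \bar R) c' s' : s' != 0 -> c' ^+ 2 + s' ^+ 2 = 1 ->
    measurable_fun setT g -> (forall p, 0 <= g p)%E ->
    (\int[mu2]_p g (rot2 c' s' p) = \int[mu2]_p g p)%E.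
  move=> s0 cs' mg g0; rewrite rot2E //=.
  set k := (c' - 1) / s'.
  have m1 : measurable_fun setT (g \o shear1 k) by exact: measurableT_comp mg (measurable_shear1 _).
  have m2 : measurable_fun setT (g \o shear1 k \o shear2 s') by exact: measurableT_comp m1 (measurable_shear2 _).
  rewrite (@ge0_integral_shear1 (g \o shear1 k \o shear2 s')) // => [|p]; last exact: g0.
  rewrite (@ge0_integral_shear2 (g \o shear1 k)) // => [|p]; last exact: g0.
  exact: ge0_integral_shear1.
have [s0|s0] := eqVneq s 0; last exact: H.
move: cs; rewrite s0 expr0n addr0 => /eqP; rewrite sqrf_eq1 => /orP[]/eqP->.
  apply: eq_integral => p _; congr f; case: p => x y; rewrite /rot2 /=; congr pair; ring.
(* In the remaining case c = -1 the half-turn is the square of the quarter-turn [rot2 0 1], which is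
   a product of shears. *)
have n1 : (1 : R) != 0 by rewrite oner_neq0.
have cs1 : (0 : R) ^+ 2 + 1 ^+ 2 = 1 by rewrite expr0n expr1n add0r.
rewrite -[RHS](H f 0 1) //.
have mr : measurable_fun setT (rot2 0 1).
  rewrite rot2E //; apply: measurableT_comp; last exact: measurable_shear1.
  by apply: measurableT_comp; [exact: measurable_shear1|exact: measurable_shear2].
rewrite -[RHS](H (f \o rot2 0 1) 0 1) //.
- apply: eq_integral => p _; rewrite /=; congr f; case: p => x y; rewrite /rot2 /=; congr pair; ring.
- exact: measurableT_comp mf mr.
- by move=> p; exact: f0.
Qed.

Definition wt (p : R * R) : R := (hyp_chart p 2 0)^-1.

Lemma wtE p : wt p = (Num.sqrt (1 + p.1 ^+ 2 + p.2 ^+ 2))^-1.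
Proof. by rewrite /wt !mxE. Qed.

Lemma hyp_chart_gt0 (p : R * R) : 0 < hyp_chart p 2 0.
Proof. by rewrite !mxE /= sqrtr_gt0; have := sqr_ge0 p.1; have := sqr_ge0 p.2; lra. Qed.

Lemma measurable_wt : measurable_fun setT (fun p => (wt p)%:E).
Proof.
apply/measurable_EFinP.
have -> : wt = (fun t : R => (Num.sqrt (1 + t ^+ 2))^-1) \o (@Num.sqrt R) \o (fun p => p.1 ^+ 2 + p.2 ^+ 2).
  by apply/funext => p; rewrite wtE /= sqr_sqrtr ?addrA // addr_ge0 ?sqr_ge0.
apply: measurableT_comp; last first.
  by apply: measurable_funD; apply: measurable_funX.
apply: measurableT_comp; apply: continuous_measurable_fun => x; last exact: sqrt_continuous.
apply: cvgV; first by rewrite gt_eqF // sqrtr_gt0 ltr_pwDl // sqr_ge0.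
apply: continuous_comp; last exact: sqrt_continuous.
by apply: cvgD; [exact: cvg_cst|exact: exprn_continuous].
Qed.

Definition area (A : set (R * R)) : \bar R := (\int[mu2]_(p in A) (wt p)%:E)%E.

Lemma hyp_areaE F : hyp_area F = area (hyp_chart @^-1` F).
Proof. by []. Qed.

Lemma area_rot2 A c s : c ^+ 2 + s ^+ 2 = 1 -> measurable A ->
  area (rot2 c s @^-1` A) = area A.
Proof.
move=> cs mA; rewrite /area [LHS]integral_mkcond [RHS]integral_mkcond.
rewrite -[RHS](@ge0_integral_rot2 _ c s) //.
- apply: eq_integral => p _; rewrite /patch mem_preimg; case: ifP => // _.
  congr EFin; rewrite !wtE /rot2 /=; congr (Num.sqrt _)^-1.
  transitivity (1 + (c ^+ 2 + s ^+ 2) * (p.1 ^+ 2 + p.2 ^+ 2)); first by rewrite cs; ring.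
  by ring.
- by apply: (measurable_restrictT _ _).1 => //; apply: measurable_funTS; exact: measurable_wt.
- by move=> p; apply: patch_ge0 => q; rewrite lee_fin invr_ge0 ltW // hyp_chart_gt0.
Qed.

Definition boost2 (c s : R) (p : R * R) : R * R := (boost1 (1 + p.2 ^+ 2) c s p.1, p.2).

(** Tonelli with the second coordinate outside: each slice is an instance of [integral_boost1]. *)
Lemma area_boost2 A c s : 0 < c -> c ^+ 2 - s ^+ 2 = 1 -> measurable A ->
  measurable (boost2 c s @^-1` A) ->
  area (boost2 c s @^-1` A) = area A.
Proof.
move=> c0 cs mA mB; rewrite /area [LHS]integral_mkcond [RHS]integral_mkcond.
have M B : measurable B -> measurable_fun setT ((fun p => (wt p)%:E) \_ B).
  by move=> mB'; apply: (measurable_restrictT _ _).1 => //; apply: measurable_funTS; exact: measurable_wt.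
have P B p : (0 <= ((fun p => (wt p)%:E) \_ B) p)%E.
  by apply: patch_ge0 => q; rewrite lee_fin invr_ge0 ltW // hyp_chart_gt0.
rewrite (tonelli2 (M _ mB)) // (tonelli2 (M _ mA)) //.
apply: eq_integral => y _.
have m0 : 0 < 1 + y ^+ 2 by rewrite ltr_pwDl // sqr_ge0.
have := @integral_boost1 R _ c s (ysection A y) m0 c0 cs (measurable_ysection y mA).
rewrite [LHS]integral_mkcond [RHS]integral_mkcond => E.
transitivity (\int[mu]_x (((fun x : R => ((Num.sqrt (1 + y ^+ 2 + x ^+ 2))^-1)%:E)
  \_ (boost1 (1 + y ^+ 2) c s @^-1` ysection A y)) x))%E.
  apply: eq_integral => x _; rewrite /patch !mem_preimg mem_ysection /boost2 /=.
  by case: ifP => // _; rewrite wtE /= addrAC.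
rewrite E; apply: eq_integral => x _; rewrite /patch mem_ysection.
by case: ifP => // _; rewrite wtE /= addrAC.
Qed.
End PlaneMeasure.

(** * Area under the full isometry group *)

Section AreaInvariance.
Context {R : realType}.
Implicit Types (g h : 'M[R]_3) (p : R * R) (A : set (R * R)).

Lemma hyp_chart_hyp p : hyperboloid (hyp_chart p).
Proof.
split; last exact: hyp_chart_gt0.
rewrite /form !mxE /= -!expr2 sqr_sqrtr; first by ring.
by have := sqr_ge0 p.1; have := sqr_ge0 p.2; lra.
Qed.

Definition proj2 (x : 'cV[R]_3) : R * R := (x 0 0, x 1 0).

Lemma proj2K x : hyperboloid x -> hyp_chart (proj2 x) = x.
Proof.
move=> [xx x2]; apply: cV3P; rewrite !mxE //=.
have -> : 1 + x 0 0 ^+ 2 + x 1 0 ^+ 2 = x 2 0 ^+ 2.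
  by move: xx; rewrite /form; lra.
by rewrite sqrtr_sqr gtr0_norm.
Qed.

Lemma hyp_chartK p : proj2 (hyp_chart p) = p.
Proof. by case: p => a b; rewrite /proj2 !mxE. Qed.

Definition chart_act g p : R * R := proj2 (g *m hyp_chart p).

Lemma chart_actE g p : SOplus g -> hyp_chart (chart_act g p) = g *m hyp_chart p.
Proof. by move=> [_ _ sg]; rewrite proj2K //; apply: sg; exact: hyp_chart_hyp. Qed.

Lemma chart_actM g h p : SOplus h -> chart_act (g *m h) p = chart_act g (chart_act h p).
Proof. by move=> sh; rewrite {2}/chart_act chart_actE // /chart_act mulmxA. Qed.

Lemma measurable_chart_act g : measurable_fun setT (chart_act g).
Proof.
have mt : measurable_fun setT (fun p : R * R => hyp_chart p 2 0).
  have -> : (fun p : R * R => hyp_chart p 2 0) = @Num.sqrt R \o (fun p => 1 + p.1 ^+ 2 + p.2 ^+ 2).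
    by apply/funext => p; rewrite !mxE.
  apply: measurableT_comp.
    by apply: continuous_measurable_fun; exact: sqrt_continuous.
  by do !apply: measurable_funD => //; apply: measurable_funX.
have M i : measurable_fun setT (fun p : R * R => (g *m hyp_chart p) i 0).
  have -> : (fun p : R * R => (g *m hyp_chart p) i 0) = (fun p => g i 0 * p.1 + g i 1 * p.2 + g i 2 * hyp_chart p 2 0).
    by apply/funext => p; rewrite mulmx3E !mxE.
  by apply: measurable_funD; [apply: measurable_funD|]; apply: measurable_funM.
by apply: measurable_fun_pair; exact: M.
Qed.

Lemma measurable_chart_preimg g A : measurable A -> measurable (chart_act g @^-1` A).
Proof. by move=> mA; rewrite -[X in measurable X]setTI; exact: measurable_chart_act. Qed.

Definition rotm (c s : R) : 'M[R]_3 :=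
  \matrix_(i, j) (nth [::] [:: [:: c; - s; 0]; [:: s; c; 0]; [:: 0; 0; 1]] i)`_j.

Definition boostm (c s : R) : 'M[R]_3 :=
  \matrix_(i, j) (nth [::] [:: [:: c; 0; s]; [:: 0; 1; 0]; [:: s; 0; c]] i)`_j.

Lemma rotmE c s x : rotm c s *m x = vec3 (c * x 0 0 - s * x 1 0) (s * x 0 0 + c * x 1 0) (x 2 0).
Proof. by apply: cV3P; rewrite mulmx3E !mxE /=; ring. Qed.

Lemma boostmE c s x : boostm c s *m x = vec3 (c * x 0 0 + s * x 2 0) (x 1 0) (s * x 0 0 + c * x 2 0).
Proof. by apply: cV3P; rewrite mulmx3E !mxE /=; ring. Qed.

Lemma SOplus_rotm (c s : R) : c ^+ 2 + s ^+ 2 = 1 -> SOplus (rotm c s).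
Proof.
move=> cs; split=> [x y||x [xx x2]].
- rewrite !rotmE /form !vec3E.
  transitivity ((c ^+ 2 + s ^+ 2) * (x 0 0 * y 0 0 + x 1 0 * y 1 0) - x 2 0 * y 2 0); first by ring.
  by rewrite cs mul1r.
- by transitivity (c ^+ 2 + s ^+ 2) => //; rewrite det_mx33 !mxE /=; ring.
- split; last by rewrite rotmE vec3E.
  rewrite !rotmE /form !vec3E -xx /form.
  transitivity ((c ^+ 2 + s ^+ 2) * (x 0 0 * x 0 0 + x 1 0 * x 1 0) - x 2 0 * x 2 0); first by ring.
  by rewrite cs mul1r.
Qed.

Lemma SOplus_boostm (c s : R) : 0 < c -> c ^+ 2 - s ^+ 2 = 1 -> SOplus (boostm c s).
Proof.
move=> c0 cs.
have L : lorentz (boostm c s).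
  split=> [x y|].
    rewrite !boostmE /form !vec3E.
    transitivity ((c ^+ 2 - s ^+ 2) * (x 0 0 * y 0 0 - x 2 0 * y 2 0) + x 1 0 * y 1 0); first by ring.
    by rewrite cs mul1r; ring.
  by transitivity (c ^+ 2 - s ^+ 2) => //; rewrite det_mx33 !mxE /=; ring.
apply: (@lorentz_SOplus _ _ e_null) => //; first exact: light_e_null.
have [n0 n2] := @light_e_null R.
have [f _] := L; split; first by rewrite f.
rewrite boostmE !vec3E mulr1 mulr1.
rewrite ltNge; apply/negP => h; have : c ^+ 2 - s ^+ 2 <= 0; last by rewrite cs ler10.
rewrite subr_sqr mulr_ge0_le0 //; last by rewrite addrC.
by move: h c0; lra.
Qed.

Lemma SOplus_fix_e3 g : SOplus g -> g *m e3 = e3 ->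
  exists c s : R, c ^+ 2 + s ^+ 2 = 1 /\ g = rotm c s.
Proof.
move=> sg ge; have [gf gd _] := sg.
have col i : g i 2 = e3 i 0.
  by have := congr1 (fun x : 'cV[R]_3 => x i 0) ge; rewrite /= mulmx3E !vec3E !mulr0 mulr1 !add0r.
have c0 := col 0; have c1 := col 1; have c2 := col 2; move: c0 c1 c2; rewrite !vec3E => c0 c1 c2.
have row x : form (g *m x) e3 = form x e3 by rewrite -{1}ge gf.
have r0 : g 2 0 = 0 by have := row (vec3 1 0 0); rewrite /form !mulmx3E !vec3E; lra.
have r1 : g 2 1 = 0 by have := row (vec3 0 1 0); rewrite /form !mulmx3E !vec3E; lra.
have := gf (vec3 1 0 0) (vec3 1 0 0); have := gf (vec3 0 1 0) (vec3 0 1 0).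
have := gf (vec3 1 0 0) (vec3 0 1 0); have := gd; rewrite det_mx33 /form !mulmx3E !vec3E.
rewrite c0 c1 c2 r0 r1 => D O N1 N0.
have E : (g 0 0 - g 1 1) ^+ 2 + (g 0 1 + g 1 0) ^+ 2 = 0 by nra.
move/eqP: E; rewrite paddr_eq0 ?sqr_ge0 // !sqrf_eq0 subr_eq0 addr_eq0 => /andP[/eqP E1 /eqP E2].
exists (g 0 0), (g 1 0); split; first by nra.
by apply/matrixP; apply: ord3P; apply: ord3P; rewrite !mxE /=.
Qed.

(** The Cartan decomposition: a rotation and a boost are chosen to carry [e3] to [g *m e3], and what
    remains fixes [e3], so it is a rotation. *)
Lemma SOplus_decomp g : SOplus g ->
  exists c s a b c' s' : R, [/\ c ^+ 2 + s ^+ 2 = 1, 0 < a, a ^+ 2 - b ^+ 2 = 1, c' ^+ 2 + s' ^+ 2 = 1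
    & g = rotm c s *m boostm a b *m rotm c' s'].
Proof.
move=> sg; have [_ _ gh] := sg.
have [yy y2] := gh _ (@hyp_e3 R); set y := g *m e3 in yy y2.
pose r := Num.sqrt (y 0 0 ^+ 2 + y 1 0 ^+ 2).
have r2 : r ^+ 2 = y 0 0 ^+ 2 + y 1 0 ^+ 2 by rewrite sqr_sqrtr // addr_ge0 ?sqr_ge0.
(* The polar angle of the spatial part of [g *m e3]; when that part is 0 the angle is taken to be
   0. *)
have [c [s [cs cr sr]]] : exists c s : R, [/\ c ^+ 2 + s ^+ 2 = 1, c * r = y 0 0 & s * r = y 1 0].
  have [r0|r0] := eqVneq r 0.
    exists 1, 0; rewrite r0 !mulr0 expr1n expr0n addr0.
    move: r2; rewrite r0 expr0n /= => /esym/eqP; rewrite paddr_eq0 ?sqr_ge0 // !sqrf_eq0.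
    by case/andP=> /eqP-> /eqP->.
  exists (y 0 0 / r), (y 1 0 / r); rewrite !divfK //; split=> //.
  by rewrite !expr_div_n -mulrDl -r2 divff // sqrf_eq0.
have ab : (y 2 0) ^+ 2 - r ^+ 2 = 1.
  by rewrite r2; move: yy; rewrite /form; lra.
have sr' := SOplus_rotm cs; have sb := SOplus_boostm y2 ab.
have sm := SOplusM sr' sb; have um := lorentz_unit (SOplus_lorentz sm).
have [||c' [s' [cs' E]]] := @SOplus_fix_e3 (invmx (rotm c s *m boostm (y 2 0) r) *m g).
- exact: SOplusM (SOplusV sm) sg.
- rewrite -mulmxA -/y.
  suff : y = (rotm c s *m boostm (y 2 0) r) *m e3 by move=> Y; rewrite [X in _ *m X = _]Y mulKmx.
  rewrite -mulmxA boostmE rotmE !vec3E; apply: cV3P; rewrite vec3E ?mulr0 ?mulr1 ?add0r ?subr0 ?addr0 //.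
exists c, s, (y 2 0), r, c', s'; split=> //.
by rewrite -E mulKVmx.
Qed.

Lemma area_rotm (c s : R) A : c ^+ 2 + s ^+ 2 = 1 -> measurable A ->
  area (chart_act (rotm c s) @^-1` A) = area A.
Proof.
move=> cs mA; have -> : chart_act (rotm c s) = rot2 c s.
  by apply/funext => p; rewrite /chart_act /proj2 rotmE !vec3E /rot2 ?mxE.
exact: area_rot2.
Qed.

Lemma area_boostm (c s : R) A : 0 < c -> c ^+ 2 - s ^+ 2 = 1 -> measurable A ->
  area (chart_act (boostm c s) @^-1` A) = area A.
Proof.
move=> c0 cs mA.
have E : chart_act (boostm c s) = boost2 c s.
  by apply/funext => p; rewrite /chart_act /proj2 boostmE !vec3E ?mxE /boost2 /boost1 /= addrAC.
by rewrite -(area_boost2 c0 cs mA) -E //; exact: measurable_chart_preimg.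
Qed.

Lemma area_SOplus g A : SOplus g -> measurable A ->
  area (chart_act g @^-1` A) = area A.
Proof.
move=> sg mA; have [c [s [a [b [c' [s' [cs a0 ab cs' ->]]]]]]] := SOplus_decomp sg.
have E : chart_act (rotm c s *m boostm a b *m rotm c' s') =
    chart_act (rotm c s) \o chart_act (boostm a b) \o chart_act (rotm c' s').
  apply/funext => p /=; rewrite -chart_actM; last exact: SOplus_boostm.
  by rewrite -chart_actM //; exact: SOplus_rotm.
have m1 := measurable_chart_preimg (rotm c s) mA.
have m2 := measurable_chart_preimg (boostm a b) m1.
transitivity (area (chart_act (rotm c' s') @^-1` (chart_act (boostm a b) @^-1` (chart_act (rotm c s) @^-1` A)))).
  by rewrite E.
by rewrite (area_rotm cs' m2) (area_boostm a0 ab m1) (area_rotm cs mA).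
Qed.
End AreaInvariance.

(** * Discreteness and finite area *)

Section Norms.
Context {R : realType}.
Implicit Types (A B C : 'M[R]_3) (x y z u v w : 'cV[R]_3) (g h : 'M[R]_3).

(** The entrywise l^1 norm is submultiplicative and unchanged by transposition and sign changes of
    entries, hence by inversion of a Lorentz matrix. *)
Definition nrm A : R := \sum_i \sum_j `|A i j|.

Lemma nrm_ge0 A : 0 <= nrm A.
Proof. by apply: sumr_ge0 => i _; apply: sumr_ge0. Qed.

Lemma entry_le_nrm A i j : `|A i j| <= nrm A.
Proof.
rewrite /nrm (bigD1 i) //= (bigD1 j) //= -addrA lerDl.
by apply: addr_ge0; [apply: sumr_ge0|apply: sumr_ge0 => k _; apply: sumr_ge0].
Qed.

Lemma nrmD A B : nrm (A + B) <= nrm A + nrm B.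
Proof.
rewrite /nrm -big_split; apply: ler_sum => i _ /=; rewrite -big_split.
by apply: ler_sum => j _ /=; rewrite mxE ler_normD.
Qed.

Lemma nrmN A : nrm (- A) = nrm A.
Proof. by apply: eq_bigr => i _; apply: eq_bigr => j _; rewrite mxE normrN. Qed.

Lemma nrmB A B : nrm (A - B) <= nrm A + nrm B.
Proof. by rewrite -(nrmN B) nrmD. Qed.

Lemma nrmZ (a : R) A : nrm (a *: A) = `|a| * nrm A.
Proof.
rewrite /nrm mulr_sumr; apply: eq_bigr => i _; rewrite mulr_sumr.
by apply: eq_bigr => j _; rewrite mxE normrM.
Qed.

Lemma nrmM A B : nrm (A *m B) <= nrm A * nrm B.
Proof.
rewrite /nrm mulr_suml; apply: ler_sum => i _.
apply: (@le_trans _ _ (\sum_j \sum_k `|A i k| * `|B k j|)).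
  apply: ler_sum => j _; rewrite mxE; apply: le_trans (ler_norm_sum _ _ _) _.
  by apply: ler_sum => k _; rewrite normrM.
rewrite exchange_big /= mulr_suml; apply: ler_sum => k _.
rewrite -mulr_sumr ler_wpM2l // [leRHS](bigD1 k) //= lerDl.
by apply: sumr_ge0 => i' _; apply: sumr_ge0.
Qed.

Lemma nrm1 : nrm 1%:M = 3.
Proof. by rewrite /nrm !sum3E !mxE /= !normr0 !normr1; ring. Qed.

Lemma nrm0_eq A : nrm A <= 0 -> A = 0.
Proof.
move=> A0; apply/matrixP => i j; rewrite mxE; apply/eqP; rewrite -normr_le0.
exact: le_trans (entry_le_nrm A i j) A0.
Qed.

Lemma nrm_bnd A (M : R) : (forall i j, `|A i j| <= M) -> nrm A <= 9 * M.
Proof.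
move=> H; rewrite /nrm !sum3E.
move: (H 0 0) (H 0 1) (H 0 2) (H 1 0) (H 1 1) (H 1 2) (H 2 0) (H 2 1) (H 2 2).
lra.
Qed.

Lemma nrm_JTJ A : nrm (mJ *m A^T *m mJ) = nrm A.
Proof.
have E : mJ *m A^T *m mJ = \matrix_(i, j) ((if i == 2 then -1 else 1) * (if j == 2 then -1 else 1) * A j i).
  by apply/matrixP; apply: ord3P; apply: ord3P; rewrite !mxE !sum3E !mxE !sum3E !mxE /=; ring.
rewrite E /nrm exchange_big /=; apply: eq_bigr => i _; apply: eq_bigr => j _.
by rewrite mxE !normrM; case: ifP => _; case: ifP => _; rewrite ?normrN1 ?normr1 !mul1r.
Qed.

Lemma nrm_inv g : lorentz g -> nrm (invmx g) = nrm g.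
Proof. by move=> lg; rewrite lorentz_inv // nrm_JTJ. Qed.

Lemma nrm_inv1 g : lorentz g -> nrm (invmx g - 1%:M) = nrm (g - 1%:M).
Proof.
move=> lg; rewrite lorentz_inv // -[RHS]nrm_JTJ; congr nrm.
have J2 : mJ *m mJ = 1%:M :> 'M[R]_3.
  by apply/matrixP; apply: ord3P; apply: ord3P; rewrite !mxE !sum3E !mxE /=; ring.
by rewrite linearB /= trmx1 mulmxBr mulmxBl mulmx1 J2.
Qed.

Lemma nrm_conj s g : lorentz s -> nrm (s *m g *m invmx s) <= nrm s ^+ 2 * nrm g.
Proof.
move=> ls; apply: le_trans (nrmM _ _) _; rewrite nrm_inv //.
rewrite expr2 [leRHS]mulrAC ler_wpM2r ?nrm_ge0 //; exact: nrmM.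
Qed.

Lemma cross_eq0 u v : cross u v = 0 -> v <> 0 -> exists t, u = t *: v.
Proof.
move=> E v0; have [E0 E1 E2] : [/\ u 1 0 * v 2 0 = u 2 0 * v 1 0,
  u 2 0 * v 0 0 = u 0 0 * v 2 0 & u 1 0 * v 0 0 = u 0 0 * v 1 0].
  have := congr1 (fun x : 'cV[R]_3 => x 0 0) E; have := congr1 (fun x : 'cV[R]_3 => x 1 0) E.
  have := congr1 (fun x : 'cV[R]_3 => x 2 0) E; rewrite /= !vec3E !mxE.
  by move=> /eqP; rewrite subr_eq0 => /eqP-> /eqP; rewrite subr_eq0 => /eqP-> /eqP; rewrite subr_eq0 => /eqP->.
have [z0|n0] := eqVneq (v 0 0) 0; last first.
  exists (u 0 0 / v 0 0); apply: cV3P; rewrite mxE; apply: (mulIf n0); rewrite mulrAC divfK //.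
have [z1|n1] := eqVneq (v 1 0) 0; last first.
  exists (u 1 0 / v 1 0); apply: cV3P; rewrite mxE; apply: (mulIf n1); rewrite mulrAC divfK //.
have [z2|n2] := eqVneq (v 2 0) 0; last first.
  exists (u 2 0 / v 2 0); apply: cV3P; rewrite mxE; apply: (mulIf n2); rewrite mulrAC divfK //.
by case: v0; apply: cV3P; rewrite mxE.
Qed.

(** The orthogonal plane of v is spanned by v and [cross v x], and in it only multiples of v are
    orthogonal to [cross v x]. *)
Lemma perp_light v x d : light_cone v -> hyperboloid x ->
  form d v = 0 -> form d (cross v x) = 0 -> exists t, d = t *: v.
Proof.
move=> lv hx dv dc; have [vv _] := lv; have vx := form_hyp_light hx lv.
apply: cross_eq0; last exact: light_neq0.
have E1 : cross v (cross v x) = - form v x *: v by rewrite cross_cross vv scale0r sub0r scaleNr.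
have := cross_cross d v (cross v x); rewrite dv dc !scale0r subrr E1; move: (cross d) (crossZr d) => c cZ.
rewrite cZ => /eqP; rewrite scaler_eq0 oppr_eq0 formC lt_eqF //= => /eqP //.
Qed.

Lemma lorentz_fix2 g v x : lorentz g -> light_cone v -> hyperboloid x ->
  g *m v = v -> g *m x = x -> g = 1%:M.
Proof.
move=> lg lv hx gv gx; have [gf _] := lg; have [vv _] := lv.
have gc : g *m cross v x = cross v x by rewrite lorentz_cross // gv gx.
apply: mulmx_ext => z; rewrite mul1mx; apply/eqP; rewrite -subr_eq0; apply/eqP.
have F y : g *m y = y -> form (g *m z - z) y = 0.
  by move=> gy; rewrite !formE -{1}gy gf subrr.
have [t E] := perp_light lv hx (F _ gv) (F _ gc).
have := F _ gx; rewrite E !formE => /eqP; rewrite mulf_eq0 (formC v) (lt_eqF (form_hyp_light hx lv)) orbF.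
by move=> /eqP->; rewrite scale0r.
Qed.

Lemma par_eq1 v (t : R) : light_cone v -> par v t = 1%:M -> t = 0.
Proof.
move=> lv E; have [vv v2] := lv; apply/eqP/negPn/negP => t0.
have := @parE _ v t e3 vv; rewrite E mul1mx => /(congr1 (fun y => form y (cross v e3))).
have c0 : form (cross v e3) (cross v e3) = form v e3 ^+ 2.
  by rewrite form_cross2 vv mul0r subr0 formC expr2 (formC e3).
rewrite !formE c0 (formC e3) form_crossr (formC v (cross _ _)) form_crossl mulr0 oppr0 addr0 add0r.
move=> /esym/eqP; rewrite mulf_eq0 (negbTE t0) sqrf_eq0 formC /=.
by rewrite (lt_eqF (form_hyp_light (@hyp_e3 R) lv)).
Qed.

(** Pairing with [cross v x] reads off the parabolic parameter. With this parameter the image of x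
    differs from y by a multiple of v, which must vanish because both points lie on the
    hyperboloid. *)
Lemma par_transport v x y : light_cone v -> hyperboloid x -> hyperboloid y ->
  form y v = form x v -> par v (form y (cross v x) / form v x ^+ 2) *m x = y.
Proof.
move=> lv hx hy e2; have [vv _] := lv; have vx := form_hyp_light hx lv.
set t := _ / _; have vx0 : form v x != 0 by rewrite formC lt_eqF.
have [pf _ ph] := SOplus_par t lv.
have d1 : form (par v t *m x - y) v = 0.
  have e1 := pf x v; rewrite par_fix // in e1.
  by rewrite !formE e1 e2 subrr.
have d2 : form (par v t *m x - y) (cross v x) = 0.
  rewrite parE // !formE form_cross2 vv mul0r subr0 (formC x (cross _ _)) form_crossr.
  rewrite (formC v (cross _ _)) form_crossl mulr0 oppr0 addr0 add0r (formC x v) /t -expr2 divfK ?subrr //.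
  by rewrite expf_neq0.
have [m E] := perp_light lv hx d1 d2.
have E' : par v t *m x = y + m *: v by rewrite -E addrC subrK.
have [yy _] := hy; have [xx _] := hx.
have H := pf x x; rewrite E' !formE xx yy vv !mulr0 (formC v) e2 in H.
have /eqP : m * form x v = 0 by lra.
rewrite mulf_eq0 (formC x) (negbTE vx0) orbF => /eqP m0.
by rewrite E' m0 scale0r addr0.
Qed.

(** The parabolic that agrees with g at [e3] differs from g by a map fixing both v and [e3], which
    is the identity. *)
Lemma stab_par g v : SOplus g -> light_cone v -> g *m v = v -> exists t, g = par v t.
Proof.
move=> sg lv gv; have lg := SOplus_lorentz sg; have [gf _] := lg; have [vv _] := lv.
have hx := @hyp_e3 R; have [_ _ gh] := sg.
have e2 : form (g *m e3) v = form e3 v by have := gf e3 v; rewrite gv.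
have Ex := par_transport lv hx (gh _ hx) e2; set t := (_ / _) in Ex.
exists t; have lp := lorentz_par t vv; have up := lorentz_unit lp.
suff E : invmx (par v t) *m g = 1%:M by rewrite -(mulKVmx up g) E mulmx1.
apply: (@lorentz_fix2 _ v e3) => //.
- by apply: lorentzM => //; exact: lorentzV.
- by rewrite -mulmxA gv; have := mulKmx up v; rewrite par_fix.
- by rewrite -mulmxA -Ex mulKmx.
Qed.

Lemma mcross_comm u v : mcross u *m mcross v - mcross v *m mcross u = mcross (cross u v).
Proof.
apply: mulmx_ext => x; rewrite mulmxBl -!mulmxA !mcrossE.
by apply: cV3P; rewrite !mxE /=; ring.
Qed.
End Norms.

(** * Packing bounds and discreteness *)

Section Packing.
Context {R : realType}.
Implicit Types (a b g h : 'M[R]_3).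

(** Pigeonhole on a grid of mesh d / 9: matrices with the same code differ by at most d / 9 in each
    of their nine entries. *)
Lemma packing (M d : R) : 0 < d -> exists N : nat, forall s : seq 'M[R]_3, uniq s ->
  (forall g, g \in s -> nrm g <= M) ->
  (forall g h, g \in s -> h \in s -> nrm (g - h) <= d -> g = h) -> (size s <= N)%N.
Proof.
move=> d0; have [e e0 de] : exists2 e : R, 0 < e & d = 9 * e.
  by exists (d / 9); [rewrite divr_gt0|rewrite mulrCA divff ?mulr1].
pose c g (i j : 'I_3) := Num.truncn ((g i j + M) / e).
pose L := Num.truncn (2 * M / e).
pose code g : {ffun 'I_3 * 'I_3 -> 'I_L.+1} := [ffun ij => inord (c g ij.1 ij.2)].
exists #|{ffun 'I_3 * 'I_3 -> 'I_L.+1}| => s us sM sep.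
have B g i j : g \in s -> 0 <= (g i j + M) / e /\ (g i j + M) / e <= 2 * M / e.
  move=> /sM gM; have := le_trans (entry_le_nrm g i j) gM; rewrite ler_norml => /andP[g1 g2].
  split; first by rewrite divr_ge0 ?(ltW e0) //; lra.
  by rewrite ler_pM2r ?invr_gt0 //; lra.
have C g i j : g \in s -> nat_of_ord (code g (i, j)) = c g i j.
  move=> gs; have [b0 b1] := B g i j gs.
  by rewrite ffunE inordK // ltnS; exact: le_truncn.
have inj : {in s &, injective code}.
  move=> g h gs hs /ffunP E; apply: sep => //.
  apply: (@le_trans _ _ (9 * e)); last by rewrite de.
  apply: nrm_bnd => i j; rewrite !mxE.
  have := C g i j gs; rewrite E C // => Ec.
  have [g0 _] := B g i j gs; have [h0 _] := B h i j hs.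
  have := truncn_itv g0; have := truncn_itv h0; rewrite -/(c g i j) -/(c h i j) Ec.
  rewrite !ler_pdivlMr // !ltr_pdivrMr // -natr1 => /andP[h1 h2] /andP[g1 g2].
  rewrite ler_norml; apply/andP; split; nra.
rewrite -(size_map code) -(card_uniqP _); last by rewrite map_inj_in_uniq.
exact: max_card.
Qed.

Lemma bounded_size_finite (T : choiceType) (A : set T) (N : nat) :
  (forall s : seq T, uniq s -> (forall x, x \in s -> A x) -> (size s <= N)%N) -> finite_set A.
Proof.
move=> H; apply: contrapT => /(infinite_set_fset N.+1)[B BA sB].
have := H (finmap.enum_fset B) (finmap.fset_uniq B); rewrite leqNgt sB => /(_ _)/negP; case=> //.
Qed.

(** Since a^-1 b - 1 = a^-1 (b - a), a gap around the identity gives a uniform separation among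
    elements of bounded norm. *)
Lemma gap_separated a b (e M : R) : lorentz a -> 0 < M -> nrm a <= M ->
  (nrm (invmx a *m b - 1%:M) <= e -> invmx a *m b = 1%:M) ->
  nrm (a - b) <= e / M -> a = b.
Proof.
move=> la M0 aM H ab; have ua := lorentz_unit la.
suff E : invmx a *m b = 1%:M by rewrite -[b](mulKVmx ua) E mulmx1.
apply: H; have -> : invmx a *m b - 1%:M = invmx a *m (b - a) by rewrite mulmxBr mulVmx.
apply: le_trans (nrmM _ _) _; rewrite nrm_inv // -(nrmN (b - a)) opprB.
apply: (@le_trans _ _ (M * (e / M))); last by rewrite mulrCA divff ?gt_eqF // mulr1.
by apply: ler_pM => //; exact: nrm_ge0.
Qed.
End Packing.

Section Discrete.
Context {R : realType} {n : nat} (G : set 'M[R]_3) (K : 'I_n -> set 'cV[R]_3).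
Hypothesis hR : punctured_surface G K.

Lemma G_lorentz g : G g -> lorentz g.
Proof. by move/(ps_SOplus hR)/SOplus_lorentz. Qed.

Lemma discrete_gap : exists2 e : R, 0 < e & forall g, G g -> nrm (g - 1%:M) <= e -> g = 1%:M.
Proof.
have [_ [V nV VG]] := ps_discrete hR (ps_one hR).
have [e /= e0 eV] := (nbhs_ballP _ _).1 nV.
exists (e / 2); first exact: divr_gt0.
move=> g Gg ge; suff : (V `&` G) g by rewrite VG.
split=> //; apply: eV; split=> // i j; rewrite /ball /= -normrN opprB.
have := le_trans (entry_le_nrm (g - 1%:M) i j) ge; rewrite !mxE => /le_lt_trans; apply.
by rewrite gtr_pMr // invf_lt1 // ltr1n.
Qed.

Lemma finite_bounded (M : R) : finite_set [set g | G g /\ nrm g <= M].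
Proof.
have [e e0 He] := discrete_gap.
pose M' := Num.max M 1; have M'0 : 0 < M' by rewrite lt_max ltr01 orbT.
have [N HN] := @packing R M' (e / M') (divr_gt0 e0 M'0).
apply: (@bounded_size_finite _ _ N) => s us sA; apply: HN => // [g /sA [_ gM]|g h /sA [Gg gM] /sA [Gh _]].
  by rewrite le_max gM.
apply: gap_separated => //; [exact: G_lorentz|by rewrite le_max gM|].
by apply: He; apply: (ps_mul hR) => //; exact: (ps_inv hR).
Qed.

Lemma countable_G : countable G.
Proof.
have -> : G = \bigcup_(k in [set: nat]) [set g | G g /\ nrm g <= k%:R].
  apply/seteqP; split=> [g Gg|g [k _ []] //].
  exists (Num.truncn (nrm g)).+1 => //; split=> //; apply: ltW.
  by have /andP[] := truncn_itv (nrm_ge0 g).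
by apply: bigcup_countable => // k _; apply: finite_set_countable; exact: finite_bounded.
Qed.
End Discrete.

(** * Overlaps in a fundamental domain *)

Section Overlap.
Context {R : realType}.

(** The sum of the indicators is at most N times the indicator of the union; integrate. *)
Lemma overlap_bound d (T : measurableType d) (m : {measure set T -> \bar R})
    (A : nat -> set T) (N : nat) :
  (forall k, measurable (A k)) ->
  (forall x (s : seq nat), uniq s -> (forall k, k \in s -> A k x) -> (size s <= N)%N) ->
  (\sum_(k <oo) m (A k) <= N%:R%:E * m (\bigcup_k A k))%E.
Proof.
move=> mA H; have mU : measurable (\bigcup_k A k) by exact: bigcup_measurable.
have E k : m (A k) = (\int[m]_x (\1_(A k) x)%:E)%E by rewrite integral_indic // setIT.
under eq_eseriesr do rewrite E.
have mI (B : set T) : measurable B -> measurable_fun setT (fun x => (\1_B x)%:E : \bar R).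
  by move=> mB; apply/measurable_EFinP; exact: measurable_indic.
rewrite -integral_nneseries //; last by move=> k; exact: mI.
have -> : m (\bigcup_k A k) = (\int[m]_x (\1_(\bigcup_k A k) x)%:E)%E by rewrite integral_indic // setIT.
rewrite -ge0_integralZl //; last exact: mI.
apply: ge0_le_integral => //.
- by move=> x _; apply: nneseries_ge0.
- by apply: ge0_emeasurable_sum => // k _; exact: mI.
- by apply: measurable_funeM; exact: mI.
move=> x _.
apply: lime_le; first by apply: is_cvg_nneseries.
apply: nearW => k; rewrite big_mkord sumEFin -EFinM lee_fin.
have [xU|xU] := boolP (x \in \bigcup_k A k); last first.
  rewrite big1 ?indicE ?(negbTE xU) ?mulr0 // => i _; rewrite indicE.
  case: (boolP (x \in A i)) => // /set_mem xi.
  by move/negP: xU; case; apply/mem_set; exists i.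
rewrite [\1_(\bigcup_ _ _) x]indicE xU mulr1.
pose s := [seq i <- iota 0 k | x \in A i].
have <- : (size s)%:R = \sum_(i < k) \1_(A i) x :> R.
  rewrite -(big_mkord xpredT (fun i => \1_(A i) x : R)) /index_iota subn0 /s size_filter.
  by elim: (iota 0 k) => [|i l IH] /=; rewrite ?big_nil // big_cons natrD IH indicE.
rewrite ler_nat; apply: (H x); first by rewrite filter_uniq // iota_uniq.
by move=> i; rewrite mem_filter => /andP[/set_mem].
Qed.
End Overlap.

Lemma area_measure (R : realType) :
  exists m : {measure set (measurableTypeR R * measurableTypeR R)%type -> \bar R},
    forall X : set (R * R), area X = m X.
Proof.
have w0 (p : R * R) : (0 <= (wt p)%:E)%E by rewrite lee_fin invr_ge0 ltW // hyp_chart_gt0.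
have [m mE] := density_measure (@lebesgue_measure R \x @lebesgue_measure R)%E (@measurable_wt R) w0.
by exists m => X; rewrite mE.
Qed.

Section AreaOverlap.
Context {R : realType} {n : nat} (G : set 'M[R]_3) (K : 'I_n -> set 'cV[R]_3).
Hypothesis hR : punctured_surface G K.
Variable F : set 'cV[R]_3.
Hypothesis fF : fundamental_domain G F.
Notation F' := (hyp_chart @^-1` F).

Lemma chart_act1 p : chart_act 1%:M p = p :> R * R.
Proof. by rewrite /chart_act mul1mx hyp_chartK. Qed.

Lemma chart_act_fun (g h : 'M[R]_3) p : G g -> G h ->
  F' (chart_act g p) -> F' (chart_act h p) -> g = h.
Proof.
move=> Gg Gh Fg Fh; have [sF _ uF] := fF.
have [y [_ uy]] := uF _ (hyp_chart_hyp p).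
have sg := ps_SOplus hR Gg; have sh := ps_SOplus hR Gh.
have E : g *m hyp_chart p = h *m hyp_chart p.
  rewrite -chart_actE // -chart_actE // -(uy (hyp_chart (chart_act g p))); last first.
    by split=> //; exists g => //; rewrite chart_actE.
  by apply: uy; split=> //; exists h => //; rewrite chart_actE.
have uh := lorentz_unit (SOplus_lorentz sh).
have : invmx h *m g = 1%:M.
  apply: (ps_free hR (x := hyp_chart p)); last by rewrite -mulmxA E mulKmx.
    by apply: (ps_mul hR) => //; exact: (ps_inv hR).
  exact: hyp_chart_hyp.
by move=> E1; rewrite -[g](mulKVmx uh) E1 mulmx1.
Qed.

Lemma chart_act_cover p : exists2 g, G g & F' (chart_act g p).
Proof.
have [sF _ uF] := fF; have [y [[Fy [g Gg gy]] _]] := uF _ (hyp_chart_hyp p).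
by exists g => //; rewrite /preimage /= chart_actE ?gy //; exact: (ps_SOplus hR).
Qed.

(** Folding U into the fundamental domain piece by piece preserves the area of each piece, and every
    point of the domain is hit at most N times. *)
Lemma area_overlap (U : set (R * R)) (N : nat) : measurable U ->
  (forall p (s : seq 'M[R]_3), uniq s -> (forall g, g \in s -> G g /\ U (chart_act g p)) ->
    (size s <= N)%N) ->
  exists E, [/\ measurable E, E `<=` F', forall p, E p -> exists2 g, G g & U (chart_act g p)
    & (area U <= N%:R%:E * area E)%E].
Proof.
move=> mU HN; have [sF mF uF] := fF.
have [f finj] := elimT (countable_injP G) (countable_G hR).
(* [A k] is the part of the domain that the group element coded by k carries into U, and [B k] is
   its image; the sets [B k] tile U. *)
pose A k := [set p | F' p /\ exists g, [/\ G g, f g = k & U (chart_act g p)]].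
pose B k := [set p | U p /\ exists g, [/\ G g, f g = k & F' (chart_act (invmx g) p)]].
have fg g h : G g -> G h -> f g = f h -> g = h by move=> Gg Gh; apply: finj; apply/mem_set.
have AE g : G g -> A (f g) = F' `&` chart_act g @^-1` U.
  move=> Gg; apply/seteqP; split=> p; first move=> [Fp [h [Gh fh Uh]]].
    by split=> //; rewrite -(fg _ _ Gh Gg fh).
  by move=> [Fp Up]; split=> //; exists g.
have BE g : G g -> B (f g) = chart_act (invmx g) @^-1` (A (f g)).
  move=> Gg; rewrite AE //; have sg := ps_SOplus hR Gg.
  have ug := lorentz_unit (SOplus_lorentz sg).
  have Eg p : chart_act g (chart_act (invmx g) p) = p.
    by rewrite -chart_actM ?mulmxV ?chart_act1 //; exact: SOplusV.
  apply/seteqP; split=> p; first move=> [Up [h [Gh fh Fp]]].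
    by move: Fp; rewrite (fg _ _ Gh Gg fh) => Fp; split=> //; rewrite /= Eg.
  by move=> [Fp] /=; rewrite Eg => Up; split=> //; exists g.
have A0 k : ~ (exists2 g, G g & f g = k) -> A k = set0 /\ B k = set0.
  by move=> H; split; apply/seteqP; split=> // p [_ [g [Gg fgk _]]]; case: H; exists g.
have mA k : measurable (A k).
  have [[g Gg <-]|/A0[-> _] //] := pselect (exists2 g, G g & f g = k).
  by rewrite AE //; apply: measurableI => //; exact: measurable_chart_preimg.
have mB k : measurable (B k).
  have [[g Gg <-]|/A0[_ ->] //] := pselect (exists2 g, G g & f g = k).
  by rewrite BE //; exact: measurable_chart_preimg.
have AB k : area (A k) = area (B k).
  have [[g Gg <-]|/A0[-> ->] //] := pselect (exists2 g, G g & f g = k).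
  apply: esym; rewrite (BE g Gg); exact: (area_SOplus (ps_SOplus hR (ps_inv hR Gg)) (mA (f g))).
have UB : U = \bigcup_k B k.
  apply/seteqP; split=> [p Up|p [k _ []] //].
  have [g Gg Fg] := chart_act_cover p; exists (f (invmx g)) => //; split=> //.
  by exists (invmx g); rewrite invmxK; split=> //; exact: (ps_inv hR).
have tB : trivIset setT B.
  move=> j k _ _ [p [[_ [g [Gg <- Fg]]] [_ [h [Gh <- Fh]]]]].
  congr f; have := chart_act_fun (ps_inv hR Gg) (ps_inv hR Gh) Fg Fh.
  by move/(congr1 invmx); rewrite !invmxK.
exists (\bigcup_k A k); split.
- exact: bigcup_measurable.
- by move=> p [k _ []].
- by move=> p [k _ [_ [g [Gg _ Up]]]]; exists g.
have [m mE'] := area_measure R.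
rewrite !mE' {1}UB measure_bigcup //.
rewrite (eq_eseriesl (Q := xpredT)); last by move=> k; rewrite in_setT.
rewrite (eq_eseriesr (g := fun k => m (A k))); last by move=> k _; rewrite -!mE' AB.
  apply: overlap_bound => // p s us sA.
have sG k : k \in s -> exists g, [/\ G g, f g = k & U (chart_act g p)] by move=> /sA[].
have [c Hc] : exists c : nat -> 'M[R]_3, forall k, k \in s -> [/\ G (c k), f (c k) = k & U (chart_act (c k) p)].
  (* Indices outside s receive the placeholder 0. *)
  have [c Hc] := @choice _ _ (fun k g => k \in s -> [/\ G g, f g = k & U (chart_act g p)]) (fun k =>
     match pselect (k \in s) with left e => let: ex_intro g P := sG k e in ex_intro _ g (fun _ => P)
     | right e => ex_intro _ 0 (fun e' => False_ind _ (e e')) end).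
  by exists c.
  rewrite -(size_map c); apply: (HN p).
  rewrite map_inj_in_uniq // => j k js ks E.
  by have [_ <- _] := Hc _ js; have [_ <- _] := Hc _ ks; rewrite E.
  by move=> g /mapP[k ks ->]; have [Gc _ Uc] := Hc _ ks.
by move=> k _; exact: mB.
Qed.
End AreaOverlap.

(** * Returns forced by finite area *)

Section GapReturn.
Context {R : realType} {n : nat} (G : set 'M[R]_3) (K : 'I_n -> set 'cV[R]_3).
Hypothesis hR : punctured_surface G K.

Lemma causal_entry (z : 'cV[R]_3) : form z z <= 0 -> 0 < z 2 0 -> forall i, `|z i 0| <= z 2 0.
Proof.
rewrite /form => zz z2.
have H (a b : R) : a ^+ 2 + b ^+ 2 - z 2 0 ^+ 2 <= 0 -> `|a| <= z 2 0.
  move=> h; rewrite -[leRHS]gtr0_norm // -!sqrtr_sqr ler_sqrt ?sqr_ge0 //.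
  by have := sqr_ge0 b; lra.
apply: ord3P; last by rewrite gtr0_norm.
- by apply: (H _ (z 1 0)); lra.
- by apply: (H _ (z 0 0)); lra.
Qed.

Definition box : set (R * R) := [set p | (`|p.1| <= 1) && (`|p.2| <= 1)].

Lemma box_chart p : box p ->
  [/\ `|hyp_chart p 0 0| <= 1, `|hyp_chart p 1 0| <= 1 & hyp_chart p 2 0 <= 2].
Proof.
move=> /andP[p1 p2]; rewrite !mxE; split=> //=.
rewrite -[leRHS]gtr0_norm // -sqrtr_sqr ler_sqrt; last by rewrite exprn_ge0.
by move: p1 p2; rewrite !ler_norml => /andP[a b] /andP[c d]; nra.
Qed.

(** The null vectors (1, 0, 1), (-1, 0, 1), (0, 1, 1), (0, -1, 1) go to null vectors whose height,
    estimated at the point q, is at most 2 * 2 * 3. Half-sums and half-differences of these images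
    are the columns of b, so its entries stay below 16, and 144 = 9 * 16. *)
Lemma box_bounded (b : 'M[R]_3) p q : SOplus b -> box p -> box q ->
  b *m hyp_chart p = hyp_chart q -> nrm b <= 144.
Proof.
move=> sb bp bq E; have [bf _ bh] := sb.
have [p1 p2 p3] := box_chart bp; have [q1 q2 q3] := box_chart bq.
have C (z : 'cV[R]_3) : light_cone z -> z 2 0 = 1 -> `|z 0 0| + `|z 1 0| <= 1 ->
    forall i, `|(b *m z) i 0| <= 16.
  move=> lz z2 z01 i; have [zz z2'] := SOplus_light sb lz.
  apply: le_trans (causal_entry _ z2' i) _; first by rewrite zz.
  have := form_hyp_causal (hyp_chart_hyp q); move=> /(_ (b *m z)); rewrite zz => /(_ (lexx _) z2') H.
  apply: le_trans H _; rewrite -E bf E /form z2 mulr1.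
  move: p1 p2 p3 q3 (hyp_chart_gt0 q) z01.
  move: (hyp_chart p 0 0) (hyp_chart p 1 0) (hyp_chart p 2 0) (hyp_chart q 2 0) (z 0 0) (z 1 0).
  move=> a1 a2 a3 c3 z0 z1 h1 h2 h3 h4 h5 h6.
  have e0 : - (a1 * z0) <= `|z0|.
    apply: le_trans (ler_norm _) _; rewrite normrN normrM -[leRHS]mul1r ler_wpM2r //.
  have e1 : - (a2 * z1) <= `|z1|.
    apply: le_trans (ler_norm _) _; rewrite normrN normrM -[leRHS]mul1r ler_wpM2r //.
  have -> : -2 * c3 * (a1 * z0 + a2 * z1 - a3) = 2 * c3 * (- (a1 * z0) + - (a2 * z1) + a3) by ring.
  have e2 : - (a1 * z0) + - (a2 * z1) + a3 <= 3 by lra.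
  have [e3|e3] := leP 0 (- (a1 * z0) + - (a2 * z1) + a3); last by nra.
  by apply: (@le_trans _ _ (2 * 2 * 3)); [apply: ler_pM => //; nra|lra].
have L (a c : R) : a ^+ 2 + c ^+ 2 = 1 -> light_cone (vec3 a c 1).
  by move=> ac; split; rewrite /form ?vec3E; [rewrite -!expr2 ac; lra|exact: ltr01].
have Cx : forall i, `|(b *m vec3 1 0 1) i 0| <= 16.
  by apply: C; rewrite ?vec3E ?normr1 ?normr0 ?addr0 //; apply: L; rewrite expr1n expr0n addr0.
have Cx' : forall i, `|(b *m vec3 (-1) 0 1) i 0| <= 16.
  by apply: C; rewrite ?vec3E ?normrN1 ?normr0 ?addr0 //; apply: L; rewrite sqrrN expr1n expr0n addr0.
have Cy : forall i, `|(b *m vec3 0 1 1) i 0| <= 16.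
  by apply: C; rewrite ?vec3E ?normr1 ?normr0 ?add0r //; apply: L; rewrite expr1n expr0n add0r.
have Cy' : forall i, `|(b *m vec3 0 (-1) 1) i 0| <= 16.
  by apply: C; rewrite ?vec3E ?normrN1 ?normr0 ?add0r //; apply: L; rewrite sqrrN expr1n expr0n add0r.
apply: (@le_trans _ _ (9 * 16)); last by lra.
apply: nrm_bnd => i.
move: (Cx i) (Cx' i) (Cy i) (Cy' i); rewrite !mulmx3E !vec3E !ler_norml.
by move=> /andP[? ?] /andP[? ?] /andP[? ?] /andP[? ?]; apply: ord3P; rewrite ler_norml; apply/andP; split; lra.
Qed.

Lemma measurable_box : measurable box.
Proof.
have -> : box = `[(-1 : R), 1]%classic `*` `[(-1 : R), 1]%classic.
  by apply/seteqP; split=> -[x y] /=; rewrite /box /= !in_itv /= !ler_norml; [case/andP|case=> -> ->].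
exact: measurableX.
Qed.

Lemma area_box_gt0 : (0 < area box)%E.
Proof.
have H : ((2^-1)%:E * ((@lebesgue_measure R) \x (@lebesgue_measure R)) box <= area box)%E.
  rewrite -integral_cst; last exact: measurable_box.
  apply: ge0_le_integral => //.
  - exact: measurable_box.
  - by move=> p _; rewrite lee_fin invr_ge0.
  - by apply: measurable_funTS; exact: measurable_wt.
  - move=> p /box_chart[_ _ p2]; rewrite lee_fin lef_pV2 ?posrE ?hyp_chart_gt0 //.
apply: lt_le_trans H; apply: mule_gt0; first by rewrite lte_fin invr_gt0.
have -> : box = `[(-1 : R), 1]%classic `*` `[(-1 : R), 1]%classic.
  by apply/seteqP; split=> -[x y] /=; rewrite /box /= !in_itv /= !ler_norml; [case/andP|case=> -> ->].
have H : (0 < (@lebesgue_measure R) `[(-1 : R)%R, 1%R]%classic)%E.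
  rewrite lebesgue_measure_itv /= lte_fin.
  have -> : (-1 < 1 :> R) by lra.
  by rewrite -EFinB lte_fin; lra.
by rewrite product_measure1E //; apply: mule_gt0; exact: H.
Qed.

(* In frames with a uniform gap around the identity, boxes embed in the surface
   with bounded multiplicity, so finite area forces two of them to meet. *)
Lemma gap_return (s : nat -> 'M[R]_3) (e : R) : 0 < e -> (forall k, SOplus (s k)) ->
  (forall k g, G g -> nrm (invmx (s k) *m g *m s k - 1%:M) <= e -> g = 1%:M) ->
  exists j k, exists2 g, G g & (j < k)%N /\ nrm (invmx (s j) *m g *m s k) <= 144.
Proof.
move=> e0 ss gap; apply: contrapT => nret.
have [F fF aF] := ps_area hR; have [sF mF uF] := fF.
have p144 : (0 : R) < 144 by lra.
have [N HN] := @packing R 144 (e / 144) (divr_gt0 e0 p144).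
pose U k := chart_act (invmx (s k)) @^-1` box.
have mU k : measurable (U k) by apply: measurable_chart_preimg; exact: measurable_box.
have aU k : area (U k) = area box by apply: area_SOplus; [exact: SOplusV|exact: measurable_box].
have us k : s k \in unitmx by exact: lorentz_unit (SOplus_lorentz (ss k)).
have B j k p g h : G g -> G h -> U j (chart_act g p) -> U k (chart_act h p) ->
    nrm (invmx (s j) *m (g *m invmx h) *m s k) <= 144.
  move=> Gg Gh Ug Uh; have sg := ps_SOplus hR Gg; have sh := ps_SOplus hR Gh.
  have uh := lorentz_unit (SOplus_lorentz sh).
  apply: (box_bounded _ Uh Ug).
    by apply: SOplusM => //; apply: SOplusM; [exact: SOplusV|apply: SOplusM => //; exact: SOplusV].
  rewrite !chart_actE //; try exact: SOplusV.
  by rewrite -!mulmxA mulKVmx // mulKmx.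
have H k := @area_overlap R n G K hR F fF (U k) N (mU k).
have {}H k : exists E, [/\ measurable E, E `<=` hyp_chart @^-1` F, forall p, E p -> exists2 g, G g & U k (chart_act g p)
    & (area box <= N%:R%:E * area E)%E].
  rewrite -(aU k); apply: H => p l ul lU.
  case: l ul lU => // h0 l; set l' := h0 :: l => ul lU.
  have h0l : h0 \in l' by rewrite inE eqxx.
  have [G0 U0] := lU _ h0l; have uh0 := lorentz_unit (G_lorentz hR G0).
  (* Read in the frame [s k], the elements bringing p into [U k] become bounded and separated, so
     one N serves for all k. *)
  pose c (g : 'M[R]_3) := invmx (s k) *m (g *m invmx h0) *m s k.
  have ci : injective c.
    move=> g h /(congr1 (fun x => s k *m x *m invmx (s k) *m h0)).
    by rewrite /c !mulmxA !mulmxV // !mul1mx !mulmxK // !mulmxKV.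
  rewrite -(size_map c); apply: HN; first by rewrite map_inj_uniq.
    by move=> _ /mapP[g gl ->]; have [Gg Ug] := lU _ gl; exact: (B _ _ p).
  move=> _ _ /mapP[g gl ->] /mapP[h hl ->]; have [Gg Ug] := lU _ gl; have [Gh Uh] := lU _ hl.
  have lc x : G x -> lorentz (c x).
    move=> Gx; apply: lorentzM; last exact: SOplus_lorentz.
    apply: lorentzM; first by apply: lorentzV; exact: SOplus_lorentz.
    by apply: (G_lorentz hR); apply: (ps_mul hR) => //; exact: (ps_inv hR).
  apply: gap_separated => //; [exact: lc|exact: (B _ _ p)|].
  have ug := lorentz_unit (G_lorentz hR Gg).
  have -> : invmx (c g) *m c h = invmx (s k) *m (h0 *m invmx g *m h *m invmx h0) *m s k.
    rewrite /c !invmxM ?invmxK ?unitmx_mul ?unitmx_inv ?us ?ug ?uh0 //.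
    by rewrite -!mulmxA mulKVmx //.
  move=> /gap ->; first by rewrite mulmx1 mulVmx.
  by do !apply: (ps_mul hR) => //; exact: (ps_inv hR).
have [E HE] := choice H.
(* A common point of two of these sets would be a return between their frames. Disjoint sets of area
   at least [area box] / N then exceed the finite area of the domain. *)
have tE : trivIset setT E.
  move=> j k _ _ [p [Ej Ek]].
  have [_ _ /(_ p Ej)[g Gg Ug] _] := HE j; have [_ _ /(_ p Ek)[h Gh Uh] _] := HE k.
  have [jk|kj|//] := ltngtP j k; exfalso; apply: nret.
    exists j, k, (g *m invmx h); first by apply: (ps_mul hR) => //; exact: (ps_inv hR).
    by split=> //; exact: (B _ _ p).
  exists k, j, (h *m invmx g); first by apply: (ps_mul hR) => //; exact: (ps_inv hR).
  by split=> //; exact: (B _ _ p).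
have [m mE] := area_measure R.
rewrite hyp_areaE mE in aF.
have mEk k : measurable (E k) by have [] := HE k.
have EF k : E k `<=` hyp_chart @^-1` F by have [] := HE k.
have aE k : (area box <= N%:R%:E * m (E k))%E by have [] := HE k; rewrite (mE (E k)).
have le_mF J : (\sum_(0 <= k < J) m (E k) <= m (hyp_chart @^-1` F))%E.
  apply: (@le_trans _ _ (\sum_(k <oo) m (E k))%E); first exact: nneseries_lim_ge.
  have -> : (\sum_(k <oo) m (E k))%E = m (\bigcup_k E k).
    rewrite measure_bigcup //.
      by apply: eq_eseriesl => k; rewrite in_setT.
    by move=> k _; exact: mEk.
  apply: le_measure; rewrite ?inE //; last by move=> p [k _ /EF].
  by apply: bigcup_measurable => k _; exact: mEk.
have fE k : m (E k) \is a fin_num.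
  rewrite ge0_fin_numE //; apply: le_lt_trans aF; apply: le_trans (le_mF k.+1).
  by rewrite big_nat_recr //= leeDr // sume_ge0.
have fF' : m (hyp_chart @^-1` F) \is a fin_num by rewrite ge0_fin_numE.
have fb : area box \is a fin_num.
  rewrite ge0_fin_numE ?ltW ?area_box_gt0 //; apply: le_lt_trans (aE 0%N) _.
  by rewrite -(fineK (fE 0%N)) -EFinM ltry.
have b0 : 0 < fine (area box) by rewrite fine_gt0 // area_box_gt0 /= -ge0_fin_numE // ltW // area_box_gt0.
have bE k : fine (area box) <= N%:R * fine (m (E k)).
  by rewrite -lee_fin EFinM !fineK.
have {}le_mF J : J%:R * fine (area box) <= N%:R * fine (m (hyp_chart @^-1` F)).
  apply: (@le_trans _ _ (N%:R * \sum_(0 <= k < J) fine (m (E k)))).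
    rewrite mulr_sumr -[J in leLHS]subn0 mulr_natl -sumr_const_nat.
    by apply: ler_sum => k _; exact: bE.
  rewrite ler_wpM2l // -lee_fin fineK // -sumEFin.
  by under eq_bigr do rewrite fineK //; exact: le_mF.
pose Q := N%:R * fine (m (hyp_chart @^-1` F)) / fine (area box).
have Q0 : 0 <= Q by rewrite divr_ge0 ?(ltW b0) // mulr_ge0 // fine_ge0.
have := le_mF (Num.truncn Q).+1; rewrite -ler_pdivlMr // leNgt.
by have /andP[_ ->] := truncn_itv Q0.
Qed.
End GapReturn.

(** * Axes of small elements *)

Section AxisNorm.
Context {R : realType}.
Implicit Types (g h : 'M[R]_3) (x w : 'cV[R]_3).

Definition vnrm x : R := `|x 0 0| + `|x 1 0| + `|x 2 0|.

Lemma vnrm_ge0 x : 0 <= vnrm x. Proof. by rewrite !addr_ge0. Qed.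

Lemma vnrmZ (t : R) x : vnrm (t *: x) = `|t| * vnrm x.
Proof. by rewrite /vnrm !mxE !normrM !mulrDr. Qed.

Lemma nrm_mcross w : nrm (mcross w) = 2 * vnrm w.
Proof. rewrite /nrm !sum3E !mcross_entry !normrN !normr0 /vnrm; ring. Qed.

Lemma mulmx_entry_le g x (M : R) i : (forall j, `|x j 0| <= M) -> `|(g *m x) i 0| <= nrm g * M.
Proof.
move=> xM; have M0 : 0 <= M by apply: le_trans (xM 0).
rewrite mxE; apply: le_trans (ler_norm_sum _ _ _) _.
apply: (@le_trans _ _ (\sum_j `|g i j| * M)).
  by apply: ler_sum => j _; rewrite normrM ler_wpM2l.
rewrite -mulr_suml ler_wpM2r // /nrm [leRHS](bigD1 i) //= lerDl.
by apply: sumr_ge0 => k _; apply: sumr_ge0.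
Qed.

Lemma mcross0 : mcross 0 = 0 :> 'M[R]_3.
Proof. by rewrite -(scale0r 0) mcrossZ scale0r. Qed.

(** Solves [axis_CH] for g - 1; the sign of the trace keeps the denominator tr g + 1 at least 1. *)
Lemma axis_bound g : lorentz g -> 0 <= \tr g -> nrm (g - 1%:M) <= vnrm (axis g) + 2 * vnrm (axis g) ^+ 2.
Proof.
move=> lg tg; have t1 : 0 < \tr g + 1 by lra.
have E : 2 *: (g - 1%:M) = mcross (axis g) + (\tr g + 1)^-1 *: (mcross (axis g) *m mcross (axis g)).
  rewrite axis_CH // scalerA mulVf ?gt_eqF // scale1r -axisP //.
  by apply/matrixP => i j; rewrite !mxE; ring.
have : nrm (2 *: (g - 1%:M)) <= 2 * vnrm (axis g) + 4 * vnrm (axis g) ^+ 2.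
  rewrite E; apply: le_trans (nrmD _ _) _; rewrite nrm_mcross lerD2l nrmZ.
  have -> : 4 * vnrm (axis g) ^+ 2 = 1 * ((2 * vnrm (axis g)) * (2 * vnrm (axis g))) by ring.
  apply: ler_pM; rewrite ?nrm_ge0 ?normr_ge0 //.
    by rewrite ger0_norm ?invr_ge0 ?(ltW t1) // invf_le1 //; lra.
  by rewrite -nrm_mcross; exact: nrmM.
by rewrite nrmZ ger0_norm //; lra.
Qed.

Lemma axis_neq0 g : lorentz g -> 0 <= \tr g -> g <> 1%:M -> axis g <> 0.
Proof.
move=> lg tg g1 a0; apply: g1; apply/eqP; rewrite -subr_eq0; apply/eqP/nrm0_eq.
apply: le_trans (axis_bound lg tg) _; rewrite a0 /vnrm !mxE normr0 !addr0 expr0n mulr0 addr0 //.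
Qed.

Lemma axis_le g : lorentz g -> vnrm (axis g) <= nrm (g - 1%:M).
Proof.
move=> lg; have : 2 * vnrm (axis g) <= 2 * nrm (g - 1%:M); last by lra.
rewrite -nrm_mcross -axisP //.
have -> : g - invmx g = (g - 1%:M) - (invmx g - 1%:M) by apply/matrixP => i j; rewrite !mxE; ring.
by apply: le_trans (nrmB _ _) _; rewrite nrm_inv1 //; lra.
Qed.

(** The skew parts of g and h commute as well, and the commutator of their matrices is the matrix of
    the cross product of the axes. *)
Lemma comm_axis g h : lorentz g -> lorentz h -> g *m h = h *m g -> cross (axis g) (axis h) = 0.
Proof.
move=> lg lh gh; have ug := lorentz_unit lg; have uh := lorentz_unit lh.
have e1 : invmx g *m h = h *m invmx g.
  by have := congr1 (fun A => invmx g *m A *m invmx g) gh; rewrite /= mulKmx // (mulmxA _ h g) mulmxK // => ->.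
have e2 : g *m invmx h = invmx h *m g.
  by have := congr1 (fun A => invmx h *m A *m invmx h) gh; rewrite /= mulKmx // (mulmxA _ g h) mulmxK // => ->.
have e3 : invmx g *m invmx h = invmx h *m invmx g by rewrite -!invmxM // gh.
apply: mcross_inj; rewrite mcross0 -mcross_comm -!axisP //.
rewrite !mulmxBl !mulmxBr gh e1 e2 e3.
by apply/matrixP => i j; rewrite !mxE; ring.
Qed.

Lemma axis_fix g : lorentz g -> g *m axis g = axis g.
Proof. by move=> lg; rewrite -axis_conj // mulmxK // lorentz_unit. Qed.

Lemma trace_ge0 g : nrm (g - 1%:M) <= 1 -> 0 <= \tr g.
Proof.
move=> g1; have H i : 0 <= g i i.
  have := le_trans (entry_le_nrm (g - 1%:M) i i) g1; rewrite !mxE eqxx ler_norml => /andP[h _].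
  by move: h; rewrite mulr1n; lra.
by rewrite /mxtrace sum3E !addr_ge0.
Qed.

Lemma seq_min (T : eqType) (f : T -> R) (x : T) (l : seq T) : x \in l ->
  exists2 y, y \in l & forall z, z \in l -> f y <= f z.
Proof.
elim: l x => [//|a l IH] x _; case: l IH => [|b l] IH.
  by exists a; rewrite ?inE // => z; rewrite inE => /eqP->.
have [y yl Hy] := IH b (mem_head _ _).
have [ay|ya] := leP (f a) (f y).
  exists a; rewrite ?inE ?eqxx // => z; rewrite in_cons => /orP[/eqP-> //|/Hy]; exact: le_trans.
exists y; first by rewrite in_cons yl orbT.
by move=> z; rewrite in_cons => /orP[/eqP->|/Hy //]; exact: ltW.
Qed.
End AxisNorm.

Section Frames.
Context {R : realType}.
Implicit Types (v : 'cV[R]_3).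

(** The boost of rapidity k log 2. Composed with a rotation r, these are frames along the geodesic
    ray towards the ideal point of [r *m e_null]. *)
Definition boostk (k : nat) : 'M[R]_3 :=
  boostm ((2 ^+ k + (2 ^+ k)^-1) / 2) ((2 ^+ k - (2 ^+ k)^-1) / 2).

Lemma pow2_ge1 k : 1 <= 2 ^+ k :> R.
Proof. by apply: exprn_ege1; rewrite ler1n. Qed.

Lemma pow2V_le1 k : 0 < (2 ^+ k : R)^-1 <= 1.
Proof. by rewrite invr_gt0 exprn_gt0 //= invf_le1 ?pow2_ge1 ?exprn_gt0. Qed.

Lemma SOplus_boostk k : SOplus (boostk k).
Proof.
have h := pow2_ge1 k; have /andP[h1 _] := pow2V_le1 k.
apply: SOplus_boostm; first by lra.
have p0 : 2 ^+ k != 0 :> R by rewrite expf_neq0.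
by field.
Qed.

Lemma boostk_null k : boostk k *m e_null = 2 ^+ k *: e_null.
Proof. by rewrite boostmE; apply: cV3P; rewrite !mxE /=; field; rewrite ?expf_neq0. Qed.

Lemma boostkS k : boostk k.+1 = boostk k *m boostk 1.
Proof.
have p0 : 2 ^+ k != 0 :> R by rewrite expf_neq0.
apply: mulmx_ext => x; rewrite -mulmxA /boostk !boostmE; apply: cV3P; rewrite !mxE /= ?exprS ?expr1; by field.
Qed.

Lemma nrm_boostk k : nrm (boostk k) <= 3 * 2 ^+ k.
Proof.
rewrite /nrm !sum3E !mxE /= !normr0 normr1.
have h := pow2_ge1 k; have /andP[h1 h2] := pow2V_le1 k.
rewrite !ger0_norm; lra.
Qed.

Lemma nrm_boost1 : nrm (boostk 1) = 5.
Proof.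
rewrite /nrm !sum3E !mxE /= !normr0 normr1 expr1 !ger0_norm; [by field| |]; lra.
Qed.

Lemma frame_rot v : light_cone v -> exists r, [/\ SOplus r, nrm r <= 5 & v = v 2 0 *: (r *m e_null)].
Proof.
move=> [vv v2]; have v20 : v 2 0 != 0 by rewrite gt_eqF.
have cs : (v 0 0 / v 2 0) ^+ 2 + (v 1 0 / v 2 0) ^+ 2 = 1.
  rewrite !expr_div_n -mulrDl; apply: (mulIf (expf_neq0 2 v20)); rewrite divfK ?expf_neq0 // mul1r.
  by move: vv; rewrite /form; lra.
exists (rotm (v 0 0 / v 2 0) (v 1 0 / v 2 0)); split; first exact: SOplus_rotm.
- have A (a b : R) : a ^+ 2 + b ^+ 2 = 1 -> `|a| <= 1.
    by move=> h; rewrite -[leRHS]normr1 -!sqrtr_sqr ler_sqrt ?expr1n //; have := sqr_ge0 b; lra.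
  have h1 := A _ _ cs; have h2 := A _ _ (etrans (addrC _ _) cs).
  by rewrite /nrm !sum3E !mxE /= normrN !normr0 normr1; lra.
- rewrite rotmE; apply: cV3P; rewrite !mxE /=; by field.
Qed.
End Frames.

Section Commutator.
Context {R : realType}.
Implicit Types A B : 'M[R]_3.

Lemma nrm_le4 A : nrm (A - 1%:M) <= 1 -> nrm A <= 4.
Proof.
have {2}-> : A = (A - 1%:M) + 1%:M by rewrite subrK.
by move=> h1; apply: le_trans (nrmD _ _) _; rewrite nrm1; lra.
Qed.

(** The commutator minus 1 is the bracket of A - 1 and B - 1 times A^-1 B^-1. The bracket has two
    terms and each inverse has norm at most 4, whence 32 = 2 * 4 * 4. *)
Lemma commutator_bound A B : lorentz A -> lorentz B ->
  nrm (A - 1%:M) <= 1 -> nrm (B - 1%:M) <= 1 ->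
  nrm (A *m B *m invmx A *m invmx B - 1%:M) <= 32 * (nrm (A - 1%:M) * nrm (B - 1%:M)).
Proof.
move=> lA lB A1 B1; have uA := lorentz_unit lA; have uB := lorentz_unit lB.
have -> : A *m B *m invmx A *m invmx B - 1%:M =
    ((A - 1%:M) *m (B - 1%:M) - (B - 1%:M) *m (A - 1%:M)) *m (invmx A *m invmx B).
  have -> : (A - 1%:M) *m (B - 1%:M) - (B - 1%:M) *m (A - 1%:M) = A *m B - B *m A.
    by rewrite !mulmxBl !mulmxBr !mulmx1 !mul1mx; apply/matrixP => i j; rewrite !mxE; ring.
  by rewrite mulmxBl !mulmxA mulmxK // mulmxV.
have a0 := nrm_ge0 (A - 1%:M); have b0 := nrm_ge0 (B - 1%:M).
apply: le_trans (nrmM _ _) _.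
apply: (@le_trans _ _ ((nrm (A - 1%:M) * nrm (B - 1%:M) + nrm (B - 1%:M) * nrm (A - 1%:M)) * (4 * 4))); last by lra.
apply: ler_pM; rewrite ?nrm_ge0 //.
  by apply: le_trans (nrmB _ _) _; apply: lerD; exact: nrmM.
by apply: le_trans (nrmM _ _) _; rewrite !nrm_inv //; apply: ler_pM; rewrite ?nrm_ge0 // nrm_le4.
Qed.
End Commutator.

(** * A parabolic fixing a direction whose orbit has height bounded below *)

Section Dichotomy.
Context {R : realType} {n : nat} (G : set 'M[R]_3) (K : 'I_n -> set 'cV[R]_3).
Hypothesis hR : punctured_surface G K.
Variable v0 : 'cV[R]_3.
Hypothesis lv0 : light_cone v0.
Variable c0 : R.
Hypothesis c00 : 0 < c0.
Hypothesis low : forall g, G g -> c0 <= (g *m v0) 2 0.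
Variable r : 'M[R]_3.
Hypothesis sr : SOplus r.
Hypothesis nr : nrm r <= 5.
Variable t : R.
Hypothesis t0 : 0 < t.
Hypothesis rv : v0 = t *: (r *m e_null).
Variable s : nat -> 'M[R]_3.
Hypothesis sE : forall k, s k = r *m boostk k.
Variable e1 : R.
Hypothesis e10 : 0 < e1.
(** 25 is the squared norm of [boostk 1], the loss in passing to the next frame. The bound 1/64
    turns the factor 32 of [commutator_bound] into a contraction by 1/2. *)
Hypothesis e1s : 25 * e1 <= 1/64.

Let e11 : e1 <= 1. Proof. by move: e10 e1s; lra. Qed.

Let ss k : SOplus (s k). Proof. by rewrite sE; apply: SOplusM => //; exact: SOplus_boostk. Qed.
Let us k : s k \in unitmx. Proof. exact: lorentz_unit (SOplus_lorentz (ss k)). Qed.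
Let C k g := invmx (s k) *m g *m s k.
Let D (g : 'M[R]_3) := nrm (g - 1%:M).

Let lC k g : G g -> lorentz (C k g).
Proof.
move=> Gg; apply: lorentzM; last exact: SOplus_lorentz.
by apply: lorentzM; [apply: lorentzV; exact: SOplus_lorentz|exact: G_lorentz hR _ Gg].
Qed.

Let CM k g h : C k (g *m h) = C k g *m C k h.
Proof. by rewrite /C !mulmxA mulmxK. Qed.

Let C1 k g : C k g = 1%:M -> g = 1%:M.
Proof.
move=> /(congr1 (fun A => s k *m A *m invmx (s k))).
by rewrite /C !mulmxA mulmxV // mul1mx mulmxK // mulmx1 mulmxV.
Qed.

Let CV k g : G g -> C k (invmx g) = invmx (C k g).
Proof.
move=> Gg; have ug := lorentz_unit (G_lorentz hR Gg).
by rewrite /C !invmxM ?invmxK ?mulmxA // ?unitmx_mul ?unitmx_inv ?us ?ug.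
Qed.

Let nrms k : nrm (s k) <= 15 * 2 ^+ k.
Proof.
rewrite sE; apply: le_trans (nrmM _ _) _.
have -> : 15 * 2 ^+ k = 5 * (3 * 2 ^+ k) :> R by ring.
by apply: ler_pM; rewrite ?nrm_ge0 // nrm_boostk.
Qed.

(* s_k moves the fixed null vector onto 2^k v0, so a bounded s_j^-1 g s_k brings
   g v0 down to height O(2^(j-k)). *)
Let return_gap : exists2 Q : R, 0 <= Q & forall j k g, G g ->
  nrm (invmx (s j) *m g *m s k) <= 144 -> c0 * 2 ^+ k <= Q * 2 ^+ j.
Proof.
exists (t * (15 * 144)); first by rewrite !mulr_ge0 // ltW.
move=> j k g Gg; set b := invmx (s j) *m g *m s k => bb.
have p0 : 0 < 2 ^+ k :> R by rewrite exprn_gt0.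
have E : 2 ^+ k *: (g *m v0) = t *: (s j *m (b *m e_null)).
  have skE : t *: (s k *m e_null) = 2 ^+ k *: v0.
    by rewrite sE -mulmxA boostk_null -scalemxAr rv !scalerA mulrC.
  transitivity (g *m (t *: (s k *m e_null))); first by rewrite skE -scalemxAr.
  by rewrite -scalemxAr /b -!mulmxA mulKVmx.
have := low Gg; rewrite -(ler_pM2r p0) => /le_trans; apply.
have := congr1 (fun x : 'cV[R]_3 => x 2 0) E; rewrite /= !mxE mulrC => ->.
rewrite -mulrA ler_wpM2l ?(ltW t0) //.
apply: le_trans (ler_norm _) _.
rewrite mulrAC -[leRHS]mulr1.
have H : forall i, `|(b *m e_null) i 0| <= 144.
  move=> i; apply: (@le_trans _ _ (nrm b * 1)); last by rewrite mulr1.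
  by apply: mulmx_entry_le; apply: ord3P; rewrite vec3E ?normr1 ?normr0.
have := @mulmx_entry_le R (s j) _ _ 2 H; rewrite [X in `|X| <= _]mxE mulr1 => /le_trans; apply.
by rewrite ler_wpM2r.
Qed.

(** If frames with gap e occurred arbitrarily far out, [gap_return] along a subsequence of them
    would give a return between two of these frames, which [return_gap] forbids once the indices are
    J apart. *)
Let shrink (e : R) : 0 < e -> exists k0, forall k, (k0 <= k)%N ->
  exists g, [/\ G g, g <> 1%:M & D (C k g) <= e].
Proof.
move=> e0; apply: contrapT => H.
have big k0 : exists k, (k0 <= k)%N /\ forall g, G g -> D (C k g) <= e -> g = 1%:M.
  apply: contrapT => H'; apply: H; exists k0 => k k0k; apply: contrapT => H''; apply: H'.
  by exists k; split=> // g Gg ge; apply: contrapT => g1; apply: H''; exists g.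
have [phi Hphi] := choice big.
have [Q Q0 HQ] := return_gap.
have [x x0 xQ] : exists2 x, 0 <= x & Q = x * c0.
  by exists (Q / c0); rewrite ?divr_ge0 ?(ltW c00) // divfK // gt_eqF.
(* J is chosen so that 2^J exceeds the ratio Q / c0 of the constants in [return_gap]. *)
pose J := (Num.truncn x).+1.
have xJ : x < 2 ^+ J.
  have /andP[_ h] := truncn_itv x0; apply: lt_le_trans h _.
  by rewrite -natrX ler_nat ltnW // ltn_expl.
pose fix idx (i : nat) : nat := if i is i'.+1 then phi (idx i' + J)%N else phi 0%N.
have idxS i : (idx i + J <= idx i.+1)%N by have [] := Hphi (idx i + J)%N.
have idxlt i j : (i < j)%N -> (idx i + J <= idx j)%N.
  elim: j => // j IH; rewrite ltnS leq_eqVlt => /orP[/eqP-> //|/IH h].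
  by apply: leq_trans h _; apply: leq_trans (idxS j); exact: leq_addr.
have gapi i g : G g -> nrm (invmx (s (idx i)) *m g *m s (idx i) - 1%:M) <= e -> g = 1%:M.
  by case: i => [|i] /=; [have [_] := Hphi 0%N|have [_] := Hphi (idx i + J)%N] => h; apply: h.
have [i [j [g Gg [ij bb]]]] := @gap_return R n G K hR (fun i => s (idx i)) e e0 (fun i => ss (idx i)) gapi.
have := HQ _ _ _ Gg bb; rewrite leNgt => /negP; apply.
rewrite xQ mulrAC [ltRHS]mulrC ltr_pM2r //.
apply: (@lt_le_trans _ _ (2 ^+ J * 2 ^+ idx i)).
  by rewrite ltr_pM2r // exprn_gt0.
by rewrite -exprD ler_eXn2l ?ltr1n // addnC idxlt.
Qed.

Let minimal k := [set g | [/\ G g, g <> 1%:M, D (C k g) <= e1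
   & forall h, G h -> h <> 1%:M -> D (C k g) <= D (C k h)]].

Let minimal_ex : exists k0, forall k, (k0 <= k)%N -> exists g, minimal k g.
Proof.
have [k0 H] := shrink e10; exists k0 => k /H[g1 [G1 g11 Dg1]].
have : finite_set [set g | [/\ G g, g <> 1%:M & D (C k g) <= e1]].
  apply: sub_finite_set (finite_bounded hR (nrm (s k) ^+ 2 * 4)) => g [Gg _ Dg]; split=> //.
  have -> : g = s k *m C k g *m invmx (s k) by rewrite /C !mulmxA mulmxV // mul1mx mulmxK.
  apply: le_trans (nrm_conj _ (SOplus_lorentz (ss k))) _.
  rewrite ler_wpM2l ?sqr_ge0 //.
  have -> : C k g = (C k g - 1%:M) + 1%:M by rewrite subrK.
  by apply: le_trans (nrmD _ _) _; rewrite nrm1; move: Dg e11; rewrite /D; lra.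
move=> /finite_seqP[l lE].
have g1l : g1 \in l by have : [set` l] g1 by rewrite -lE.
have [g gl gmin] := seq_min (fun g => D (C k g)) g1l.
have : [set` l] g by [].
rewrite -lE => -[Gg gn1 Dg]; exists g; split=> // h Gh h1.
have [Dh|Dh] := leP (D (C k h)) (e1); last by apply: le_trans (ltW Dh).
by apply: gmin; have : [set` l] h by rewrite -lE.
Qed.

(* The commutator of two small elements is smaller than either of them. *)
Let minimal_comm k g h : minimal k g -> G h -> D (C k h) <= 1/64 -> g *m h = h *m g.
Proof.
move=> [Gg g1 Dg gmin] Gh Dh; have ug := lorentz_unit (G_lorentz hR Gg); have uh := lorentz_unit (G_lorentz hR Gh).
set A := C k g in Dg gmin; set B := C k h in Dh.
have lA := lC k Gg; have lB := lC k Gh.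
have uA := lorentz_unit lA; have uB := lorentz_unit lB; rewrite -/A -/B in lA lB uA uB.
suff E : g *m h *m invmx g *m invmx h = 1%:M.
  have := congr1 (fun X => X *m h *m g) E; rewrite /= mulmxKV // mulmxKV // mul1mx //.
apply: contrapT => w1.
have Gw : G (g *m h *m invmx g *m invmx h) by do !apply: (ps_mul hR) => //; exact: (ps_inv hR).
have := gmin _ Gw w1; rewrite !CM !CV // -/A -/B.
have a0 : 0 <= D A by exact: nrm_ge0.
move=> H; have := le_trans H (commutator_bound lA lB (le_trans Dg e11) (le_trans Dh _)).
rewrite -/(D A) -/(D B) => H2; have {}H2 : D A <= 32 * (D A * D B) by apply: H2; lra.
have DA0 : D A <= 0 by nra.
by apply: g1; apply: (@C1 k); apply/eqP; rewrite -subr_eq0; apply/eqP/nrm0_eq.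
Qed.

Let frame_change k g : D (C k g) <= 25 * D (C k.+1 g).
Proof.
have ub : (boostk 1 : 'M[R]_3) \in unitmx by exact: lorentz_unit (SOplus_lorentz (@SOplus_boostk R 1)).
have sS : s k.+1 = s k *m boostk 1 by rewrite !sE boostkS mulmxA.
have -> : 25 = nrm (boostk 1) ^+ 2 :> R by rewrite nrm_boost1; ring.
suff E : C k g - 1%:M = boostk 1 *m (C k.+1 g - 1%:M) *m invmx (boostk 1).
  by rewrite /D E; apply: nrm_conj; exact: SOplus_lorentz (@SOplus_boostk R 1).
rewrite mulmxBr mulmxBl mulmx1 mulmxV //; congr (_ - _).
by rewrite /C sS invmxM // !mulmxA mulmxV // mul1mx mulmxK.
Qed.

Lemma parabolic_of_low : exists2 u, u != 0 & G (par v0 u).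
Proof.
have [k0 Hk0] := minimal_ex.
have Hk0' k : exists g, (k0 <= k)%N -> minimal k g.
  by case: (leqP k0 k) => [/Hk0[g gm]|_]; [exists g|exists 0].
have [ga Hga] := choice Hk0'.
have Gga k : (k0 <= k)%N -> G (ga k) by move=> /Hga[].
pose a k := axis (ga k).
have trC k g : \tr (C k g) = \tr g by rewrite /C -mulmxA mxtrace_mulC -mulmxA mulmxV // mulmx1.
have tr0 k : (k0 <= k)%N -> 0 <= \tr (ga k).
  by move=> /Hga[_ _ h _]; rewrite -(trC k); apply: trace_ge0; move: h e11; rewrite /D; lra.
have aN0 k : (k0 <= k)%N -> a k <> 0.
  by move=> kk; apply: axis_neq0; [exact: G_lorentz hR _ (Gga _ kk)|exact: tr0|case: (Hga _ kk)].
have acc k : (k0 <= k)%N -> cross (a k.+1) (a k) = 0.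
  move=> kk; have kk' := leqW kk.
  rewrite crossC; apply/eqP; rewrite oppr_eq0; apply/eqP.
  apply: comm_axis; try exact: G_lorentz hR _ (Gga _ _).
  (* The next minimal element has size at most e1 in its own frame, hence at most 25 e1 in the frame
     k, small enough to commute with [ga k]. *)
  apply: (@minimal_comm k) (Hga _ kk) (Gga _ kk') _.
  apply: le_trans (frame_change _ _) _; have [_ _ h _] := Hga _ kk'; move: h e1s; lra.
have prop m : exists u, a (k0 + m)%N = u *: a k0.
  elim: m => [|m [u IH]]; first by exists 1; rewrite addn0 scale1r.
  have [u' E] := cross_eq0 (acc _ (leq_addr m k0)) (aN0 _ (leq_addr m k0)).
  by exists (u' * u); rewrite addnS E IH scalerA.
have ur : r \in unitmx by exact: lorentz_unit (SOplus_lorentz sr).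
pose y := invmx r *m a k0.
have axC k : (k0 <= k)%N -> axis (C k (ga k)) = invmx (s k) *m a k.
  move=> kk; rewrite /C -[X in _ *m X](invmxK (s k)) axis_conj ?invmxK //.
    by apply: lorentzV; exact: SOplus_lorentz.
  exact: G_lorentz hR _ (Gga _ kk).
(* The components of y transverse to [e_null] are the difference of the outer coordinates, which the
   boost divides by 2^k, and the middle one, which it keeps. So every frame bounds them by the norm
   of z. *)
have yE k z : boostk k *m z = y -> `|y 0 0 - y 2 0| + `|y 1 0| <= 2 * vnrm z.
  move=> <-; rewrite /boostk boostmE !vec3E /vnrm.
  have h := @pow2_ge1 R k; have /andP[h1 h2] := @pow2V_le1 R k.
  set p := (2 ^+ k)^-1 in h1 h2 *.
  have -> : (2 ^+ k + p) / 2 * z 0 0 + (2 ^+ k - p) / 2 * z 2 0 -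
    ((2 ^+ k - p) / 2 * z 0 0 + (2 ^+ k + p) / 2 * z 2 0) = p * (z 0 0 - z 2 0) by field.
  have n1 : `|p * (z 0 0 - z 2 0)| <= `|z 0 0| + `|z 2 0|.
    rewrite normrM (gtr0_norm h1); apply: le_trans (ler_normB _ _).
    by rewrite ler_piMl.
  by have := normr_ge0 (z 0 0); have := normr_ge0 (z 1 0); have := normr_ge0 (z 2 0); lra.
have smal k (tau : R) : (k0 <= k)%N -> a k = tau *: a k0 ->
    `|tau| * (`|y 0 0 - y 2 0| + `|y 1 0|) <= 2 * D (C k (ga k)).
  move=> kk ak.
  have B1 : boostk k *m (invmx (s k) *m a k0) = y.
    rewrite /y sE invmxM //; last exact: lorentz_unit (SOplus_lorentz (SOplus_boostk k)).
    by rewrite -mulmxA mulKVmx //; exact: lorentz_unit (SOplus_lorentz (SOplus_boostk k)).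
  have := ler_wpM2l (normr_ge0 tau) (yE _ _ B1); move=> /le_trans; apply.
  rewrite mulrCA -vnrmZ scalemxAr -ak -axC // ler_wpM2l //.
  by apply: axis_le; apply: lC; exact: Gga.
(* Otherwise the common axis would be contracted at the same rate as the minimal
   elements, which would eventually violate discreteness of G itself. *)
have key : `|y 0 0 - y 2 0| + `|y 1 0| = 0.
  apply/eqP; apply: contrapT => /negP c'0.
  set c' := _ + _ in c'0 smal yE.
  have {}c'0 : 0 < c' by rewrite lt_neqAle eq_sym c'0 addr_ge0.
  have [eG eG0 HG] := discrete_gap hR.
  pose X := vnrm (a k0) + 1.
  have X0 : 0 < X by rewrite ltr_wpDl // vnrm_ge0.
  (* With d <= 1, the bound u + 2 u^2 of [axis_bound] for u <= d is at most 3 d, hence within the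
     gap of G. *)
  have [d [d0 d1 dG]] : exists d : R, [/\ 0 < d, d <= 1 & 3 * d <= eG].
    exists (Num.min 1 (eG / 3)); split.
    - by rewrite lt_min ltr01 divr_gt0.
    - by rewrite ge_min lexx.
    - have : Num.min 1 (eG / 3) <= eG / 3 by rewrite ge_min lexx orbT.
      lra.
  have ee : 0 < d * c' / (2 * X) by rewrite divr_gt0 // mulr_gt0.
  have [k1 Hk1] := shrink ee.
  pose k := (k0 + k1)%N.
  have kk : (k0 <= k)%N := leq_addr _ _.
  have [tau ak] := prop k1; rewrite -/k in ak.
  have Dk : D (C k (ga k)) <= d * c' / (2 * X).
    have [h [Gh h1 Dh]] := Hk1 k (leq_addl _ _).
    by have [_ _ _ hm] := Hga _ kk; apply: le_trans (hm _ Gh h1) Dh.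
  have tauX : `|tau| * X <= d.
    have := le_trans (smal _ _ kk ak) (ler_wpM2l _ Dk) => /(_ (ler0n _ 2)).
    have -> : 2 * (d * c' / (2 * X)) = (d / X) * c' by field; rewrite gt_eqF.
    by rewrite ler_pM2r // ler_pdivlMr.
  have [_ gn1 _ _] := Hga _ kk; apply: gn1; apply: HG; first exact: Gga.
  have lg := G_lorentz hR (Gga _ kk).
  apply: le_trans (axis_bound lg (tr0 _ kk)) _; rewrite -/(a k) ak vnrmZ.
  have u0 : 0 <= `|tau| * vnrm (a k0) by rewrite mulr_ge0 // vnrm_ge0.
  have ud : `|tau| * vnrm (a k0) <= d.
    by apply: le_trans tauX; rewrite ler_wpM2l // lerDl.
  move: (`|tau| * vnrm (a k0)) u0 ud => u u0 ud; nra.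
have [y02 y1] : y 0 0 = y 2 0 /\ y 1 0 = 0.
  move/eqP: key; rewrite paddr_eq0 // !normr_eq0 subr_eq0 => /andP[/eqP-> /eqP->].
  by [].
have yv : y = y 2 0 *: e_null by apply: cV3P; rewrite [RHS]mxE vec3E ?y02 ?y1; ring.
have av : a k0 = (y 2 0 / t) *: v0.
  rewrite {1}rv scalerA divfK ?gt_eqF // scalemxAr -yv /y mulKVmx //.
have y20 : y 2 0 != 0.
  by apply/eqP => z; apply: (aN0 k0) => //; rewrite av z mul0r scale0r.
have gv : ga k0 *m v0 = v0.
  have := axis_fix (G_lorentz hR (Gga _ (leqnn k0))); rewrite -/(a k0) av -scalemxAr.
  by apply: scalerI; rewrite mulf_neq0 // invr_neq0 // gt_eqF.
have [tau gp] := stab_par (ps_SOplus hR (Gga _ (leqnn k0))) lv0 gv.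
exists tau; last by rewrite -gp; exact: Gga.
apply/eqP => tz; have [_ gn1 _ _] := Hga _ (leqnn k0); apply: gn1.
by rewrite gp tz par0.
Qed.
End Dichotomy.

Lemma parabolic_or_horospherical {R : realType} {n : nat} (G : set 'M[R]_3)
    (K : 'I_n -> set 'cV[R]_3) (hR : punctured_surface G K) (v : 'cV[R]_3) :
  light_cone v ->
  (exists2 u, u != 0 & G (par v u)) \/
  (forall e : R, 0 < e -> exists2 g, G g & (g *m v) 2 0 < e).
Proof.
move=> lv; have [[c c0 low]|H] := pselect (exists2 c : R, 0 < c & forall g, G g -> c <= (g *m v) 2 0).
  left; have [r [sr nr rv]] := frame_rot lv; have [_ v2] := lv.
  (* 1600 = 25 * 64 meets the smallness condition with equality. *)
  have e0 : (0 : R) < 1 / 1600 by lra.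
  have e1 : 25 * (1 / 1600) <= 1 / 64 :> R by lra.
  exact: (parabolic_of_low hR lv c0 low sr nr v2 rv (fun=> erefl) e0 e1).
right=> e e0; apply: contrapT => H'; apply: H; exists e => // g Gg.
by rewrite leNgt; apply/negP => h; apply: H'; exists g.
Qed.

(** * Horocycle lengths and cusps *)

Section Arc.
Context {R : realType}.
Notation mu := (@lebesgue_measure R).

(** Monotonicity is assumed only on the half-open interval, where a closed horocycle is traced once;
    the intermediate value theorem takes care of the endpoint. *)
Lemma incr_arc (f : R -> R) : (forall t, derivable f t 1) -> continuous f^`()%classic ->
  {in `[0, 1[ &, {homo f : x y / x < y}} -> f 0 = 0 ->
  [/\ 0 < f 1, forall y, 0 < y < f 1 -> exists2 t, 0 < t < 1 & f t = y
    & (\int[mu]_(t in `[(0 : R)%R, 1%R]) (`|f^`()%classic t|)%R%:E = (f 1%R)%:E)%E].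
Proof.
move=> df cf inc f0.
have cont : continuous f.
  by move=> x; apply: differentiable_continuous; apply/derivable1_diffP.
have within (a b : R) : {within `[a, b], continuous f} by exact: continuous_subspaceT.
have half : 0 < f (1/2).
  by rewrite -f0; apply: inc; rewrite ?in_itv /=; lra.
have f1 : 0 < f 1.
  rewrite ltNge; apply/negP => f1.
  have l : (1/2 : R) <= 1 by lra.
  have [|t] := IVT l (within _ _) (v := f (1/2) / 2).
    by rewrite ge_min le_max; apply/andP; split; apply/orP; [right|left]; lra.
  rewrite in_itv /= => /andP[t1 t2] ft.
  have t12 : t < 1.
    rewrite lt_neqAle t2 andbT; apply/eqP => tE; move: ft f1 half; rewrite tE; lra.
  move: t1; rewrite le_eqVlt => /orP[/eqP tE|t1].
    by move: ft half; rewrite -tE; lra.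
  have : f (1/2) < f t by apply: inc; rewrite ?in_itv /=; lra.
  by move: half; rewrite ft; lra.
split=> //.
  move=> y /andP[y0 y1].
  have [|t] := IVT (ler01 : (0 : R) <= 1) (within _ _) (v := y).
    by rewrite f0 ge_min le_max (ltW y0) (ltW y1) orbT.
  rewrite in_itv /= => /andP[t1 t2] ft; exists t => //.
  rewrite !lt_neqAle t1 t2 !andbT; apply/andP; split; apply/eqP => tE.
    by move: y0; rewrite -ft -tE f0 ltxx.
  by move: y1; rewrite -ft tE ltxx.
have pos t : t \in `]0, 1[ -> 0 <= f^`()%classic t.
  by apply: (@incr_derive1_ge0_itv _ f true true) => // x _.
have mf : measurable_fun setT (fun t => (`|f^`()%classic t|)%:E).
  apply/measurable_EFinP; apply: measurableT_comp => //.
  exact: continuous_measurable_fun.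
have mf' : measurable_fun setT (fun t => (f^`()%classic t)%:E).
  by apply/measurable_EFinP; exact: continuous_measurable_fun.
transitivity (\int[mu]_(t in `[(0 : R)%R, 1%R]) (f^`()%classic t)%:E)%E.
  rewrite integral_itv_bndoo; last exact: measurable_funTS.
  rewrite [RHS]integral_itv_bndoo; last exact: measurable_funTS.
  by apply: eq_integral => t; rewrite inE /= => /pos t0; rewrite ger0_norm.
have dLR : derivable_oo_LRcontinuous f 0 1.
  split; [by move=> t _; exact: df| |].
    by apply: cvg_at_right_filter; exact: cont.
  by apply: cvg_at_left_filter; exact: cont.
have cw : {within `[0, 1], continuous f^`()%classic} by apply: continuous_subspaceT => x; exact: cf.
have dE : {in `]0, 1[, f^`()%classic =1 f^`()%classic} by [].
have := continuous_FTC2 ltr01 cw dLR dE; rewrite f0 => ->.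
by rewrite sube0.
Qed.

(** The sign [sg] records in which direction the curve runs. *)
Lemma inj_arc (f : R -> R) : (forall t, derivable f t 1) -> continuous f^`()%classic ->
  {in `[0, 1[ &, injective f} -> f 0 = 0 ->
  exists2 sg : R, sg = 1 \/ sg = -1 & [/\ 0 < sg * f 1,
    forall y, 0 < y < sg * f 1 -> exists2 t, 0 < t < 1 & sg * f t = y
  & (\int[mu]_(t in `[(0 : R)%R, 1%R]) (`|f^`()%classic t|)%R%:E = (sg * f 1)%R%:E)%E].
Proof.
move=> df cf inj f0.
have cont : continuous f.
  by move=> x; apply: differentiable_continuous; apply/derivable1_diffP.
have [inc|dec] := itv_continuous_inj_mono (continuous_subspaceT cont) inj.
  have [f1 IV I] := incr_arc df cf inc f0; exists 1; first by left.
  rewrite mul1r; split; [exact: f1| |exact: I].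
  by move=> y /IV[t t01 <-]; exists t; rewrite ?mul1r.
pose h t := - f t.
have hE : h^`()%classic = (fun t => - f^`()%classic t).
  by apply/funext => t; rewrite derive1N.
have dh t : derivable h t 1 by exact: derivableN.
have ch : continuous h^`()%classic by rewrite hE => t; apply: cvgN; exact: cf.
have inch : {in `[0, 1[ &, {homo h : x y / x < y}}.
  by move=> x y x0 y0 xy; rewrite ltrN2; exact: dec.
have h0 : h 0 = 0 by rewrite /h f0 oppr0.
have [f1 IV I] := incr_arc dh ch inch h0.
exists (-1); first by right.
rewrite mulN1r; split; [exact: f1| |].
  by move=> y /IV[t t01 <-]; exists t; rewrite ?mulN1r.
by rewrite -[- f 1]/(h 1) -I; apply: eq_integral => t _; rewrite hE normrN.
Qed.
End Arc.

(** * Horocycle length as the period of the parabolic stabiliser *)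

Section HorocycleCurve.
Context {R : realType}.
Implicit Types (v x y z : 'cV[R]_3) (c : R -> 'cV[R]_3).

Lemma derive1_mxE c t : derivable c t 1 -> forall i, derive1 c t i 0 = derive1 (fun u => c u i 0) t.
Proof. by move=> dc i; rewrite !derive1E derive_mx // mxE. Qed.

Lemma horocycle_par v x y : light_cone v -> horocycle v x -> horocycle v y ->
  par v (form y (cross v x)) *m x = y.
Proof.
move=> lv [hx xv] [hy yv]; have := par_transport lv hx hy; rewrite xv yv (formC v) xv => /(_ erefl).
by rewrite sqrrN expr1n divr1.
Qed.

Lemma form_par_cross v x t : light_cone v -> horocycle v x -> form (par v t *m x) (cross v x) = t.
Proof.
move=> [vv _] [hx xv]; rewrite parE // !formE form_cross2 vv mul0r subr0 (formC x (cross _ _)) form_crossr.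
rewrite (formC v (cross _ _)) form_crossl (formC v x) xv; ring.
Qed.

Lemma horocycle_par_stable v x t : light_cone v -> horocycle v x -> horocycle v (par v t *m x).
Proof.
move=> lv [hx xv]; have [pf _ ph] := SOplus_par t lv; split; first exact: ph.
by rewrite -{2}(par_fix t (proj1 lv)) pf.
Qed.

Lemma horocycle_nonempty v : light_cone v -> exists x, horocycle v x.
Proof.
move=> lv; have [vv v2] := lv; have v20 : v 2 0 != 0 by rewrite gt_eqF.
have [e33 _] := @hyp_e3 R.
have ev : form e3 v = - v 2 0 by rewrite /form !vec3E; ring.
pose a := (v 2 0)^-1; pose x := a *: e3 + ((1 - a ^+ 2) / 2) *: v.
have xv : form x v = -1 by rewrite !formE ev vv mulr0 addr0 mulrN mulVf.
have xx : form x x = -1.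
  rewrite !formE vv e33 (formC v) ev /a; by field.
exists x; split=> //; split=> //; rewrite ltNge; apply/negP => x2.
by have := neg_hyp_form xx x2 lv; rewrite xv ltrNr oppr0 ltr10.
Qed.

Lemma is_derive_par_curve v x (f : R -> R) (t d : R) i : light_cone v -> horocycle v x ->
  is_derive t 1 f d ->
  is_derive t 1 (fun u => (par v (f u) *m x) i 0) (d * (cross v x i 0 + f t * v i 0)).
Proof.
move=> [vv _] [_ xv] fd.
have -> : (fun u => (par v (f u) *m x) i 0) =
    (fun u => x i 0 + cross v x i 0 * f u + (v i 0 / 2) * (f u) ^+ 2).
  apply/funext => u; rewrite parE // !mxE (formC v) xv; by field.
apply: is_derive_eq; rewrite /GRing.scale /=; by field.
Qed.

(** The parabolic parameter is arc length on the horocycle: at parameter u the velocity is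
    [cross v x + u *: v], a unit vector. *)
Lemma speed v x (f : R -> R) c t : light_cone v -> horocycle v x -> derivable f t 1 ->
  derivable c t 1 -> (\near t, c t = par v (f t) *m x) ->
  form (derive1 c t) (derive1 c t) = (derive1 f t) ^+ 2.
Proof.
move=> lv hx df dc E; have [vv _] := lv; have [_ xv] := hx.
have -> : derive1 c t = derive1 f t *: (cross v x + f t *: v).
  apply/colP => i; rewrite derive1_mxE // [RHS]mxE [X in _ * X]mxE [X in _ + X]mxE.
  have fd : is_derive t 1 f (derive1 f t) by rewrite derive1E; exact: derivableP.
  have H := is_derive_par_curve i lv hx fd.
  rewrite [LHS]derive1E (@near_eq_derive _ _ _ _ (fun u => (par v (f u) *m x) i 0)); last first.
    by near=> u; congr (fun y : 'cV[R]_3 => y i 0); near: u.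
  by case: H.
rewrite !formE form_cross2 form_crossl (formC v (cross _ _)) form_crossl vv (formC v) xv; ring.
Unshelve. all: by end_near. Qed.

Lemma gorbit_stab_par (G : set 'M[R]_3) v x y : G `<=` SOplus -> light_cone v -> horocycle v x ->
  gorbit (stab G v) x y -> exists2 t, G (par v t) & y = par v t *m x.
Proof.
move=> GS lv hx [g [Gg gv] <-]; have [t gE] := stab_par (GS _ Gg) lv gv.
by exists t; rewrite -gE.
Qed.

Lemma par_gorbit_stab (G : set 'M[R]_3) v x t : light_cone v -> G (par v t) ->
  gorbit (stab G v) x (par v t *m x).
Proof. by move=> [vv _] Gt; exists (par v t) => //; split=> //; rewrite par_fix. Qed.

Lemma par_inj_hor v x s t : light_cone v -> horocycle v x -> par v s *m x = par v t *m x -> s = t.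
Proof. by move=> lv hx E; rewrite -(form_par_cross s lv hx) E form_par_cross. Qed.

Lemma is_derive_lincomb (a b d : R -> R) (a' b' d' p q r t : R) :
  is_derive t 1 a a' -> is_derive t 1 b b' -> is_derive t 1 d d' ->
  is_derive t 1 (fun u => a u * p + b u * q - d u * r) (a' * p + b' * q - d' * r).
Proof. move=> da db dd; apply: is_derive_eq; rewrite /GRing.scale /=; ring. Qed.

Lemma continuous_affine (V : normedModType R) (u w : V) (a : R) :
  continuous (fun t : R => a *: (u + (t * a) *: w)).
Proof.
move=> t; apply: cvgZl_tmp; apply: cvgD; first exact: cvg_cst.
by apply: cvgZr_tmp; apply: cvgMr_tmp; exact: cvg_id.
Qed.

Lemma is_derive_form_curve z c t : derivable c t 1 ->
  is_derive t 1 (fun u => form (c u) z) (form (derive1 c t) z).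
Proof.
move=> dc; rewrite /form !(derive1_mxE dc).
have D i : is_derive t 1 (fun u => c u i 0) (derive1 (fun u => c u i 0) t).
  by rewrite derive1E; apply: derivableP; exact: ((derivable_mxP _ _ _).1 dc).
exact: is_derive_lincomb.
Qed.

Lemma continuous_form c d : continuous c -> continuous d -> continuous (fun t => form (c t) (d t)).
Proof.
move=> cc cd; have E (e : R -> 'cV[R]_3) i : continuous e -> continuous (fun t => e t i 0).
  by move=> ce t; apply: (@continuous_comp _ _ _ e (fun M : 'cV[R]_3 => M i 0)); [exact: ce|exact: coord_continuous].
rewrite /form => t.
apply: cvgB; first apply: cvgD; apply: cvgM; exact: E.
Qed.

Lemma int_multiples (P : set R) (l : R) : 0 < l -> P l ->
  (forall s t, P s -> P t -> P (s - t)) -> (forall t, 0 < t < l -> ~ P t) ->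
  forall t, P t <-> exists k : int, t = k%:~R * l.
Proof.
move=> l0 Pl PB Pmin; have P0 : P 0 by rewrite -(subrr l); exact: PB.
have Pn (k : nat) : P (k%:R * l).
  elim: k => [|k IH]; first by rewrite mul0r.
  by rewrite (_ : _ * l = k%:R * l - (0 - l)); [exact: PB (PB _ _ P0 Pl)|rewrite -natr1; ring].
have Pk (k : int) : P (k%:~R * l).
  case: k => k; first exact: Pn.
  by rewrite NegzE mulrNz mulNr -sub0r; exact: PB (Pn _).
move=> t; split=> [Pt|[k ->//]].
exists (Num.floor (t / l)); have /andP[h1 h2] := mem_rg1_floor (t / l).
set k := Num.floor _ in h1 h2 *.
have h3 : 0 <= t - k%:~R * l by rewrite subr_ge0 -ler_pdivlMr.
have h4 : t - k%:~R * l < l by move: h2; rewrite ltr_pdivrMr // mulrDl mul1r; lra.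
case: (eqVneq (t - k%:~R * l) 0) => [/eqP|h]; first by rewrite subr_eq0 => /eqP.
by case: (Pmin (t - k%:~R * l)); [rewrite h4 lt_neqAle h3 eq_sym h|exact: PB].
Qed.

Section Length.
Variable G : set 'M[R]_3.
Hypothesis GS : G `<=` SOplus.
Hypothesis G1 : G 1%:M.
Hypothesis GM : forall g h, G g -> G h -> G (g *m h).
Hypothesis GV : forall g, G g -> G (invmx g).

Lemma inv_par v t : form v v = 0 -> invmx (par v t) = par v (- t).
Proof.
move=> vv; have E : par v t *m par v (- t) = 1%:M by rewrite parD // subrr par0.
by rewrite -[RHS](mulKmx (lorentz_unit (lorentz_par t vv))) E mulmx1.
Qed.

Lemma G_parB v s t : light_cone v -> G (par v s) -> G (par v t) -> G (par v (s - t)).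
Proof. by move=> [vv _] Gs Gt; rewrite -parD // -inv_par //; apply: GM => //; exact: GV. Qed.

(** In the parameter f of the curve the length is |f 1|. It is a period because the endpoints are
    equivalent, and no smaller positive number is one because the curve meets every class once. *)
Lemma horocycle_length_period v (l : R) : light_cone v -> horocycle_length G v l ->
  0 < l /\ forall t, G (par v t) <-> exists k : int, t = k%:~R * l.
Proof.
move=> lv [c [[dc cc] hc cl cu len]].
have l01 : (0 : R) <= (0 : R) <= (1 : R) by apply/andP; split; [exact: lexx|exact: ler01].
have l11 : (0 : R) <= (1 : R) <= (1 : R) by apply/andP; split; [exact: ler01|exact: lexx].
have hx := hc 0 l01; set x0 := c 0 in hx cl; pose z := cross v x0.
pose f t := form (c t) z.
have df (t : R) : is_derive t 1 f (form (derive1 c t) z) by exact: is_derive_form_curve.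
have f'E : f^`()%classic = (fun t => form (derive1 c t) z).
  by apply/funext => t; rewrite derive1E; apply: derive_val.
have f'c : continuous f^`()%classic.
  by rewrite f'E; apply: continuous_form => // t; exact: cvg_cst.
have f0 : f 0 = 0 by rewrite /f formC form_crossr.
have cE t : 0 <= t <= 1 -> c t = par v (f t) *m x0.
  by move=> t01; rewrite /f horocycle_par //; exact: hc.
have finj : {in `[0, 1[ &, injective f}.
  move=> s t; rewrite !in_itv /= => /andP[s0 s1] /andP[t0 t1] st.
  have s01 : 0 <= s <= 1 by rewrite s0 ltW.
  have t01 : 0 <= t <= 1 by rewrite t0 ltW.
  have [u [_ U]] := cu _ (hc _ t01); rewrite -(U s) ?(U t) //; split; rewrite ?s0 ?t0 //.
    by exists 1%:M; [split; rewrite ?mul1mx|rewrite mul1mx].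
  by exists 1%:M; [split; rewrite ?mul1mx|rewrite mul1mx (cE s) // (cE t) // st].
have [sg sgE [sf1 IV I]] := inj_arc (fun t => @ex_derive _ _ _ _ _ _ _ (df t)) f'c finj f0.
have lE : l = sg * f 1.
  apply: EFin_inj; rewrite -I -len /curve_length.
  have m1 : measurable_fun setT (fun t : R => (Num.sqrt (form (derive1 c t) (derive1 c t)))%:E).
    apply/measurable_EFinP; apply: continuous_measurable_fun => t.
    apply: (@continuous_comp _ _ _ (fun t => form (derive1 c t) (derive1 c t)) Num.sqrt).
      exact: continuous_form.
    exact: sqrt_continuous.
  have m2 : measurable_fun setT (fun t : R => (`|f^`()%classic t|)%:E).
    apply/measurable_EFinP; apply: measurableT_comp => //.
    exact: continuous_measurable_fun.
  rewrite integral_itv_bndoo; last exact: measurable_funTS.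
  rewrite [RHS]integral_itv_bndoo; last exact: measurable_funTS.
  apply: eq_integral => t; rewrite inE /= in_itv /= => /andP[t0 t1].
  congr (_%:E); rewrite (@speed v x0 f) ?sqrtr_sqr //.
  have : \forall u \near t, u \in `]0, 1[ by apply: near_in_itvoo; rewrite in_itv /= t0.
  apply: filterS => u; rewrite in_itv /= => /andP[u0 u1].
  by apply: cE; rewrite !ltW.
have l0 : 0 < l by rewrite lE.
have Gf1 : G (par v (f 1)).
  have [t Gt] := gorbit_stab_par GS lv hx cl.
  by rewrite (cE 1) // => /(par_inj_hor lv hx) ->.
have Gsg t : G (par v (sg * t)) <-> G (par v t).
  case: sgE => ->; rewrite ?mul1r // mulN1r; split=> /GV; rewrite inv_par ?opprK //; exact: (proj1 lv).
split=> //; apply: int_multiples => //.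
- by rewrite lE Gsg.
- by move=> s t; exact: G_parB.
move=> t; rewrite {1}lE => /IV[u /andP[u0 u1] <-] /Gsg Gu.
have [u' [_ U]] := cu _ hx.
have /eqP : 0 = u; last by rewrite lt_eqF.
have U0 : u' = 0.
  apply: U; split; first by apply/andP; split; [exact: lexx|exact: ltr01].
  by exists 1%:M; [split; [exact: G1|rewrite mul1mx]|rewrite mul1mx].
rewrite -U0; apply: U; split; first by apply/andP; split; [exact: ltW|exact: u1].
rewrite (cE u); first exact: par_gorbit_stab.
by apply/andP; split; exact: ltW.
Qed.

Lemma period_horocycle_length v (l : R) : light_cone v -> 0 < l ->
  (forall t, G (par v t) <-> exists k : int, t = k%:~R * l) -> horocycle_length G v l.
Proof.
move=> lv l0 GP; have [x0 hx] := horocycle_nonempty lv.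
pose f (t : R) := t * l; pose c t := par v (f t) *m x0.
have df (t : R) : is_derive t 1 f l.
  by rewrite /f; apply: is_derive_eq; rewrite /GRing.scale /= mulr1 mulr0 add0r.
have dc t : derivable c t 1.
  apply/derivable_mxP => i j; rewrite ord1.
  exact: (@ex_derive _ _ _ _ _ _ _ (is_derive_par_curve i lv hx (df t))).
have c'E : derive1 c = (fun t => l *: (cross v x0 + (t * l) *: v)).
  apply/funext => t; apply/colP => i; rewrite derive1_mxE // derive1E.
  rewrite (@derive_val _ _ _ _ _ _ _ (is_derive_par_curve i lv hx (df t))).
  by rewrite /f [RHS]mxE [X in _ = _ * X]mxE [X in _ = _ * (_ + X)]mxE.
exists c; split.
- by split; [exact: dc|rewrite c'E; exact: continuous_affine].
- by move=> t _; exact: horocycle_par_stable.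
- exists (par v l); first split; last by rewrite mulmxA parD ?(proj1 lv) // /c /f mul0r mul1r addr0.
    by apply/GP; exists 1; rewrite mul1r.
  by rewrite par_fix // (proj1 lv).
- move=> x hx'; have xE := horocycle_par lv hx hx'; move: xE; set s := form _ _ => xE.
  have fl := mem_rg1_floor (s / l).
  have sh (t : R) : par v (t * l - s) *m x = c t.
    by rewrite -xE mulmxA parD ?subrK // (proj1 lv).
  (* The curve meets the class of x at the fractional part of s / l. *)
  exists (s / l - (Num.floor (s / l))%:~R); split.
    split; first by move: fl => /andP[h1 h2]; apply/andP; split; move: h1 h2; lra.
    rewrite -sh; apply: par_gorbit_stab => //; apply/GP; exists (- Num.floor (s / l)).
    by rewrite mulrNz mulrBl divfK ?gt_eqF // mulNr; ring.
  move=> t [/andP[t0 t1]] /(gorbit_stab_par GS lv hx')[u /GP[k kE]].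
  rewrite -sh => /(par_inj_hor lv hx') tE.
  have {}tE : t - s / l = k%:~R.
    by apply: (mulIf (lt0r_neq0 l0)); rewrite mulrBl divfK ?gt_eqF // tE.
  have -> : Num.floor (s / l) = - k; last by rewrite mulrNz opprK -tE addrC subrK.
  apply: floor_def; rewrite rmorphD !rmorphN /= -tE; apply/andP; split; lra.
have E (t : R) : Num.sqrt (form (derive1 c t) (derive1 c t)) = l.
  rewrite (@speed v x0 f) ?derive1E ?derive_val ?sqrtr_sqr ?ger0_norm ?ltW //.
  by near=> u.
rewrite /curve_length; under eq_integral => t _ do rewrite E.
by rewrite integral_cst //= lebesgue_measure_itv /= lte_fin ltr01 oppr0 adde0 mule1.
Unshelve. all: by end_near. Qed.

Lemma horocycle_lengthP v (l : R) : light_cone v -> horocycle_length G v l <->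
  0 < l /\ forall t, G (par v t) <-> exists k : int, t = k%:~R * l.
Proof.
by move=> lv; split=> [|[]]; [exact: horocycle_length_period|exact: period_horocycle_length].
Qed.
End Length.
End HorocycleCurve.

(** * Cusps and their horocycles of length 1 *)

Section Horospheres.
Context {R : realType}.
Implicit Types (v x y z w : 'cV[R]_3) (g h : 'M[R]_3).

(** Adding the same multiple of v puts both null vectors on the hyperboloid; parabolics fix v, so
    [par_transport] applies. *)
Lemma light_transport v w w' : light_cone v -> light_cone w -> form w v = form w' v ->
  light_cone w' -> form w v != 0 -> exists t, par v t *m w = w'.
Proof.
move=> lv lw E lw' wv; have wv0 : form w v < 0 by rewrite lt_neqAle wv light_le0.
have [vv v2] := lv.
pose a := - (2 * form w v)^-1.
have a0 : 0 < a by rewrite oppr_gt0 invr_lt0; lra.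
have H z : light_cone z -> form z v = form w v -> hyperboloid (z + a *: v).
  move=> [zz z2] zv; split; last by rewrite !mxE addr_gt0 // mulr_gt0.
  by rewrite !formE zz vv (formC v) zv /a; field.
have F z : form (z + a *: v) v = form z v by rewrite !formE vv mulr0 addr0.
have := @par_transport _ v (w + a *: v) (w' + a *: v) lv.
rewrite !F => /(_ (H _ lw erefl) (H _ lw' (esym E)) (esym E)); set t := _ / _ => tE.
exists t; move: tE; rewrite mulmxDr -scalemxAr par_fix //; exact: addIr.
Qed.

(* If g scaled v by c <> 1, it would be hyperbolic and fix a second ideal point. *)
Lemma parabolic_fixed g v : parabolic g -> fixes_ideal g v -> exists2 t, t != 0 & g = par v t.
Proof.
move=> [Sg fr [v' _ U]] fv; have {U} U w : fixes_ideal g w -> ray v w.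
  move=> fw; have [s /= s0 sE] := U _ fv; have [r /= r0 rE] := U _ fw.
  by exists (r / s); [exact: divr_gt0|rewrite -rE -sE scalerA divfK ?gt_eqF].
have [lv [c /= c0 cE]] := fv; have lg := SOplus_lorentz Sg.
case: (eqVneq c 1) => [c1|c1].
  move: cE; rewrite c1 scale1r => /esym gv; have [t gE] := stab_par Sg lv gv.
  exists t => //; apply/eqP => t0; apply: (fr _ (proj1 (conj hyp_e3 I))).
  by rewrite gE t0 par0 mul1mx.
have [vv v2] := lv; pose m := vec3 (- v 0 0) (- v 1 0) (v 2 0).
have lm : light_cone m by split; [move: vv; rewrite /form !vec3E; lra|rewrite vec3E].
have mv : form m v = - 2 * v 2 0 ^+ 2 by move: vv; rewrite /form !vec3E; lra.
have mv0 : form m v != 0 by rewrite mv mulf_neq0 ?expf_neq0 ?oppr_eq0 ?gt_eqF.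
have lw : light_cone (c *: (g *m m)) by apply: lightZ => //; exact: SOplus_light.
have mw : form m v = form (c *: (g *m m)) v.
  by rewrite formZl -formZr cE; have [gf _ _] := Sg; rewrite gf.
have [s sE] := light_transport lv lm mw lw mv0.
(* At parameter a, c g maps [par v a *m m] to [par v (c * a + s) *m m]; its fixed point is a = s /
   (1 - c). *)
pose u := par v (s / (1 - c)) *m m.
have lu : light_cone u by apply: SOplus_light => //; exact: SOplus_par.
have uv : form u v = form m v.
  by have [pf _ _] := SOplus_par (s / (1 - c)) lv; have := pf m v; rewrite par_fix.
have c1' : 1 - c != 0 by rewrite subr_eq0 eq_sym.
have gu : g *m u = c^-1 *: u.
  rewrite /u mulmxA par_conj // -cE -mulmxA parZ; apply: (scalerI (lt0r_neq0 c0)).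
  rewrite scalemxAr -sE mulmxA parD // scalerA mulfV ?gt_eqF // scale1r; congr (par v _ *m m).
  by field.
have [|r r0 rE] := U u; first by split=> //; exists c^-1; rewrite /= ?invr_gt0.
by move: mv0; rewrite -uv -rE formZl vv mulr0 eqxx.
Qed.

Lemma par_parabolic v t : light_cone v -> t != 0 -> (forall x, hyperboloid x -> par v t *m x <> x) ->
  parabolic (par v t).
Proof.
move=> lv t0 fr; have [vv _] := lv; split=> //; first exact: SOplus_par.
exists v; first by split=> //; exists 1; rewrite /= ?par_fix ?scale1r.
move=> w [lw [c /= c0 cE]]; have [pf _ _] := SOplus_par t lv.
suff wv : form w v = 0.
  have [_ w2] := lw; have [_ v2] := lv.
  by exists (w 2 0 / v 2 0); rewrite /= ?divr_gt0 // -light_parallel.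
have := pf w v; rewrite par_fix // -cE formZl; case: (eqVneq (form w v) 0) => // wv.
rewrite -{2}(mul1r (form w v)) => /(mulIf wv) c1; move: cE; rewrite c1 scale1r parE //.
move=> /(congr1 (form w)); rewrite !formE (formC w (cross _ _)) form_crossr (formC v w) => E.
have /eqP : (t * form w v) ^+ 2 = 0 by move: E; rewrite exprMn; lra.
by rewrite expf_eq0 mulf_eq0 (negPf t0) (negPf wv).
Qed.

Section Cusps.
Variables (n : nat) (G : set 'M[R]_3) (K : 'I_n -> set 'cV[R]_3).
Hypothesis hR : punctured_surface G K.

Lemma cusp_light i v : K i v -> light_cone v.
Proof.
have [/(_ i Logic.I) [u [g [Gg _ [lu _]]] <-] _ _] := ps_cusps hR.
move=> [h Gh [c /= c0 <-]]; apply: lightZ => //; apply: SOplus_light => //; exact: (ps_SOplus hR).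
Qed.

Lemma cusp_stable i g v (c : R) : G g -> 0 < c -> K i v -> K i (c *: (g *m v)).
Proof.
have [/(_ i Logic.I) [u _ <-] _ _] := ps_cusps hR.
move=> Gg c0 [h Gh [d /= d0 <-]]; exists (g *m h); first exact: (ps_mul hR).
by exists (c * d); rewrite /= ?mulr_gt0 // -scalemxAr scalerA mulmxA.
Qed.

Lemma cusp_index i j v : K i v -> K j v -> i = j.
Proof.
have [Kc Kinj _] := ps_cusps hR; move=> Ki Kj; apply: Kinj; rewrite ?inE //.
have [u _ uE] := Kc i Logic.I; have [w _ wE] := Kc j Logic.I.
have sub a b : cusp_of G a v -> cusp_of G b v -> cusp_of G a `<=` cusp_of G b.
  move=> [g Gg [c /= c0 cE]] [h Gh [d /= d0 dE]] _ [k Gk [e /= e0 <-]].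
  have Ug : g \in unitmx by apply: lorentz_unit; exact: SOplus_lorentz (ps_SOplus hR Gg).
  exists (k *m invmx g *m h); first by apply: (ps_mul hR) => //; apply: (ps_mul hR) => //; exact: (ps_inv hR).
  exists (e / c * d); first by rewrite /= mulr_gt0 // divr_gt0.
  have -> : (e / c * d) *: (k *m invmx g *m h *m b) = (e / c) *: (k *m invmx g *m (d *: (h *m b))).
    by rewrite -scalerA -!mulmxA -!scalemxAr.
  by rewrite dE -cE -!scalemxAr scalerA divfK ?gt_eqF // mulmxA mulmxKV.
rewrite -uE in Ki *; rewrite -wE in Kj *.
by apply/seteqP; split; exact: sub.
Qed.

Lemma cusp_parabolic i v : K i v -> exists2 t, t != 0 & G (par v t).
Proof.
have [/(_ i Logic.I) [u [g [Gg pg fu]] <-] _ _] := ps_cusps hR.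
move=> [h Gh [d /= d0 <-]]; have [t t0 gE] := parabolic_fixed pg fu.
have lh : lorentz h by apply: SOplus_lorentz; exact: (ps_SOplus hR).
exists (t / d); first by rewrite mulf_neq0 ?invr_eq0 // gt_eqF.
rewrite parZ mulrC divfK ?gt_eqF // -(mulmxK (lorentz_unit lh) (par _ _)) -par_conj // -gE.
by apply: (ps_mul hR); [exact: (ps_mul hR)|exact: (ps_inv hR)].
Qed.

Lemma nrm_par v (t M : R) : vnrm v <= M -> `|t| <= M ->
  nrm (par v t) <= 3 + 2 * M ^+ 2 + 2 * M ^+ 4.
Proof.
move=> vM tM; have M0 : 0 <= M by apply: le_trans tM.
have mM : nrm (mcross v) <= 2 * M by rewrite nrm_mcross ler_wpM2l.
apply: le_trans (nrmD _ _) _; apply: lerD.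
  apply: le_trans (nrmD _ _) _; rewrite nrm1 lerD2l nrmZ.
  apply: le_trans (ler_pM (normr_ge0 _) (nrm_ge0 _) tM mM) _; lra.
rewrite nrmZ normrM normrX [`|2^-1|]ger0_norm ?invr_ge0 //.
have h1 : `|t| ^+ 2 <= M ^+ 2 by rewrite ler_pXn2r ?nnegrE.
have h2 : nrm (mcross v *m mcross v) <= (2 * M) ^+ 2.
  by apply: le_trans (nrmM _ _) _; rewrite -expr2 ler_pXn2r ?nnegrE ?nrm_ge0 ?mulr_ge0.
have h3 : `|t| ^+ 2 * nrm (mcross v *m mcross v) <= M ^+ 2 * (2 * M) ^+ 2.
  by apply: ler_pM => //; rewrite ?exprn_ge0 ?nrm_ge0.
have -> : 2 * M ^+ 4 = M ^+ 2 * (2 * M) ^+ 2 / 2 by field.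
lra.
Qed.

(** By discreteness only finitely many periods lie below a given one, and the smallest generates. *)
Lemma par_period v : light_cone v -> (exists2 t, t != 0 & G (par v t)) ->
  exists2 l : R, 0 < l & forall t, G (par v t) <-> exists k : int, t = k%:~R * l.
Proof.
move=> lv [t0 t00 Gt0]; have [vv _] := lv.
have GB s t : G (par v s) -> G (par v t) -> G (par v (s - t)).
  exact: (G_parB (ps_mul hR) (ps_inv hR)).
have [t1 t10 Gt1] : exists2 t1, 0 < t1 & G (par v t1).
  case: (ltgtP t0 0) t00 => // t00 _; last by exists t0.
  exists (- t0); rewrite ?oppr_gt0 //; rewrite -sub0r; apply: GB => //; rewrite par0; exact: (ps_one hR).
pose P := [set t | G (par v t) /\ 0 < t <= t1].
have fP : finite_set P.
  pose M := Num.max (vnrm v) t1.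
  have fS := finite_bounded hR (3 + 2 * M ^+ 2 + 2 * M ^+ 4).
  (* The parameter of a parabolic is recovered from its action on [e3], so finiteness passes from
     matrices to parameters. *)
  apply: (sub_finite_set _ (finite_image (fun g => form (g *m e3) (cross v e3) / form v e3 ^+ 2) fS)).
  move=> t [Gt /andP[tp tt]]; exists (par v t).
    split=> //; apply: nrm_par; rewrite ?le_max ?lexx //.
    by rewrite gtr0_norm // tt orbT.
  have ve : form v e3 != 0 by rewrite formC lt_eqF //; exact: form_hyp_light hyp_e3 lv.
  rewrite parE // !formE form_cross2 vv mul0r subr0 (formC e3 (cross _ _)) form_crossr.
  by rewrite (formC v (cross _ _)) form_crossl (formC e3 v); field.
have /finite_seqP[s sE] := fP.
have t1s : t1 \in s.
  by have : P t1; [split=> //; rewrite t10 lexx|rewrite sE].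
have [l ls lmin] := seq_min id t1s.
have [Gl /andP[l0 lt1]] : P l by rewrite sE.
exists l => //; apply: (int_multiples l0 Gl GB).
move=> t /andP[tp tl] Gt; have : P t by split=> //; rewrite tp (le_trans (ltW tl)).
by rewrite sE => /lmin; rewrite leNgt tl.
Qed.

(* The points of the cusp i whose horocycle has length 1. *)
Definition unit_cusp (i : 'I_n) : set 'cV[R]_3 :=
  [set v | K i v /\ forall t : R, G (par v t) <-> exists k : int, t = k%:~R].

(** Because [par (c *: v) t] is [par v (c * t)], scaling v by c divides its period, hence its
    horocycle length, by c. *)
Lemma horo_pointsE (w0 : 'rV[R]_n) i v :
  horo_points G K w0 i v <-> 0 < w0 0 i /\ unit_cusp i (w0 0 i *: v).
Proof.
have hl u : light_cone u -> horocycle_length G u (w0 0 i) <-> 0 < w0 0 i /\ _ :=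
  horocycle_lengthP (ps_SOplus hR) (ps_one hR) (ps_mul hR) (ps_inv hR) (w0 0 i).
have KZ c : 0 < c -> K i v <-> K i (c *: v).
  move=> c0; split=> [/(cusp_stable (ps_one hR) c0)|]; first by rewrite mul1mx.
  have cV0 : 0 < c^-1 by rewrite invr_gt0.
  by move/(cusp_stable (ps_one hR) cV0); rewrite mul1mx scalerA mulVf ?gt_eqF // scale1r.
split.
  move=> [w0i Ki /(hl _ (cusp_light Ki))[_ P]]; split=> //; split; first exact/KZ.
  move=> t; rewrite parZ; split=> [/P[k kE]|[k ->]]; last by apply/P; exists k; rewrite mulrC.
  by exists k; apply: (mulfI (lt0r_neq0 w0i)); rewrite kE mulrC.
move=> [w0i [/(KZ _ w0i) Ki P]]; split=> //; apply/(hl _ (cusp_light Ki)); split=> // t.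
rewrite -{1}(divfK (lt0r_neq0 w0i) t) mulrC -parZ; split=> [/P[k kE]|[k ->]].
  by exists k; rewrite -kE divfK ?gt_eqF.
by apply/P; exists k; rewrite mulfK ?gt_eqF.
Qed.

Lemma unit_cusp_light i v : unit_cusp i v -> light_cone v.
Proof. by case=> /cusp_light. Qed.

Lemma unit_cusp_exists i v : K i v -> exists2 c, 0 < c & unit_cusp i (c *: v).
Proof.
move=> Ki; have [l l0 P] := par_period (cusp_light Ki) (cusp_parabolic Ki).
exists l => //; split; first by rewrite -(mul1mx v); apply: cusp_stable => //; exact: (ps_one hR).
move=> t; rewrite parZ; split=> [/P[k kE]|[k ->]]; last by apply/P; exists k; rewrite mulrC.
by exists k; apply: (mulfI (lt0r_neq0 l0)); rewrite kE mulrC.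
Qed.

Lemma unit_cusp_nonempty i : exists v, unit_cusp i v.
Proof.
have [/(_ i Logic.I) [u [g [Gg _ [lu _]]] uE] _ _] := ps_cusps hR.
have [|c _ Vc] := @unit_cusp_exists i u; last by exists (c *: u).
rewrite -uE; exists 1%:M; first exact: (ps_one hR).
by exists 1; rewrite /= ?mul1mx ?scale1r.
Qed.

(** Both c and its inverse are periods of vectors with period 1, hence positive integers. *)
Lemma unit_cusp_unique i j (c : R) u : unit_cusp i u -> 0 < c -> unit_cusp j (c *: u) -> c = 1 /\ i = j.
Proof.
move=> [Ki Pi] c0 [Kj Pj]; split; last first.
  by apply: (@cusp_index _ _ (c *: u)) => //; rewrite -(mul1mx u); apply: cusp_stable => //; exact: (ps_one hR).
have [k kE] : exists k : int, c = k%:~R.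
  by apply/Pi; rewrite -[c]mulr1 -parZ; apply/Pj; exists 1.
have [m mE] : exists k : int, c^-1 = k%:~R.
  apply/Pj; rewrite parZ mulfV ?gt_eqF //; apply/Pi; by exists 1.
have ge1 (a : int) (d : R) : 0 < d -> d = a%:~R -> 1 <= d.
  by move=> d0 dE; move: d0; rewrite dE ltr0z ler1z gtz0_ge1.
have c1 := ge1 _ _ c0 kE.
have : 1 <= c^-1 by apply: ge1 mE; rewrite invr_gt0.
rewrite invf_ge1 // => c2; apply/eqP; rewrite eq_le c2 c1 //.
Qed.

Lemma unit_cusp_stable i g v : G g -> unit_cusp i v -> unit_cusp i (g *m v).
Proof.
move=> Gg [Ki P]; have lg : lorentz g by apply: SOplus_lorentz; exact: (ps_SOplus hR).
split; first by rewrite -(scale1r (g *m v)); exact: cusp_stable.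
have E t : par (g *m v) t = g *m par v t *m invmx g.
  by rewrite par_conj // mulmxK ?lorentz_unit.
move=> t; rewrite -P E; split=> Gt; last first.
  by apply: (ps_mul hR); [exact: (ps_mul hR)|exact: (ps_inv hR)].
have ug := lorentz_unit lg.
have -> : par v t = invmx g *m (g *m par v t *m invmx g) *m g by rewrite -!mulmxA mulKmx // mulVmx ?mulmx1.
by apply: (ps_mul hR) => //; apply: (ps_mul hR) => //; exact: (ps_inv hR).
Qed.

Lemma unit_cusp_par i j u v (k : int) : unit_cusp i v -> unit_cusp j u -> unit_cusp j (par v k%:~R *m u).
Proof. by move=> [_ P]; apply: unit_cusp_stable; apply/P; exists k. Qed.

(** v is half the axis of [par v 1], a group element whose norm is bounded in terms of the height of
    v. *)
Lemma unit_cusp_finite (M : R) : finite_set [set v | (exists i, unit_cusp i v) /\ v 2 0 <= M].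
Proof.
pose M' := Num.max (3 * M) 1.
have fS := finite_bounded hR (3 + 2 * M' ^+ 2 + 2 * M' ^+ 4).
apply: (sub_finite_set _ (finite_image (fun g => (2^-1 : R) *: axis g) fS)).
move=> v [[i Vi] vM]; have [vv v2] := unit_cusp_light Vi.
exists (par v 1); last first.
  suff -> : axis (par v 1) = 2 *: v by rewrite scalerA mulVf ?scale1r ?pnatr_eq0.
  apply: mcross_inj; rewrite -axisP ?mcrossZ; last exact: lorentz_par.
  rewrite inv_par // /par sqrrN; move: (mcross v) => A; move: (A *m A) => B.
  by apply/matrixP => a b; rewrite !mxE; ring.
split; first by case: Vi => _ P; apply/P; exists 1.
apply: nrm_par; last by rewrite normr1 le_max lexx orbT.
have vi j : `|v j 0| <= v 2 0 by apply: causal_entry => //; rewrite vv.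
have := vi 0; have := vi 1; have := vi 2; rewrite /vnrm le_max => h1 h2 h3; apply/orP; left.
by move: vM h1 h2 h3; lra.
Qed.

(** In the second case some g v is close to 0, and pairing g^-1 u with v is the same as pairing u
    with g v. *)
Lemma unit_cusp_approx v : light_cone v ->
  (exists2 c, 0 < c & exists i, unit_cusp i (c *: v)) \/
  (forall i e, 0 < e -> exists2 u, unit_cusp i u & - form u v < e).
Proof.
move=> lv; have [[t t0 Gt]|H] := parabolic_or_horospherical hR lv; [left|right].
  have pg : parabolic (par v t).
    apply: par_parabolic => // x hx xE; have E := ps_free hR Gt hx xE.
    by have := par_eq1 lv E => t0'; rewrite t0' eqxx in t0.
  have [_ _ Ks] := ps_cusps hR.
  have [|i _ iE] := Ks (cusp_of G v).
    exists v => //; exists (par v t); split=> //; split=> //.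
    by exists 1; rewrite /= ?par_fix ?scale1r ?(proj1 lv).
  have [|c c0 Vc] := @unit_cusp_exists i v; last by exists c => //; exists i.
  rewrite iE; exists 1%:M; first exact: (ps_one hR).
  by exists 1; rewrite /= ?mul1mx ?scale1r.
move=> i e e0; have [u Vu] := unit_cusp_nonempty i.
have lu := unit_cusp_light Vu; have [_ u2] := lu.
(* Each of the three products in the form is at most the product of the heights, now less than e /
   4. *)
have [|g Gg ge] := H (e / (4 * u 2 0)); first by rewrite divr_gt0 // mulr_gt0.
have Gi := ps_inv hR Gg; have Sg := ps_SOplus hR Gg.
exists (invmx g *m u); first exact: unit_cusp_stable.
have lgv := SOplus_light Sg lv; move: ge; set z := g *m v in lgv * => ge.
have -> : form (invmx g *m u) v = form u z.
  have [gf _ _] := Sg; rewrite -gf mulKVmx //; apply: lorentz_unit; exact: SOplus_lorentz.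
have [zz z2] := lgv; have zz' : form z z <= 0 by rewrite zz.
have zi := causal_entry zz' z2.
have [uu _] := lu; have uu' : form u u <= 0 by rewrite uu.
have ui := causal_entry uu' u2.
have P j : - (u j 0 * z j 0) <= u 2 0 * z 2 0.
  apply: le_trans (ler_norm _) _; rewrite normrN normrM; exact: ler_pM.
have := P 0; have := P 1; move: ge; rewrite ltr_pdivlMr ?mulr_gt0 // /form; nra.
Qed.
End Cusps.
End Horospheres.

(** * Cones and feasible functionals *)

Section Cones.
Context {R : realType}.
Implicit Types (v x y z w q d u t : 'cV[R]_3) (s : seq 'cV[R]_3) (S T : set 'cV[R]_3).

(* The sign makes future-directed causal q nonnegative on the light cone. *)
Definition pair q x : R := - form q x.

Lemma pairDl p q x : pair (p + q) x = pair p x + pair q x.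
Proof. by rewrite /pair formDl opprD. Qed.
Lemma pairDr q x y : pair q (x + y) = pair q x + pair q y.
Proof. by rewrite /pair formDr opprD. Qed.
Lemma pairZl a q x : pair (a *: q) x = a * pair q x.
Proof. by rewrite /pair formZl mulrN. Qed.
Lemma pairZr a q x : pair q (a *: x) = a * pair q x.
Proof. by rewrite /pair formZr mulrN. Qed.
Lemma pairNl q x : pair (- q) x = - pair q x.
Proof. by rewrite /pair formNl. Qed.
Lemma pairNr q x : pair q (- x) = - pair q x.
Proof. by rewrite /pair formNr. Qed.
Lemma pairC q x : pair q x = pair x q. Proof. by rewrite /pair formC. Qed.
Lemma pair0 q : pair q 0 = 0. Proof. by rewrite -[X in pair _ X](scale0r 0) pairZr mul0r. Qed.
Definition pairE := (pairDl, pairDr, pairNl, pairNr, pairZl, pairZr).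

Fixpoint combination s x : Prop :=
  if s is t :: s' then exists2 c : R, 0 <= c & combination s' (x - c *: t) else x = 0.

Definition cone S x := exists2 s, {in s, forall u, S u} & combination s x.

Lemma combinationZ s (a : R) x : 0 <= a -> combination s x -> combination s (a *: x).
Proof.
move=> a0; elim: s x => [|t s IH] x /=; first by move=> ->; rewrite scaler0.
by move=> [c c0 /IH]; rewrite scalerBr scalerA; exists (a * c); rewrite ?mulr_ge0.
Qed.

Lemma combination_cat s s' x y : combination s x -> combination s' y -> combination (s ++ s') (x + y).
Proof.
elim: s x => [|t s IH] x /=; first by move=> ->; rewrite add0r.
by move=> [c c0 /IH H] /H; exists c => //; rewrite addrAC.
Qed.

Lemma coneP S x : S x -> cone S x.
Proof.
move=> Sx; exists [:: x] => /=; first by move=> u; rewrite inE => /eqP->.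
by exists 1; rewrite ?scale1r ?subrr.
Qed.

Lemma coneS S T x : S `<=` T -> cone S x -> cone T x.
Proof. by move=> ST [s sS cs]; exists s => // u /sS; exact: ST. Qed.

Lemma coneZ S (a : R) x : 0 <= a -> cone S x -> cone S (a *: x).
Proof. by move=> a0 [s sS cs]; exists s => //; exact: combinationZ. Qed.

Lemma coneD S x y : cone S x -> cone S y -> cone S (x + y).
Proof.
move=> [s sS cs] [s' sS' cs']; exists (s ++ s'); last exact: combination_cat.
by move=> u; rewrite mem_cat => /orP[/sS|/sS'].
Qed.

Lemma cone0 S : cone S 0. Proof. by exists [::]. Qed.

Lemma cone_ind S (P : 'cV[R]_3 -> Prop) : P 0 ->
  (forall c t x, 0 <= c -> S t -> cone S x -> P x -> P (c *: t + x)) ->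
  forall x, cone S x -> P x.
Proof.
move=> P0 PS x [s]; elim: s x => [|t s IH] x sS /=; first by move=> ->.
move=> [c c0 cs]; rewrite -(subrK (c *: t) x) addrC; apply: PS => //.
- by apply: sS; rewrite mem_head.
- by exists s => // u us; apply: sS; rewrite inE us orbT.
- by apply: IH => // u us; apply: sS; rewrite inE us orbT.
Qed.

Lemma cone_idem S T x : S `<=` cone T -> cone S x -> cone T x.
Proof.
move=> ST; apply: cone_ind; first exact: cone0.
by move=> c t y c0 /ST Tt _; apply: coneD; exact: coneZ.
Qed.

Lemma cone_ge0 S q x : (forall u, S u -> 0 <= pair q u) -> cone S x -> 0 <= pair q x.
Proof.
move=> Sq; apply: (@cone_ind S (fun x => 0 <= pair q x)); first by rewrite pair0.
by move=> c t y c0 /Sq qt _ qy; rewrite !pairE addr_ge0 // mulr_ge0.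
Qed.

Lemma cone_eq0 S q x : (forall u, S u -> pair q u = 0) -> cone S x -> pair q x = 0.
Proof.
move=> Sq; apply: (@cone_ind S (fun x => pair q x = 0)); first by rewrite pair0.
by move=> c t y c0 /Sq qt _ qy; rewrite !pairE qt qy mulr0 addr0.
Qed.

Lemma cone_nonempty S x : cone S x -> x <> 0 -> exists2 t, S t & exists2 c : R, 0 < c & cone S (x - c *: t).
Proof.
have H : (x = 0 \/ exists2 t, S t & exists2 c : R, 0 < c & cone S (x - c *: t)) ->
  x <> 0 -> exists2 t, S t & exists2 c : R, 0 < c & cone S (x - c *: t) by case.
move=> Cx; apply: H; move: x Cx; apply: cone_ind; first by left.
move=> c t x; rewrite le_eqVlt => /orP[/eqP<- St Cx|c0 St Cx _]; first by rewrite scale0r add0r.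
by right; exists t => //; exists c => //; rewrite [_ + x]addrC addrK.
Qed.

(** If d separates x from the tail but is negative on the head t, everything is projected along t to
    the kernel of d. A functional separating the projections is then corrected by a multiple of d so
    as to vanish at t. *)
Lemma farkas s x : combination s x \/
  exists2 q, {in s, forall u, 0 <= pair q u} & pair q x < 0.
Proof.
(* The induction is on the length, since the tail gets replaced by its projection. *)
elim: {s}(size s) {-2}s (erefl (size s)) x => [|k IH] [|t s] //= sk x.
  case: (pselect (x = 0)) => [|x0]; [by left|right].
  (* [pair q x] is minus the squared Euclidean norm of x. *)
  pose q := vec3 (x 0 0) (x 1 0) (- x 2 0); exists q => //.
  rewrite lt_neqAle; apply/andP; split.
    apply/eqP => E; apply: x0; have : x 0 0 ^+ 2 + x 1 0 ^+ 2 + x 2 0 ^+ 2 = 0.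
      by move: E; rewrite /pair /form !vec3E; lra.
    move=> h; have := sqr_ge0 (x 0 0); have := sqr_ge0 (x 1 0); have := sqr_ge0 (x 2 0) => h1 h2 h3.
    by apply: cV3P; rewrite !mxE; apply/eqP; rewrite -sqrf_eq0; apply/eqP; lra.
  rewrite /pair /form !vec3E; have := sqr_ge0 (x 0 0); have := sqr_ge0 (x 1 0); have := sqr_ge0 (x 2 0); lra.
have {sk}sk : size s = k by case: sk.
have [cx|[d ds dx]] := IH s sk x.
  by left; exists 0 => //; rewrite scale0r subr0.
have [dt|dt] := leP 0 (pair d t).
  by right; exists d => // u; rewrite inE => /orP[/eqP->|/ds].
pose pr y := y - (pair d y / pair d t) *: t.
have [cx|[e es ex]] := IH (map pr s) (etrans (size_map _ _) sk) (pr x).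
  (* A combination of projections lifts to one of the original vectors plus a multiple of t,
     nonnegative because [pair d] has opposite signs on the tail and at t. *)
  left; have H : forall s' y, {in s', forall u, 0 <= pair d u} -> combination (map pr s') y ->
    exists2 c : R, 0 <= c & combination s' (y - c *: t).
    elim=> [|a s' IHs] y /= ds'; first by move=> ->; exists 0; rewrite ?scale0r ?subr0.
    move=> [c c0 /IHs[|c' c'0 H]]; first by move=> u us; apply: ds'; rewrite inE us orbT.
    have da := ds' a (mem_head _ _).
    exists (c' + c * (pair d a / - pair d t)).
      by rewrite addr_ge0 // mulr_ge0 // divr_ge0 // oppr_ge0 ltW.
    exists c => //; suff -> : y - (c' + c * (pair d a / - pair d t)) *: t - c *: a =
      y - c *: pr a - c' *: t by [].
    rewrite /pr; apply/colP => i; rewrite !mxE; field; by rewrite lt_eqF.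
  have [c c0 cy] := H _ _ ds cx; exists (c + pair d x / pair d t).
    by rewrite addr_ge0 // ltW // nmulr_rgt0 // invr_lt0.
  suff -> : x - (c + pair d x / pair d t) *: t = pr x - c *: t by [].
  by rewrite /pr scalerDl opprD addrA addrAC.
right; exists (e - (pair e t / pair d t) *: d).
  move=> u; rewrite inE => /orP[/eqP->|us].
    by rewrite !pairE divfK ?subrr // lt_eqF.
  have := es (pr u) (map_f pr us); rewrite /pr !pairE.
  by suff -> : pair d u / pair d t * pair e t = pair e t / pair d t * pair d u by []; ring.
move: ex; rewrite /pr !pairE.
by suff -> : pair d x / pair d t * pair e t = pair e t / pair d t * pair d x by []; ring.
Qed.

(** Radial projection forgets scale, so convex hulls may be replaced by the cones they generate,
    where Farkas and duality apply. *)
Lemma conv_hull_cone S x :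
  radial_proj (conv_hull S) x <-> hyperboloid x /\ cone S x.
Proof.
split=> -[hx].
  move=> [t t0 tx]; split=> //.
  have : cone S (t *: x).
    apply: (smallest_sub _ _ tx); last by move=> u; exact: coneP.
    move=> y z l; rewrite !inE => Cy Cz.
    by rewrite /conv /=; apply: coneD; apply: coneZ => //; rewrite subr_ge0.
  by move/(coneZ (a := t^-1)); rewrite scalerA mulVf ?gt_eqF // scale1r invr_ge0 ltW //; apply.
move=> Cx; split=> //.
have x0 : x <> 0 by move=> x0; move: hx; rewrite x0 => -[_]; rewrite mxE ltxx.
suff [c c0 cx] : exists2 c : R, 0 < c & conv_hull S (c^-1 *: x) by exists c^-1; rewrite ?invr_gt0.
suff : x = 0 \/ exists2 c : R, 0 < c & conv_hull S (c^-1 *: x) by case.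
move: x Cx {hx x0}; apply: cone_ind; first by left.
move=> c t x; rewrite le_eqVlt => /orP[/eqP<- St Cx|c0 St Cx]; first by rewrite scale0r add0r.
move=> H; right; case: H => [->|[e e0 ex]].
  exists c => //; rewrite addr0 scalerA mulVf ?gt_eqF // scale1r; exact: sub_gen_smallest.
(* The rescaled sum is the convex combination of t and x / e with weights c / (c + e) and e / (c +
   e). *)
exists (c + e); first exact: addr_gt0.
move=> C [cC SC].
have /andP[ce0 ce1] : 0 <= c / (c + e) <= 1.
  have ce := addr_gt0 c0 e0.
  by apply/andP; split; [rewrite divr_ge0 ?ltW|rewrite ler_pdivrMr // mul1r lerDl ltW].
have := cC t (e^-1 *: x) (Itv01 ce0 ce1).
rewrite !inE => /(_ (SC _ St) (ex _ (conj cC SC))); congr C.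
rewrite /conv /=; apply/colP => i; rewrite !mxE /unstable.onem /=; field.
by rewrite !gt_eqF ?addr_gt0.
Qed.
End Cones.

(** * Parabolic coordinates around a null vector *)

Section Causal.
Context {R : realType}.
Implicit Types (v x y z w q d u t : 'cV[R]_3).

Lemma pair_e3 x : pair e3 x = x 2 0.
Proof. by rewrite /pair /form !vec3E; ring. Qed.

Lemma pair_light_ge0 u v : light_cone u -> light_cone v -> 0 <= pair u v.
Proof. by move=> lu lv; rewrite oppr_ge0 light_le0. Qed.

Lemma pair_hyp_gt0 x v : hyperboloid x -> light_cone v -> 0 < pair v x.
Proof. by move=> hx lv; rewrite /pair formC oppr_gt0 form_hyp_light. Qed.

Lemma null_light y v : light_cone v -> form y y = 0 -> 0 < pair v y -> light_cone y.
Proof.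
move=> lv yy yv; split=> //; rewrite ltNge; apply/negP => y2.
have [y20|y20] := eqVneq (y 2 0) 0.
  suff y0 : y = 0 by move: yv; rewrite y0 pair0 ltxx.
  have := sqr_ge0 (y 0 0); have := sqr_ge0 (y 1 0); move: yy; rewrite /form y20 => h h1 h2.
  by apply: cV3P; rewrite !mxE //; apply/eqP; rewrite -sqrf_eq0; apply/eqP; lra.
have ly : light_cone (- y).
  by split; [rewrite formNl formNr yy oppr0 oppr0|rewrite mxE oppr_gt0 lt_neqAle y20].
by have := pair_light_ge0 lv ly; rewrite pairNr oppr_ge0 leNgt yv.
Qed.

Lemma light_antipode v : light_cone v -> exists2 y, light_cone y & pair v y = 1.
Proof.
move=> [vv v2]; pose m := vec3 (- v 0 0) (- v 1 0) (v 2 0).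
have lm : light_cone m by split; [move: vv; rewrite /form !vec3E; lra|rewrite vec3E].
have mv : pair v m = 2 * v 2 0 ^+ 2 by move: vv; rewrite /pair /form !vec3E; lra.
have c0 : 0 < 2 * v 2 0 ^+ 2 by rewrite mulr_gt0 ?exprn_gt0.
exists ((2 * v 2 0 ^+ 2)^-1 *: m); first by apply: lightZ; rewrite ?invr_gt0.
by rewrite pairZr mv mulVf // gt_eqF.
Qed.

Lemma pair_par v y s d : form v v = 0 -> pair v y = 1 ->
  pair d (par v s *m y) = pair d y + s * pair d (cross v y) + s ^+ 2 / 2 * pair d v.
Proof.
move=> vv vy; rewrite parE // -[form v y]opprK -/(pair v y) vy !pairE; by field.
Qed.

(* Parabolic coordinates with respect to [v]: any causal vector transverse to
   [v] lies, up to scale, on an upward ray issued from the horocycle through [y]. *)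
Lemma causal_param v y u : light_cone v -> light_cone y -> pair v y = 1 ->
  0 < pair v u ->
  exists s, u = pair v u *: (par v s *m y + (- form u u / (2 * pair v u ^+ 2)) *: v).
Proof.
move=> lv ly vy vu; have [vv _] := lv; set m := pair v u in vu *.
have m0 : m != 0 by rewrite gt_eqF.
pose mu := - form u u / (2 * m ^+ 2); pose z := m^-1 *: u - mu *: v.
have uv : form u v = - m by rewrite formC /m /pair opprK.
have vz : pair v z = 1 by rewrite /z !pairE [pair v v]/pair vv oppr0 mulr0 oppr0 addr0 -/m mulVf.
have zz : form z z = 0.
  by rewrite /z !formE vv (formC v) uv /mu; field.
have lz : light_cone z by apply: (null_light lv zz); rewrite vz.
have [||s sE] := @light_transport _ v y z lv ly _ lz.
- by rewrite !(formC _ v) -[LHS]opprK -[RHS]opprK -!/(pair _ _) vy vz.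
- by rewrite formC -[form _ _]opprK -/(pair _ _) vy oppr_eq0 oner_eq0.
exists s; rewrite sE /z subrK scalerA mulfV // scale1r //.
Qed.

(** The ideal points other than that of v form a line, on which the ray of [par v s *m y] has
    coordinate s. *)
Definition sigma v y u : R := form u (cross v y) / pair v u.

Lemma light_sigma v y u : light_cone v -> light_cone y -> pair v y = 1 ->
  light_cone u -> 0 < pair v u -> u = pair v u *: (par v (sigma v y u) *m y).
Proof.
move=> lv ly vy lu vu; have [s] := causal_param lv ly vy vu.
have [uu _] := lu; rewrite uu oppr0 mul0r scale0r addr0 => uE.
suff -> : sigma v y u = s by [].
have [vv _] := lv; rewrite /sigma {1}uE formZl parE // !formE form_cross2 vv (formC y (cross _ _)) form_crossr.
rewrite (formC v (cross _ _)) form_crossl (formC y v) -[form v y]opprK -/(pair v y) vy; field.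
by rewrite gt_eqF.
Qed.

(** Convexity of the quadratic in [pair_par]; it passes a sign from two neighbouring vertices of a
    punctured face to all the others. *)
Lemma convex_quadratic (a b c s t r : R) : 0 <= c ->
  a + s * b + s ^+ 2 / 2 * c < 0 -> 0 <= a + t * b + t ^+ 2 / 2 * c ->
  (s <= t <= r) || (r <= t <= s) -> 0 <= a + r * b + r ^+ 2 / 2 * c.
Proof.
move=> c0 fs ft H; rewrite leNgt; apply/negP => fr.
have E : (r - s) * (a + t * b + t ^+ 2 / 2 * c) =
  (r - t) * (a + s * b + s ^+ 2 / 2 * c) + (t - s) * (a + r * b + r ^+ 2 / 2 * c)
  - c / 2 * ((r - t) * (t - s) * (r - s)) by field.
case/orP: H => /andP[h1 h2].
  have st : s < t by rewrite lt_neqAle h1 andbT; apply/eqP => st; move: ft fs; rewrite st; lra.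
  have p1 : 0 <= (r - t) * (t - s) * (r - s) by rewrite !mulr_ge0 //; lra.
  have p2 := mulr_ge0 c0 p1.
  have p3 : (r - t) * (a + s * b + s ^+ 2 / 2 * c) <= 0 by apply: mulr_ge0_le0; [lra|exact: ltW].
  have p4 : (t - s) * (a + r * b + r ^+ 2 / 2 * c) < 0 by rewrite pmulr_rlt0 //; lra.
  have p5 : 0 <= (r - s) * (a + t * b + t ^+ 2 / 2 * c) by rewrite mulr_ge0 //; lra.
  lra.
have st : t < s by rewrite lt_neqAle h2 andbT; apply/eqP => st; move: ft fs; rewrite st; lra.
have p1 : 0 <= (t - r) * (s - t) * (s - r) by rewrite !mulr_ge0 //; lra.
have p2 := mulr_ge0 c0 p1.
have p3 : (t - r) * (a + s * b + s ^+ 2 / 2 * c) <= 0 by apply: mulr_ge0_le0; [lra|exact: ltW].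
have p4 : (s - t) * (a + r * b + r ^+ 2 / 2 * c) < 0 by rewrite pmulr_rlt0 //; lra.
have p5 : 0 <= (s - r) * (a + t * b + t ^+ 2 / 2 * c) by rewrite mulr_ge0 //; lra.
lra.
Qed.

Lemma quadratic_lead_ge0 (a b c : R) : (forall k : int, 0 <= a + k%:~R * b + k%:~R ^+ 2 / 2 * c) -> 0 <= c.
Proof.
move=> H; rewrite leNgt; apply/negP => c0.
pose k := (Num.truncn (2 * a / - c)).+1.
have H0 := H 0; have H1 := H k; have := H (- k%:Z); rewrite rmorphN /= sqrrN.
have kE : (k%:Z%:~R : R) = k%:R by [].
rewrite kE in H1 *; have nc : 0 < - c by rewrite oppr_gt0.
have k1 : 2 * a / - c < k%:R by exact: truncnS_gt.
have k2 : (1 : R) <= k%:R by rewrite ler1n.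
rewrite ltr_pdivrMr // in k1; move: H1; set r : R := k%:R in k1 k2 *; move=> H1 H2.
have H3 : r * - c <= r ^+ 2 * - c by rewrite ler_wpM2r ?(ltW nc) // expr2 ler_peMr //; lra.
lra.
Qed.

(** The future causal cone is its own dual; the test vector is the null vector with the spatial part
    of q. *)
Lemma causal_of_light_ge0 q : (forall v, light_cone v -> 0 <= pair q v) ->
  form q q <= 0 /\ 0 <= q 2 0.
Proof.
move=> H; pose r := Num.sqrt (q 0 0 ^+ 2 + q 1 0 ^+ 2).
have r2 : r ^+ 2 = q 0 0 ^+ 2 + q 1 0 ^+ 2 by rewrite sqr_sqrtr // addr_ge0 ?sqr_ge0.
have r0 : 0 <= r := sqrtr_ge0 _.
have [rE|r1] := eqVneq r 0.
  have := H _ light_e_null; have := sqr_ge0 (q 0 0); have := sqr_ge0 (q 1 0).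
  rewrite rE in r2; rewrite /pair /form !vec3E => h1 h2 h3.
  have q0 : q 0 0 = 0 by apply/eqP; rewrite -sqrf_eq0; apply/eqP; lra.
  have q1 : q 1 0 = 0 by apply/eqP; rewrite -sqrf_eq0; apply/eqP; lra.
  by have := sqr_ge0 (q 2 0); move: h3; rewrite q0 q1; split; lra.
have rp : 0 < r by rewrite lt_neqAle eq_sym r1.
have lv : light_cone (vec3 (q 0 0) (q 1 0) r).
  by split; rewrite /form !vec3E //; move: r2; lra.
have := H _ lv; rewrite /pair /form !vec3E => h.
have rq : r <= q 2 0 by rewrite -(ler_pM2r rp); move: h r2; lra.
by split; last exact: le_trans rq; move: r2; nra.
Qed.

Lemma causal_dichotomy q : form q q <= 0 -> 0 <= q 2 0 -> q <> 0 ->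
  0 < q 2 0 /\ (form q q < 0 \/ light_cone q).
Proof.
move=> qq q2 q0; have {}q2 : 0 < q 2 0.
  rewrite lt_neqAle q2 andbT eq_sym; apply/eqP => q20; apply: q0.
  have := sqr_ge0 (q 0 0); have := sqr_ge0 (q 1 0); move: qq; rewrite /form q20 => h h1 h2.
  by apply: cV3P; rewrite !mxE //; apply/eqP; rewrite -sqrf_eq0; apply/eqP; lra.
by split=> //; move: qq; rewrite le_eqVlt => /orP[/eqP qq|]; [right|left].
Qed.

Lemma timelike_pair q : form q q < 0 -> 0 < q 2 0 ->
  exists2 e : R, 0 < e & forall v, light_cone v -> e * v 2 0 <= pair q v.
Proof.
move=> qq q2; have hq := hyp_scale qq q2; set r := Num.sqrt _ in hq.
have r0 : 0 < r by rewrite sqrtr_gt0 oppr_gt0.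
pose k := 2 * (r^-1 * q 2 0) * r^-1; have k0 : 0 < k by rewrite !mulr_gt0 ?invr_gt0.
exists k^-1; first by rewrite invr_gt0.
move=> v [vv v2]; have vv' : form v v <= 0 by rewrite vv.
have := form_hyp_causal hq vv' v2; rewrite formZl mxE => h.
rewrite -(ler_pM2l k0) mulrA mulfV ?gt_eqF // mul1r; apply: le_trans h _.
by rewrite /k /pair -subr_ge0 le_eqVlt; apply/orP; left; apply/eqP; ring.
Qed.

Lemma pair_le d v : light_cone v -> `|pair d v| <= vnrm d * v 2 0.
Proof.
move=> [vv v2]; have vv' : form v v <= 0 by rewrite vv.
have vi := causal_entry vv' v2.
have P i : `|d i 0 * v i 0| <= `|d i 0| * v 2 0 by rewrite normrM ler_wpM2l.
rewrite /pair normrN /form /vnrm !mulrDl.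
apply: le_trans (ler_normB _ _) _; apply: lerD => //.
by apply: le_trans (ler_normD _ _) _; apply: lerD.
Qed.

End Causal.

Section Finite.
Context {R : realType}.

Lemma finite_uniform (T : choiceType) (F : set T) (P : T -> R -> Prop) : finite_set F ->
  (forall u, F u -> exists2 s, 0 < s & forall r, 0 <= r <= s -> P u r) ->
  exists2 s, 0 < s & forall u, F u -> forall r, 0 <= r <= s -> P u r.
Proof.
move=> /finite_seqP[l ->]; elim: l => [|a l IH] H; first by exists 1 => // u; rewrite /= in_nil.
have [|s s0 sP] := IH; first by move=> u ul; apply: H; rewrite /= inE; apply/orP; right.
have [|t t0 tP] := H a; first by rewrite /= mem_head.
exists (Num.min s t); first by rewrite lt_min s0.
move=> u; rewrite /= inE => /orP[/eqP->|ul] r /andP[r0]; rewrite le_min => /andP[rs rt].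
  by apply: tP; rewrite r0.
by apply: (sP u ul); rewrite r0.
Qed.
End Finite.

Lemma weightP {R : realType} (n : nat) (w : 'rV[R]_n) :
  weight w <-> (forall i, 0 <= w 0 i) /\ exists i, 0 < w 0 i.
Proof.
split=> -[w0 wn]; split=> //.
  apply: contrapT => H; apply: wn; apply/funext => a; apply/funext => i.
  rewrite [a]ord1 [RHS]/=; apply/eqP; rewrite eq_le w0 andbT leNgt.
  by apply/negP => wi; apply: H; exists i.
case: wn => i wi E; have : w 0 i = 0 by rewrite E.
by move=> wE; move: wi; rewrite wE ltxx.
Qed.

(** * Feasible functionals and their perturbation *)

Section CuspSystem.
Context {R : realType} (n : nat) (G : set 'M[R]_3) (K : 'I_n -> set 'cV[R]_3).
Hypothesis hR : punctured_surface G K.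
Implicit Types (v x y z q d u t : 'cV[R]_3) (w : 'rV[R]_n) (i j : 'I_n).
Notation V := (unit_cusp G K).

Definition feasible w : set 'cV[R]_3 := [set q | forall i u, V i u -> w 0 i <= pair q u].

(* Undecorated cusps (w i = 0) on which q vanishes count as tight, so that tight
   sets of sums are intersections; by [absorb] they do not enlarge the cell. *)
Definition tight w q : set 'cV[R]_3 := [set u | exists2 i, V i u & pair q u = w 0 i].

Definition cell w q : set 'cV[R]_3 := [set x | hyperboloid x /\ cone (tight w q) x].

Lemma vertex_low : exists2 e : R, 0 < e & forall i u, V i u -> e <= u 2 0.
Proof.
have [|s s0 sP] := finite_uniform (P := fun u r => r <= u 2 0) (unit_cusp_finite hR 1) _.
  move=> u [[i Vu] _]; have [_ u2] := unit_cusp_light hR Vu.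
  by exists (u 2 0) => // r /andP[].
exists (Num.min s 1); first by rewrite lt_min s0 ltr01.
move=> i u Vu; rewrite ge_min; case: (leP (u 2 0) 1) => u1.
  by apply/orP; left; apply: (sP u); rewrite ?lexx ?(ltW s0) //; split=> //; exists i.
by rewrite (ltW u1) orbT.
Qed.

Lemma cusp_pair0 i j u v : V i u -> V j v -> pair u v = 0 -> v = u /\ i = j.
Proof.
move=> Vu Vv /eqP; rewrite /pair oppr_eq0 formC => /eqP uv.
have lu := unit_cusp_light hR Vu; have lv := unit_cusp_light hR Vv.
have vE := light_parallel lv lu uv; have [_ u2] := lu; have [_ v2] := lv.
have c0 : 0 < v 2 0 / u 2 0 by rewrite divr_gt0.
have [c1 ij] := unit_cusp_unique hR Vu c0 (eq_ind _ (V j) Vv _ vE).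
by rewrite vE c1 scale1r.
Qed.

Lemma cusp_index_eq i j u : V i u -> V j u -> i = j.
Proof. move=> Vi Vj; have [uu _] := unit_cusp_light hR Vi.
by have [|] := cusp_pair0 Vi Vj; first by rewrite /pair uu oppr0. Qed.

Lemma pair_vertex_gt0 i j u v : V i u -> V j v -> v <> u -> 0 < pair u v.
Proof.
move=> Vu Vv vu; rewrite lt_neqAle eq_sym pair_light_ge0 ?andbT;
  [|exact: unit_cusp_light Vu|exact: unit_cusp_light Vv].
by apply/eqP => /(cusp_pair0 Vu Vv)[].
Qed.

(** The stabiliser of v shifts [sigma] by integers, so the coordinate can be brought into [0, 1). *)
Lemma cusp_window i j v u y : V i v -> V j u -> u <> v -> light_cone y -> pair v y = 1 ->
  exists k : int, exists2 s : R, 0 <= s < 1 & par v k%:~R *m u = pair v u *: (par v s *m y).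
Proof.
move=> Vv Vu uv ly vy; have lv := unit_cusp_light hR Vv; have [vv _] := lv.
have uE := light_sigma lv ly vy (unit_cusp_light hR Vu) (pair_vertex_gt0 Vv Vu uv).
set s := sigma v y u in uE; exists (- Num.floor s); exists (s - (Num.floor s)%:~R).
  by have /andP[h1 h2] := mem_rg1_floor s; apply/andP; split; move: h1 h2; lra.
by rewrite {1}uE -scalemxAr mulmxA parD // mulrNz addrC.
Qed.

Lemma par2_le v y (s M : R) : light_cone v -> light_cone y -> pair v y = 1 -> `|s| <= M ->
  (par v s *m y) 2 0 <= y 2 0 + M * `|pair e3 (cross v y)| + M ^+ 2 * v 2 0.
Proof.
move=> [vv v2] ly vy sM; rewrite -!pair_e3 pair_par // [pair e3 v]pair_e3.
apply: lerD; first apply: lerD => //.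
  by apply: le_trans (ler_norm _) _; rewrite normrM ler_wpM2r.
have s2 : s ^+ 2 <= M ^+ 2.
  by rewrite -real_normK ?num_real // ler_pXn2r ?nnegrE // (le_trans _ sM).
by have := sqr_ge0 s => h; rewrite ler_pM2r //; lra.
Qed.

(** Where q is nonnegative the null directions stay away from v, and there the pairing with v
    controls the height. *)
Lemma near_light q v : light_cone v -> pair q v < 0 ->
  exists2 C : R, 0 < C & forall u, light_cone u -> 0 <= pair q u -> u 2 0 <= C * pair v u.
Proof.
move=> lv qv; have [y ly vy] := light_antipode lv; have [vv v2] := lv; have [_ y2] := ly.
(* For |s| > M the quadratic of [pair_par] is negative, its leading coefficient being half of
   [pair q v]. *)
pose M := 2 * (`|pair q y| + `|pair q (cross v y)|) / - pair q v + 1.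
have M0 : 0 <= M by rewrite addr_ge0 // divr_ge0 ?mulr_ge0 ?addr_ge0 // oppr_ge0 ltW.
pose C := y 2 0 + M * `|pair e3 (cross v y)| + M ^+ 2 * v 2 0.
have C0 : 0 < C.
  have h1 : 0 <= M * `|pair e3 (cross v y)| by rewrite mulr_ge0.
  have h2 : 0 <= M ^+ 2 * v 2 0 by rewrite mulr_ge0 ?exprn_ge0 // ltW.
  by rewrite /C; lra.
exists C => // u lu qu; have [_ u2] := lu.
have vu : 0 < pair v u.
  rewrite lt_neqAle eq_sym pair_light_ge0 // andbT; apply/eqP => vu0.
  have uE : u = (u 2 0 / v 2 0) *: v.
    by apply: light_parallel => //; apply/eqP; rewrite -oppr_eq0 -/(pair u v) pairC vu0.
  by move: qu; rewrite uE pairZr pmulr_rge0 ?divr_gt0 // leNgt qv.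
have uE := light_sigma lv ly vy lu vu; set s := sigma v y u in uE.
have hE := congr1 (fun z : 'cV[R]_3 => z 2 0) uE; rewrite /= mxE in hE.
rewrite hE mulrC ler_pM2r //.
apply: par2_le => //; move: qu; rewrite {1}uE pairZr pmulr_rge0 // pair_par //.
move=> h; rewrite /M; set a := pair q y in h *; set b := pair q (cross v y) in h *.
move: qv h; set c := pair q v => c0 h; rewrite leNgt; apply/negP => sM.
have nc : 0 < - c by rewrite oppr_gt0.
have ab : 0 <= 2 * (`|a| + `|b|) / - c by rewrite divr_ge0 ?mulr_ge0 ?addr_ge0 // ltW.
have s1 : 1 < `|s| by move: sM; lra.
have : 2 * (`|a| + `|b|) < `|s| * - c by rewrite -ltr_pdivrMr //; lra.
have s2 : s ^+ 2 = `|s| ^+ 2 by rewrite real_normK // num_real.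
have h1 : a <= `|a| by exact: ler_norm.
have h2 : s * b <= `|s| * `|b| by rewrite -normrM ler_norm.
have h3 : `|a| <= `|s| * `|a| by rewrite ler_peMl // ltW.
move=> h4; have h5 : `|s| * (2 * (`|a| + `|b|)) < `|s| * (`|s| * - c) by rewrite ltr_pM2l //; lra.
by move: h h5; rewrite s2; lra.
Qed.

(** The parabolics at t bring u into a bounded window of [sigma] without changing [pair t u]. There
    the height is at most C times this pairing, and heights of vertices are bounded below. *)
Lemma vertex_separated i t : V i t -> exists2 c : R, 0 < c & forall j u, V j u -> u <> t -> c <= pair t u.
Proof.
move=> Vt; have [e e0 eP] := vertex_low; have lt := unit_cusp_light hR Vt.
have [y ly ty] := light_antipode lt.
pose C := y 2 0 + 1 * `|pair e3 (cross t y)| + 1 ^+ 2 * t 2 0.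
have C0 : 0 < C.
  have [_ y2] := ly; have [_ t2] := lt.
  by rewrite /C expr1n !mul1r addr_gt0 // -[ltLHS](addr0 0) ltr_leD.
exists (e / C); first exact: divr_gt0.
move=> j u Vu ut; have [k [s /andP[s0 s1] kE]] := cusp_window Vt Vu ut ly ty.
have := eP _ _ (unit_cusp_par hR k Vt Vu); rewrite kE mxE ler_pdivrMr // => h.
apply: le_trans h _; rewrite ler_pM2l; last exact: pair_vertex_gt0 Vt Vu ut.
by apply: par2_le => //; rewrite ger0_norm // ltW.
Qed.

Definition total_weight w : R := \sum_i `|w 0 i|.

Lemma le_total_weight w i : w 0 i <= total_weight w.
Proof.
rewrite /total_weight (bigD1 i) //=; apply: le_trans (ler_norm _) _.
by rewrite lerDl sumr_ge0.
Qed.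

Lemma total_ge0 w : 0 <= total_weight w. Proof. exact: sumr_ge0. Qed.

(** A large multiple of t dominates all weights at the other vertices and vanishes at t, where a
    multiple of [e3] gives the right value. *)
Lemma feasible_at w i t : weight w -> V i t -> exists2 q, feasible w q & pair q t = w 0 i.
Proof.
move=> [w0 _] Vt; have [c c0 cP] := vertex_separated Vt; have lt := unit_cusp_light hR Vt.
have [tt t2] := lt.
pose r := total_weight w / c; pose q := r *: t + (w 0 i / t 2 0) *: e3.
have qt : pair q t = w 0 i.
  by rewrite /q !pairE /pair tt oppr0 mulr0 add0r -/(pair e3 t) pair_e3 divfK ?gt_eqF.
exists q => // j u Vu; case: (pselect (u = t)) => [uE|ut].
  by move: Vu; rewrite uE qt => /(cusp_index_eq Vt) <-.
have [_ u2] := unit_cusp_light hR Vu.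
rewrite /q !pairE pair_e3; apply: le_trans (le_total_weight w j) _; rewrite -[leLHS]addr0 lerD //.
  rewrite /r mulrAC ler_pdivlMr // ler_wpM2l ?total_ge0 //; exact: cP Vu ut.
by rewrite mulr_ge0 ?divr_ge0 ?w0 ?ltW.
Qed.

(** At a cusp v, the values of q along a parabolic orbit of vertices are, up to a positive factor, a
    quadratic in k with leading coefficient half of [pair q v], and they stay positive. Towards any
    other direction there are vertices whose pairing with v tends to 0 while their height does not,
    against [near_light]. *)
Lemma light_ge0 w q i : V i `<=` [set u | w 0 i <= pair q u] -> 0 < w 0 i ->
  forall v, light_cone v -> 0 <= pair q v.
Proof.
move=> qw wi v lv; have [[c c0 [j Vj]]|H] := unit_cusp_approx hR lv.
  rewrite -(pmulr_rge0 _ c0) -pairZr; move: (c *: v) Vj => {lv}{}v Vv.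
  have lv := unit_cusp_light hR Vv; have [vv _] := lv.
  have [u Vu] := unit_cusp_nonempty hR i.
  case: (pselect (u = v)) => [uE|uv].
    by apply: le_trans (ltW wi) _; apply: qw; rewrite -uE.
  have [y ly vy] := light_antipode lv.
  have [m [s _ mE]] := cusp_window Vv Vu uv ly vy; have vu := pair_vertex_gt0 Vv Vu uv.
  have yv1 : pair v (par v s *m y) = 1.
    have [pf _] := lorentz_par s vv; rewrite /pair -{1}(par_fix s vv) pf; exact: vy.
  apply: (@quadratic_lead_ge0 _ (pair q (par v s *m y)) (pair q (cross v (par v s *m y)))) => k.
  rewrite -pair_par // -(pmulr_rge0 _ vu) -pairZr.
  have -> : pair v u *: (par v k%:~R *m (par v s *m y)) = par v k%:~R *m (par v m%:~R *m u).
    by rewrite mE scalemxAr.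
  apply: le_trans (ltW wi) _; apply: qw.
  by do 2 apply: (unit_cusp_par hR _ Vv).
rewrite leNgt; apply/negP => qv; have [C C0 CP] := near_light lv qv.
have [e e0 eP] := vertex_low; have [u Vu uv] := H i _ (divr_gt0 e0 C0).
have qu : 0 <= pair q u by apply: le_trans (ltW wi) _; exact: qw.
have := CP _ (unit_cusp_light hR Vu) qu; have := eP _ _ Vu; rewrite leNgt => /negP h1 h2.
by apply: h1; apply: le_lt_trans h2 _; rewrite mulrC -ltr_pdivlMr // pairC.
Qed.

Section Feasible.
Variables (w : 'rV[R]_n) (q : 'cV[R]_3).
Hypotheses (ww : weight w) (fq : feasible w q).

Lemma decorated : exists i, 0 < w 0 i.
Proof.
by have /weightP[] := ww.
Qed.

Lemma feasible_light_ge0 v : light_cone v -> 0 <= pair q v.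
Proof.
have [i wi] := decorated; apply: (@light_ge0 w q i) => // u Vu; exact: fq.
Qed.

Lemma feasible_causal : 0 < q 2 0 /\ (form q q < 0 \/ light_cone q).
Proof.
have [qq q2] := causal_of_light_ge0 feasible_light_ge0; apply: causal_dichotomy => // q0.
have [i wi] := decorated; have [u Vu] := unit_cusp_nonempty hR i.
by have := fq Vu; rewrite q0 pairC pair0 leNgt wi.
Qed.

(** If q did not point at a cusp, vertices of a decorated cusp would pair with q below their weight.
    At the cusp itself a null vector pairs to 0, which forces the weight 0. *)
Lemma feasible_light_cusp : light_cone q -> exists j, exists2 c : R, 0 < c & V j (c *: q) /\ w 0 j = 0.
Proof.
move=> lq; have [[c c0 [j Vj]]|H] := unit_cusp_approx hR lq.
  exists j; exists c => //; split=> //; apply/eqP; rewrite eq_le (proj1 ww) andbT.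
  by have := fq Vj; have [qq _] := lq; rewrite pairZr /pair qq oppr0 mulr0.
have [i wi] := decorated; have [u Vu] := H i _ wi.
by have := fq Vu; rewrite pairC -/(pair u q) leNgt => /negP.
Qed.

Lemma slack_gap d : (forall v, light_cone v -> pair q v = 0 -> 0 < pair d v) ->
  exists2 e : R, 0 < e & forall v, light_cone v -> pair d v < 0 -> e * v 2 0 <= pair q v.
Proof.
move=> dq; have [q2 [tq|lq]] := feasible_causal.
  by have [e e0 eP] := timelike_pair tq q2; exists e => // v lv _; exact: eP.
have dq0 : pair (- d) q < 0.
  by rewrite pairNl oppr_lt0; apply: dq => //; have [qq _] := lq; rewrite /pair qq oppr0.
have [C C0 CP] := near_light lq dq0; exists C^-1; first by rewrite invr_gt0.
move=> v lv dv; rewrite mulrC ler_pdivrMr // mulrC; apply: CP => //.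
by rewrite pairNl oppr_ge0 ltW.
Qed.

(** Only finitely many vertices lie below a given height, and each allows a small step. High up,
    wherever d is negative, q grows linearly with the height and outweighs both d and the
    weights. *)
Lemma slack d : (forall u, tight w q u -> 0 <= pair d u) ->
  (forall v, light_cone v -> pair q v = 0 -> 0 < pair d v) ->
  exists2 s : R, 0 < s & forall r, 0 <= r <= s -> feasible w (q + r *: d).
Proof.
move=> dt dq; have [e e0 eP] := slack_gap dq.
(* Above height M, q exceeds twice every weight wherever d is negative, so half of q may be lost to
   r d. *)
pose M := 2 * total_weight w / e.
have [|s s0 sP] := finite_uniform (P := fun u r => forall i, V i u -> w 0 i <= pair (q + r *: d) u)
    (unit_cusp_finite hR M).
  move=> u [[i Vu] _]; have lu := unit_cusp_light hR Vu.
  have [du|du] := leP 0 (pair d u).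
    exists 1 => // r /andP[r0 _] j Vj; rewrite !pairE; apply: le_trans (fq Vj) _.
    by rewrite lerDl mulr_ge0.
  have wq : w 0 i < pair q u.
    rewrite lt_neqAle fq // andbT; apply/eqP => wq.
    by have := dt u; rewrite leNgt du => /(_ (ex_intro2 _ _ i Vu (esym wq))).
  exists ((pair q u - w 0 i) / - pair d u); first by rewrite divr_gt0 ?oppr_gt0 // subr_gt0.
  move=> r /andP[r0]; rewrite ler_pdivlMr ?oppr_gt0 // => h j Vj.
  by rewrite -(cusp_index_eq Vu Vj) !pairE; move: h; rewrite mulrN; lra.
have [D DE] : exists D, D = vnrm d by exists (vnrm d).
have D0 : 0 <= D by rewrite DE vnrm_ge0.
have s'0 : 0 < e / (2 * D + 1) by rewrite divr_gt0 //; lra.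
exists (Num.min s (e / (2 * D + 1))); first by rewrite lt_min s0.
move=> r /andP[r0]; rewrite le_min => /andP[rs rD] i u Vu.
have lu := unit_cusp_light hR Vu; have [_ u2] := lu.
have [uM|uM] := leP (u 2 0) M.
  by apply: (sP u) => //; [split=> //; exists i|rewrite r0].
rewrite !pairE; have [du|du] := leP 0 (pair d u).
  by apply: le_trans (fq Vu) _; rewrite lerDl mulr_ge0.
apply: le_trans (le_total_weight w i) _; have h1 := eP _ lu du.
have h2 := pair_le d lu; rewrite -DE in h2; have h3 : - pair d u <= D * u 2 0.
  by apply: le_trans h2; rewrite -normrN ler_norm.
have h4 : r * - pair d u <= r * (D * u 2 0) by rewrite ler_wpM2l.
have h5 : r * (2 * D + 1) <= e by rewrite -ler_pdivlMr //; lra.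
have h6 : 2 * total_weight w <= u 2 0 * e by rewrite -ler_pdivrMr // ltW.
have h7 : r * (2 * D + 1) * u 2 0 <= e * u 2 0 by rewrite ler_pM2r.
have h8 : 0 <= r * u 2 0 by rewrite mulr_ge0 // ltW.
have E : r * (2 * D + 1) * u 2 0 = 2 * (r * (D * u 2 0)) + r * u 2 0 by ring.
by move: h1 h4 h6 h7 h8; rewrite E mulrN [u 2 0 * e]mulrC; lra.
Qed.
End Feasible.
End CuspSystem.

(** * Delaunay cells cover the hyperboloid *)

Section Covering.
Context {R : realType} (n : nat) (G : set 'M[R]_3) (K : 'I_n -> set 'cV[R]_3).
Hypothesis hR : punctured_surface G K.
Implicit Types (v x y z q d u t : 'cV[R]_3) (w : 'rV[R]_n) (i j : 'I_n).
Notation V := (unit_cusp G K).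

Lemma continuousT_opp (T : topologicalType) (a : T -> R) :
  continuous a -> continuous (fun r => - a r).
Proof. by move=> ca r; apply: cvgN; exact: ca. Qed.

Lemma continuousT_add (T : topologicalType) (a b : T -> R) :
  continuous a -> continuous b -> continuous (fun r => a r + b r).
Proof. by move=> ca cb r; apply: cvgD; [exact: ca|exact: cb]. Qed.

Lemma continuous_pair_tr u : continuous (fun r : 'rV[R]_3 => pair r^T u).
Proof.
have c (i : 'I_3) : continuous (fun r : 'rV[R]_3 => r^T i 0 * u i 0).
  have -> : (fun r : 'rV[R]_3 => r^T i 0 * u i 0) = (fun a => a * u i 0) \o (fun r : 'rV[R]_3 => r 0 i).
    by apply/funext => r; rewrite /= mxE.
  move=> r; apply: continuous_comp; first exact: coord_continuous.
  exact: mulrr_continuous.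
exact: (continuousT_opp (continuousT_add (continuousT_add (c 0) (c 1)) (continuousT_opp (c 2)))).
Qed.

(** Feasible functionals are causal, so a bound at x bounds all coordinates; the conditions being
    closed, the set is compact. *)
Lemma feasible_max w x (c : R) (f : 'cV[R]_3 -> R) : weight w -> hyperboloid x ->
  continuous (fun r : 'rV[R]_3 => f r^T) ->
  (exists2 q, feasible G K w q & pair q x <= c) ->
  exists q, [/\ feasible G K w q, pair q x <= c &
    forall q', feasible G K w q' -> pair q' x <= c -> f q' <= f q].
Proof.
move=> ww hx fc [q0 fq0 q0c].
(* Transposed, since the extreme value theorem used here is about row vectors. *)
pose A := [set r : 'rV[R]_3 | feasible G K w r^T /\ pair r^T x <= c].
have [|||r rA rmax] := @EVT_max_rV R 3 (fun r => f r^T) A.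
- by exists q0^T; rewrite /A /= trmxK.
- apply: bounded_closed_compact.
    have B r : A r -> forall a b, `|r a b| <= 2 * x 2 0 * c.
      move=> [fr rc] a b; have [r2 cr] := feasible_causal hR ww fr.
      have rr : form r^T r^T <= 0 by case: cr => [/ltW//|[-> _]].
      have h1 := form_hyp_causal hx rr r2; have [_ x2] := hx.
      have h2 : 2 * x 2 0 * pair r^T x <= 2 * x 2 0 * c by rewrite ler_pM2l // mulr_gt0.
      have -> : r a b = r^T b 0 by rewrite mxE [a]ord1.
      apply: le_trans (causal_entry rr r2 b) _; apply: le_trans h1 _; apply: le_trans h2.
      by rewrite /pair formC; lra.
    exists (2 * x 2 0 * c); split; first exact: num_real.
    move=> M cM r /[dup] Ar /B rB; rewrite /= -[`|r|]/(mx_norm r) mx_normrE.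
    apply/bigmax_leP; split; last by move=> ab _; apply: le_trans (ltW cM); exact: rB.
    by apply: le_trans (ltW cM); apply: le_trans (rB 0 0).
  have -> : A = (\bigcap_(p in [set p : 'I_n * 'cV[R]_3 | V p.1 p.2])
      (fun r : 'rV[R]_3 => pair r^T p.2) @^-1` [set y | w 0 p.1 <= y]) `&`
      (fun r : 'rV[R]_3 => pair r^T x) @^-1` [set y | y <= c].
    apply/seteqP; split=> r /= [fr rc]; split=> //; first by move=> [i u] /= Vu; exact: fr.
    by move=> i u Vu; exact: (fr (i, u)).
  apply: closedI; last first.
    by apply: preimage_closed; [move=> r _; exact: continuous_pair_tr|exact: closed_le].
  apply: closed_bigI => p _.
  by apply: preimage_closed; [move=> r _; exact: continuous_pair_tr|exact: closed_ge].
- by apply: continuous_subspaceT => r; exact: fc.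
exists r^T; move: rA; rewrite inE => -[fr rc]; split=> // q' fq' q'c.
by have := rmax q'^T; rewrite inE /A /= trmxK; apply.
Qed.

Definition nsq q : R := q 0 0 ^+ 2 + q 1 0 ^+ 2 + q 2 0 ^+ 2.

Lemma continuous_nsq_tr : continuous (fun r : 'rV[R]_3 => nsq r^T).
Proof.
have c (i : 'I_3) : continuous (fun r : 'rV[R]_3 => r^T i 0 ^+ 2).
  have -> : (fun r : 'rV[R]_3 => r^T i 0 ^+ 2) = (fun a => a ^+ 2) \o (fun r : 'rV[R]_3 => r 0 i).
    by apply/funext => r; rewrite /= mxE.
  move=> r; apply: continuous_comp; first exact: coord_continuous.
  exact: exprn_continuous.
exact: (continuousT_add (continuousT_add (c 0) (c 1)) (c 2)).
Qed.

Definition minimal w q x := forall q', feasible G K w q' -> pair q x <= pair q' x.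

(* The squared Euclidean norm is strictly convex: maximising it selects a
   minimiser that is not the midpoint of two others. *)
Lemma minimizer w x : weight w -> hyperboloid x -> exists q,
  [/\ feasible G K w q, minimal w q x &
   forall q', feasible G K w q' -> pair q' x <= pair q x -> nsq q' <= nsq q].
Proof.
move=> ww hx; have /weightP[_ [i wi]] := ww; have [t Vt] := unit_cusp_nonempty hR i.
have [q0 fq0 _] := feasible_at hR ww Vt.
have cN : continuous (fun r : 'rV[R]_3 => - pair r^T x).
  exact: (continuousT_opp (@continuous_pair_tr x)).
have [|q1 [fq1 q1c q1m]] := feasible_max (c := pair q0 x) (f := fun q => - pair q x) ww hx cN; first by exists q0.
have [|q2 [fq2 q2c q2m]] := feasible_max (c := pair q1 x) ww hx continuous_nsq_tr; first by exists q1.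
have m1 : minimal w q1 x.
  move=> q' fq'; have [q'c|/ltW q'c] := leP (pair q' x) (pair q0 x); last exact: le_trans q'c.
  by rewrite -lerN2; exact: q1m.
exists q2; split=> // [q' fq'|q' fq' q'c]; first by apply: le_trans q2c _; exact: m1.
by apply: q2m => //; exact: le_trans q2c.
Qed.

Lemma light_eq0_parallel q t : light_cone q -> light_cone t -> pair q t = 0 ->
  exists2 c, 0 < c & q = c *: t.
Proof.
move=> lq lt /eqP; rewrite oppr_eq0 => /eqP /(light_parallel lq lt) qE.
by have [_ q2] := lq; have [_ t2] := lt; exists (q 2 0 / t 2 0); rewrite ?divr_gt0.
Qed.

Lemma pair_par_inv q t u (s : R) : light_cone q -> light_cone t -> pair q t = 0 ->
  pair q (par t s *m u) = pair q u.
Proof.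
move=> lq lt qt; have [c c0 ->] := light_eq0_parallel lq lt qt; have [tt _] := lt.
by rewrite !pairZl /pair -{1}(par_fix s tt); have [-> _] := lorentz_par s tt.
Qed.

Lemma tight_par w q j t u (k : int) : light_cone q -> V j t ->
  pair q t = 0 -> tight G K w q u -> tight G K w q (par t k%:~R *m u).
Proof.
move=> lq Vt qt [i Vu qu]; exists i; first by have := unit_cusp_par hR k Vt Vu.
by rewrite pair_par_inv //; exact: unit_cusp_light Vt.
Qed.

Lemma vertex_finite (M : R) (P : set 'cV[R]_3) : (forall u, P u -> exists i, V i u) ->
  (forall u, P u -> u 2 0 <= M) -> finite_set P.
Proof.
move=> PV PM; apply: (sub_finite_set _ (unit_cusp_finite hR M)) => u Pu; split; [exact: PV|exact: PM].
Qed.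

Lemma tight_finite w q : weight w -> feasible G K w q -> form q q < 0 -> finite_set (tight G K w q).
Proof.
move=> ww fq tq; have [q2 _] := feasible_causal hR ww fq; have [e e0 eP] := timelike_pair tq q2.
apply: (@vertex_finite (total_weight w / e)) => u [i Vu qu]; first by exists i.
rewrite ler_pdivlMr // mulrC; apply: le_trans (eP _ (unit_cusp_light hR Vu)) _.
by rewrite qu; exact: le_total_weight.
Qed.

Lemma minimal_no_descent w q x d (s : R) : minimal w q x -> 0 < s -> pair d x < 0 ->
  ~ feasible G K w (q + s *: d).
Proof. by move=> mq s0 dx /mq; rewrite !pairE lerDl pmulr_rge0 // leNgt dx. Qed.

(** Linear programming duality: a functional separating x from the finite tight set is a feasible
    descent direction, which minimality excludes. *)
Lemma timelike_min_cone w q x : weight w -> feasible G K w q -> minimal w q x ->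
  form q q < 0 -> cone (tight G K w q) x.
Proof.
move=> ww fq mq tq; have /finite_seqP[l lE] := tight_finite ww fq tq.
have [cx|[d dl dx]] := farkas l x; first by exists l => // u ul; rewrite lE.
have [||s s0 sP] := slack hR ww fq (d := d).
- by move=> u; rewrite lE; exact: dl.
- move=> v lv qv; have [q2 _] := feasible_causal hR ww fq; have [e e0 eP] := timelike_pair tq q2.
  have := eP _ lv; rewrite qv leNgt => /negP[]; have [_ v2] := lv; exact: mulr_gt0.
by case: (minimal_no_descent mq s0 dx); apply: sP; rewrite lexx ltW.
Qed.

(** * Minimisers at an undecorated cusp *)

Section Lightlike.
Variables (w : 'rV[R]_n) (q t x y : 'cV[R]_3) (j : 'I_n).
Hypotheses (ww : weight w) (fq : feasible G K w q) (lq : light_cone q).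
Hypotheses (Vt : V j t) (qt : pair q t = 0) (ly : light_cone y) (ty : pair t y = 1).
Hypothesis hx : hyperboloid x.

Let lt : light_cone t := unit_cusp_light hR Vt.
Let tt : form t t = 0 := proj1 lt.

Notation T := (tight G K w q).

Lemma sigma_par u (k : int) : light_cone u -> 0 < pair t u ->
  sigma t y (par t k%:~R *m u) = sigma t y u + k%:~R.
Proof.
move=> lu tu; have tu' : pair t (par t k%:~R *m u) = pair t u.
  by apply: pair_par_inv => //; rewrite /pair tt oppr0.
rewrite /sigma tu' parE // !formE form_cross2 (formC t (cross _ _)) form_crossl tt.
have -> : form t y = -1 by rewrite -[LHS]opprK -/(pair t y) ty.
have -> : form u t = - pair t u by rewrite /pair opprK formC.
by field; rewrite gt_eqF.
Qed.

Lemma sigma_window (a b : R) : finite_set [set u | [/\ T u, u <> t & a <= sigma t y u <= b]].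
Proof.
have [c c0 qE] := light_eq0_parallel lq lt qt.
pose M := Num.max `|a| `|b|.
pose C := y 2 0 + M * `|pair e3 (cross t y)| + M ^+ 2 * t 2 0.
apply: (@vertex_finite (total_weight w / c * C)) => u [[i Vu qu] ut /andP[au ub]]; first by exists i.
have lu := unit_cusp_light hR Vu; have tu := pair_vertex_gt0 hR Vt Vu ut.
have uE := light_sigma lt ly ty lu tu.
have hE := congr1 (fun z : 'cV[R]_3 => z 2 0) uE; rewrite /= mxE in hE.
have [_ p2] : light_cone (par t (sigma t y u) *m y) by apply: SOplus_light => //; exact: SOplus_par.
rewrite hE; apply: ler_pM; rewrite ?(ltW tu) ?(ltW p2) //.
  by rewrite ler_pdivlMr // mulrC -pairZl -qE qu le_total_weight.
apply: par2_le => //; rewrite /M le_max; have [s0|s0] := leP 0 (sigma t y u).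
  by apply/orP; right; rewrite ger0_norm //; apply: le_trans ub (ler_norm _).
by apply/orP; left; rewrite ltr0_norm // -(normrN a); apply: le_trans (ler_norm _); rewrite lerN2.
Qed.

(* A punctured face is an infinite polygon with vertices ordered by [sigma]; its
   edge over [s] joins [u] and [v]. *)
Lemma sigma_neighbours u0 (s : R) : T u0 -> u0 <> t ->
  exists u v, [/\ T u, u <> t, T v, v <> t &
    sigma t y u <= s <= sigma t y v /\ forall z, T z -> z <> t ->
      sigma t y z <= sigma t y u \/ sigma t y v <= sigma t y z].
Proof.
move=> Tu0 u0t.
have shift (k : int) : [/\ T (par t k%:~R *m u0), par t k%:~R *m u0 <> t &
    sigma t y (par t k%:~R *m u0) = sigma t y u0 + k%:~R].
  have [i Vu0 _] := Tu0; have lu := unit_cusp_light hR Vu0; have tu := pair_vertex_gt0 hR Vt Vu0 u0t.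
  split; [by have := tight_par k lq Vt qt Tu0|move=> E|exact: sigma_par].
  by move: tu; rewrite -(pair_par_inv u0 k%:~R lt lt) ?E /pair tt oppr0 ?ltxx.
have [b [Tb bt bs]] : exists b, [/\ T b, b <> t & sigma t y b <= s].
  have [h1 h2 h3] := shift (Num.floor (s - sigma t y u0)).
  exists (par t (Num.floor (s - sigma t y u0))%:~R *m u0); split=> //; rewrite h3.
  by have /andP[] := mem_rg1_floor (s - sigma t y u0); lra.
have [a [Ta at_ as_]] : exists a, [/\ T a, a <> t & s <= sigma t y a].
  have [h1 h2 h3] := shift (Num.floor (s - sigma t y u0) + 1).
  exists (par t (Num.floor (s - sigma t y u0) + 1)%:~R *m u0); split=> //; rewrite h3 intrD.
  by have /andP[_] := mem_rg1_floor (s - sigma t y u0); lra.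
have /finite_seqP[l1 E1] := sigma_window (sigma t y b) s.
have /finite_seqP[l2 E2] := sigma_window s (sigma t y a).
have b1 : b \in l1.
  by have : [set` l1] b by rewrite -E1; split=> //; rewrite lexx.
have a2 : a \in l2.
  by have : [set` l2] a by rewrite -E2; split=> //; rewrite as_ lexx.
have [u u1 umax] := seq_min (fun z => - sigma t y z) b1.
have [v v2 vmin] := seq_min (sigma t y) a2.
have [Tu ut /andP[bu us]] : [set u | [/\ T u, u <> t & sigma t y b <= sigma t y u <= s]] u by rewrite E1.
have [Tv vt /andP[sv va]] : [set u | [/\ T u, u <> t & s <= sigma t y u <= sigma t y a]] v by rewrite E2.
exists u, v; split=> //; split; first by rewrite us sv.
move=> z Tz zt; have [zs|/ltW zs] := leP (sigma t y z) s.
  left; have [zb|/ltW zb] := leP (sigma t y b) (sigma t y z); last exact: le_trans bu.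
  rewrite -lerN2; apply: umax; have : [set` l1] z by rewrite -E1; split=> //; rewrite zb.
  by [].
right; have [za|/ltW za] := leP (sigma t y z) (sigma t y a); last exact: le_trans va za.
by apply: vmin; have : [set` l2] z by rewrite -E2; split=> //; rewrite zs.
Qed.

(** The tight set may be infinite, so Farkas is applied to t and the two vertices enclosing the
    coordinate of x. In that coordinate a separating functional is a convex quadratic, negative at x
    and nonnegative at both neighbours, hence nonnegative at every other tight vertex. It would be a
    descent direction by [slack]. *)
Lemma lightlike_min_cone : minimal w q x -> cone T x.
Proof.
move=> mq; have tT : T t.
  exists j => //; rewrite qt; apply/eqP; rewrite eq_le (proj1 ww) -qt; exact: fq.
have tx := pair_hyp_gt0 hx lt.
have noslack d : (forall u, T u -> u <> t -> 0 <= pair d u) -> 0 < pair d t -> pair d x < 0 -> False.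
  move=> dT dt dx; have [||s s0 sP] := slack hR ww fq (d := d).
  - by move=> u Tu; case: (pselect (u = t)) => [->|ut]; [exact: ltW|exact: dT].
  - move=> v lv qv; have [c c0 qE] := light_eq0_parallel lq lt qt.
    have [|c' c'0 ->] := light_eq0_parallel lv lt; last by rewrite pairZr mulr_gt0.
    by apply/eqP; move: qv; rewrite qE pairZl pairC => /eqP; rewrite mulf_eq0 gt_eqF.
  by case: (minimal_no_descent mq s0 dx); apply: sP; rewrite lexx ltW.
(* [slack] requires strict positivity at t. The added multiple of [e3] is positive on null vectors
   and only halves the negative value at x. *)
have perturb d (l : seq 'cV[R]_3) : {in l, forall u, light_cone u} -> {in l, forall u, 0 <= pair d u} -> pair d x < 0 ->
    exists d', {in l, forall u, 0 < pair d' u} /\ pair d' x < 0.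
  move=> ll dl dx; have [_ x2] := hx; exists (d + (- pair d x / (2 * x 2 0)) *: e3).
  have c0 : 0 < - pair d x / (2 * x 2 0) by rewrite divr_gt0 ?oppr_gt0 ?mulr_gt0.
  split; first by move=> u ul; rewrite !pairE pair_e3 ltr_wpDl ?dl // mulr_gt0 //; case: (ll u ul).
  rewrite !pairE pair_e3 -mulrA (_ : (2 * x 2 0)^-1 * x 2 0 = 2^-1); first lra.
  by field; rewrite gt_eqF.
case: (pselect (exists2 u0, T u0 & u0 <> t)) => [[u0 Tu0 u0t]|none].
  have [sx xE] := causal_param lt ly ty tx.
  set mu := (- form x x / _) in xE; have mu0 : 0 < mu.
    by rewrite /mu; have [-> _] := hx; rewrite opprK divr_gt0 // mulr_gt0 // exprn_gt0.
  have [u [v [Tu ut Tv vt [/andP[us sv] H]]]] := sigma_neighbours sx Tu0 u0t.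
  have Tl z : T z -> light_cone z by case=> k Vz _; exact: unit_cusp_light Vz.
  have Tp z : T z -> z <> t -> 0 < pair t z by case=> k Vz _; exact: pair_vertex_gt0 Vt Vz.
  have sT : {in [:: t; u; v], forall z, T z}.
    by move=> z; rewrite !inE => /or3P[] /eqP->.
  have [cx|[d dl dx]] := farkas [:: t; u; v] x; first by exists [:: t; u; v].
  have [z /sT/Tl //|d' [d'l d'x]] := perturb d [:: t; u; v] _ dl dx.
  have d't : 0 < pair d' t by apply: d'l; rewrite !inE eqxx.
  have d'u : 0 < pair d' u by apply: d'l; rewrite !inE eqxx orbT.
  have d'v : 0 < pair d' v by apply: d'l; rewrite !inE eqxx !orbT.
  case: (@noslack d') => // z Tz zt.
  have sgn z' : T z' -> z' <> t -> (0 <= pair d' z') =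
      (0 <= pair d' y + sigma t y z' * pair d' (cross t y) + sigma t y z' ^+ 2 / 2 * pair d' t).
    move=> Tz' z't; rewrite {1}(light_sigma lt ly ty (Tl _ Tz') (Tp _ Tz' z't)) pairZr pmulr_rge0 ?Tp //.
    by rewrite pair_par.
  have fx : pair d' y + sx * pair d' (cross t y) + sx ^+ 2 / 2 * pair d' t < 0.
    move: d'x; rewrite xE pairZr pmulr_rlt0 // pairDr pair_par // pairZr => h.
    by have := mulr_gt0 mu0 d't; move: h; lra.
  rewrite sgn //; have [zu|vz] := H z Tz zt.
    apply: (convex_quadratic (ltW d't) fx _ (t := sigma t y u)); first by rewrite -sgn // ltW.
    by rewrite zu us orbT.
  apply: (convex_quadratic (ltW d't) fx _ (t := sigma t y v)); first by rewrite -sgn // ltW.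
  by rewrite sv vz.
have [cx|[d dl dx]] := farkas [:: t] x.
  by exists [:: t] => // z; rewrite inE => /eqP->.
have [z|d' [d'l d'x]] := perturb d [:: t] _ dl dx; first by rewrite inE => /eqP->.
case: (@noslack d') => //; last by apply: d'l; rewrite inE.
by move=> u Tu ut; case: none; exists u.
Qed.
End Lightlike.

Lemma min_cone w q x : weight w -> hyperboloid x -> feasible G K w q -> minimal w q x ->
  cone (tight G K w q) x.
Proof.
move=> ww hx fq mq; have [q2 [tq|lq]] := feasible_causal hR ww fq.
  exact: timelike_min_cone.
have [j [c c0 [Vj wj]]] := feasible_light_cusp hR ww fq lq.
have lt := unit_cusp_light hR Vj; have [y ly ty] := light_antipode lt.
apply: (lightlike_min_cone ww fq lq Vj _ ly ty hx mq).
by have [qq _] := lq; rewrite pairZr /pair qq oppr0 mulr0.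
Qed.
End Covering.

(** * Undecorated vertices and the covering by cells *)

Section Cells.
Context {R : realType} (n : nat) (G : set 'M[R]_3) (K : 'I_n -> set 'cV[R]_3).
Hypothesis hR : punctured_surface G K.
Implicit Types (v x y z q d u t : 'cV[R]_3) (w : 'rV[R]_n) (i j : 'I_n).
Notation V := (unit_cusp G K).
Notation feasible := (feasible G K).
Notation tight := (tight G K).
Notation cell := (cell G K).

Lemma nsq_gt0 d : d <> 0 -> 0 < nsq d.
Proof.
move=> d0; rewrite lt_neqAle /nsq !addr_ge0 ?sqr_ge0 // andbT eq_sym; apply/eqP => E; apply: d0.
have := sqr_ge0 (d 0 0); have := sqr_ge0 (d 1 0); have := sqr_ge0 (d 2 0) => h1 h2 h3.
by apply: cV3P; rewrite mxE; apply/eqP; rewrite -sqrf_eq0; apply/eqP; lra.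
Qed.

Lemma nsq_parallelogram q d : nsq (q + d) + nsq (q - d) = 2 * nsq q + 2 * nsq d.
Proof. by rewrite /nsq !mxE; ring. Qed.

Lemma nsqZ (a : R) d : nsq (a *: d) = a ^+ 2 * nsq d.
Proof. by rewrite /nsq !mxE; ring. Qed.

Definition three (S : set 'cV[R]_3) : Prop :=
  exists x y z, [/\ S x, S y, S z & [/\ x <> y, y <> z & x <> z]].

Lemma tight_light w q u : tight w q u -> light_cone u.
Proof. by case=> i Vu _; exact: unit_cusp_light Vu. Qed.

Lemma tight_pair_gt0 w q u v : tight w q u -> tight w q v -> v <> u -> 0 < pair u v.
Proof. by move=> [i Vu _] [j Vv _]; exact: pair_vertex_gt0 Vu Vv. Qed.

Lemma cone_two w q x : hyperboloid x -> cone (tight w q) x ->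
  exists u v, [/\ tight w q u, tight w q v & u <> v].
Proof.
move=> hx cx; have x0 : x <> 0 by move=> x0; move: hx; rewrite x0 => -[_]; rewrite mxE ltxx.
have [t Tt _] := cone_nonempty cx x0; exists t.
apply: contrapT => H; have tx := pair_hyp_gt0 hx (tight_light Tt).
suff : pair t x = 0 by move=> E; rewrite E ltxx in tx.
apply: (cone_eq0 _ cx) => u Tu; have [tt _] := tight_light Tt.
suff <- : t = u by rewrite /pair tt oppr0.
by apply: contrapT => tu; apply: H; exists u.
Qed.

Section Punctured.
Variables (w : 'rV[R]_n) (q t : 'cV[R]_3) (j : 'I_n).
Hypotheses (ww : weight w) (fq : feasible w q) (Vt : V j t) (qt : pair q t = 0).

Lemma punctured_light : light_cone q.
Proof.
have [q2 [tq|//]] := feasible_causal hR ww fq; have [e e0 eP] := timelike_pair tq q2.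
have lt := unit_cusp_light hR Vt; have := eP _ lt; rewrite qt leNgt => /negP[].
by have [_ t2] := lt; exact: mulr_gt0.
Qed.

Lemma par_distinct u (k m : int) : light_cone u -> 0 < pair t u -> k != m ->
  par t k%:~R *m u <> par t m%:~R *m u.
Proof.
move=> lu tu km E; have lt := unit_cusp_light hR Vt; have [y ly ty] := light_antipode lt.
have := congr1 (sigma t y) E; rewrite !(sigma_par hR Vt ty) //.
by move=> /addrI /intr_inj /eqP; rewrite (negPf km).
Qed.

(** The tight vertices that correspond to horocycle points, as they appear in [delaunay]. *)
Definition decorated_tight : set 'cV[R]_3 := [set u | exists i, [/\ V i u, 0 < w 0 i & pair q u = w 0 i]].

Lemma decorated_tight_par u (k : int) : decorated_tight u -> decorated_tight (par t k%:~R *m u).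
Proof.
move=> [i [Vu wi qu]]; exists i; split=> //; first by have := unit_cusp_par hR k Vt Vu.
rewrite pair_par_inv //; [exact: punctured_light|exact: unit_cusp_light Vt].
Qed.

Lemma undecorated_eq i u : V i u -> w 0 i = 0 -> pair q u = w 0 i -> u = t.
Proof.
move=> Vu wi qu; rewrite wi in qu; have lq := punctured_light.
have [c c0 qE] := light_eq0_parallel lq (unit_cusp_light hR Vt) qt.
have tu : pair t u = 0 by apply/eqP; move: qu => /eqP; rewrite qE pairZl mulf_eq0 gt_eqF.
by have [] := cusp_pair0 hR Vt Vu tu.
Qed.

Lemma decorated_pair_gt0 u : decorated_tight u -> 0 < pair t u.
Proof.
move=> [i [Vu wi qu]]; apply: (pair_vertex_gt0 hR Vt Vu) => ut.
by move: wi; rewrite -qu ut qt ltxx.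
Qed.

Lemma tight_split u : tight w q u -> decorated_tight u \/ u = t.
Proof.
move=> [i Vu qu]; have [w0 _] := ww; have := w0 i; rewrite le_eqVlt => /orP[/eqP wi|wi].
  by right; apply: (undecorated_eq Vu _ qu).
by left; exists i.
Qed.

(** The parabolic at t moves one decorated vertex to infinitely many others. *)
Lemma decorated_three u : decorated_tight u -> three decorated_tight.
Proof.
move=> Tu; have tu := decorated_pair_gt0 Tu.
have lu : light_cone u by case: Tu => i [Vu _ _]; exact: unit_cusp_light Vu.
exists (par t (0 : int)%:~R *m u), (par t (1 : int)%:~R *m u), (par t (2 : int)%:~R *m u).
by split; [exact: decorated_tight_par|exact: decorated_tight_par|exact: decorated_tight_par|split; exact: par_distinct].
Qed.

(* p^k u + p^-k u = 2 u + k^2 <t, u> t for the parabolic p fixing t. *)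
Lemma absorb_cusp u (c l : R) : decorated_tight u -> 0 < c -> 0 <= l ->
  cone decorated_tight (c *: u + l *: t).
Proof.
move=> Tu c0 l0; have tu := decorated_pair_gt0 Tu; set m := pair t u in tu.
(* k is so large that removing twice the coefficient [al] from c leaves a nonnegative number. *)
pose k := (Num.truncn (2 * l / (m * c))).+1.
have k1 : 1 <= k%:R :> R by rewrite ler1n.
have k2 : 2 * l <= k%:R ^+ 2 * (m * c).
  rewrite -ler_pdivrMr ?mulr_gt0 //; apply: le_trans (ltW (truncnS_gt _)) _.
  by rewrite -/k expr2 ler_peMr // (le_trans ler01).
pose al := l / (k%:R ^+ 2 * m).
have al0 : 0 <= al by rewrite divr_ge0 // mulr_ge0 ?exprn_ge0 // ltW.
have [tt _] := unit_cusp_light hR Vt.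
have km : 0 < k%:R ^+ 2 * m by rewrite mulr_gt0 // exprn_gt0 // (lt_le_trans ltr01).
have kE : k%:R ^+ 2 * m != 0 by rewrite gt_eqF.
have -> : c *: u + l *: t = (c - 2 * al) *: u + al *: (par t k%:Z%:~R *m u + par t (- k%:Z)%:~R *m u).
  rewrite !parE // rmorphN /= sqrrN -[form t u]opprK -/(pair t u) -/m.
  apply/colP => a; rewrite !mxE -[k%:~R]/(k%:R : R).
  have -> : l * t a 0 = al * (k%:R ^+ 2 * m) * t a 0 by rewrite /al divfK.
  by field.
apply: coneD; apply: coneZ; rewrite ?subr_ge0 //.
- by rewrite /al mulrA ler_pdivrMr //; move: k2; rewrite mulrA [_ * c]mulrC.
- exact: coneP.
by apply: coneD; apply: coneP; exact: decorated_tight_par.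
Qed.

End Punctured.

(** All multiples of t are collected into one term. As x is not on the ray of t, some decorated
    vertex occurs with positive coefficient and absorbs that term. *)
Lemma absorb w q x : weight w -> feasible w q -> hyperboloid x -> cone (tight w q) x ->
  cone (decorated_tight w q) x.
Proof.
move=> ww fq hx cx.
have [[t [j [Vt wj qt]]]|H] := pselect (exists t j, [/\ V j t, w 0 j = 0 & pair q t = 0]); last first.
  apply: coneS cx => u [i Vu qu]; exists i; split=> //; rewrite lt_neqAle (proj1 ww) andbT eq_sym.
  by apply/eqP => wi; apply: H; exists u, i; rewrite qu.
have [l l0 cl] : exists2 l : R, 0 <= l & cone (decorated_tight w q) (x - l *: t).
  move: x cx {hx}; apply: cone_ind; first by exists 0; rewrite ?scale0r ?subr0 //; exact: cone0.
  move=> c u x c0 Tu _ [l l0 cl]; have [Tu'|->] := tight_split ww fq Vt qt Tu.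
    by exists l => //; rewrite -addrA; apply: coneD => //; apply: coneZ => //; exact: coneP.
  by exists (c + l); rewrite ?addr_ge0 // scalerDl opprD addrACA subrr add0r.
have lt := unit_cusp_light hR Vt; have tx := pair_hyp_gt0 hx lt.
have y0 : x - l *: t <> 0.
  move=> /eqP; rewrite subr_eq0 => /eqP xE; move: tx; have [tt _] := lt.
  by rewrite xE pairZr /pair tt oppr0 mulr0 ltxx.
have [u Tu [c c0 cu]] := cone_nonempty cl y0.
have -> : x = (c *: u + l *: t) + (x - l *: t - c *: u).
  by apply/colP => a; rewrite !mxE; ring.
by apply: coneD => //; apply: (absorb_cusp ww fq Vt qt Tu c0 l0).
Qed.

Lemma three_decorated w q : weight w -> feasible w q -> three (tight w q) -> three (decorated_tight w q).
Proof.
move=> ww fq [x [y [z [Tx Ty Tz [xy yz xz]]]]].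
have [[t [j [Vt wj qt]]]|H] := pselect (exists t j, [/\ V j t, w 0 j = 0 & pair q t = 0]); last first.
  have dT u : tight w q u -> decorated_tight w q u.
    move=> [i Vu qu]; exists i; split=> //; rewrite lt_neqAle (proj1 ww) andbT eq_sym.
    by apply/eqP => wi; apply: H; exists u, i; rewrite qu.
  by exists x, y, z; split=> //; exact: dT.
have [dx|xt] := tight_split ww fq Vt qt Tx; first apply: (decorated_three ww fq Vt qt dx).
have [dy|yt] := tight_split ww fq Vt qt Ty; first apply: (decorated_three ww fq Vt qt dy).
by case: xy; rewrite xt yt.
Qed.

Lemma covering w x : weight w -> hyperboloid x ->
  exists q, [/\ feasible w q, three (tight w q) & cell w q x].
Proof.
move=> ww hx; have [q [fq mq nq]] := minimizer hR ww hx.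
have cx := min_cone hR ww hx fq mq; exists q; split=> //.
have [u [v [Tu Tv uv]]] := cone_two hx cx.
have [q2 [tq|lq]] := feasible_causal hR ww fq; last first.
  have [j [c c0 [Vj wj]]] := feasible_light_cusp hR ww fq lq.
  have qt : pair q (c *: q) = 0 by have [qq _] := lq; rewrite pairZr /pair qq oppr0 mulr0.
  have dT z : decorated_tight w q z -> tight w q z by move=> [i [Vz _ qz]]; exists i.
  have H z : decorated_tight w q z -> three (tight w q).
    by move=> /(decorated_three ww fq Vj qt)[a [b [d [Ta Tb Td D]]]]; exists a, b, d; split=> //; exact: dT.
  have [/H //|ut] := tight_split ww fq Vj qt Tu; have [/H //|vt] := tight_split ww fq Vj qt Tv.
  by case: uv; rewrite ut vt.
(* With only two tight vertices q could move both ways along a d orthogonal to them, and one of the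
   two ends would have larger [nsq]. *)
apply: contrapT => no3; have [d [du dv d0]] : exists d, [/\ pair d u = 0, pair d v = 0 & d <> 0].
  exists (cross u v); rewrite /pair form_crossl form_crossr oppr0; split=> // d0.
  have lu := tight_light Tu; have lv := tight_light Tv.
  have [c uE] := cross_eq0 d0 (light_neq0 lv).
  have := tight_pair_gt0 Tv Tu uv; have [vv _] := lv.
  by rewrite uE pairZr /pair vv oppr0 mulr0 ltxx.
have T2 z : tight w q z -> z = u \/ z = v.
  move=> Tz; apply: contrapT => /not_orP[zu zv]; apply: no3; exists z, u, v.
  by split.
have dT z : tight w q z -> pair d z = 0 by move=> /T2[] ->.
have dx : pair d x = 0 by apply: cone_eq0 cx.
have tpos z : light_cone z -> pair q z = 0 -> 0 < pair d z.
  move=> lz qz; have [e e0 eP] := timelike_pair tq q2.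
  by have := eP _ lz; rewrite qz leNgt => /negP[]; have [_ z2] := lz; exact: mulr_gt0.
have tneg z : light_cone z -> pair q z = 0 -> 0 < pair (- d) z.
  move=> lz qz; have [e e0 eP] := timelike_pair tq q2.
  by have := eP _ lz; rewrite qz leNgt => /negP[]; have [_ z2] := lz; exact: mulr_gt0.
have [|s s0 sP] := slack hR ww fq _ tpos; first by move=> z /dT ->.
have [|r r0 rP] := slack hR ww fq _ tneg; first by move=> z /dT; rewrite pairNl => ->; rewrite oppr0.
pose m := Num.min s r; have m0 : 0 < m by rewrite lt_min s0.
have f1 : feasible w (q + m *: d) by apply: sP; rewrite (ltW m0) /m ge_min lexx.
have f2 : feasible w (q + m *: (- d)) by apply: rP; rewrite (ltW m0) /m ge_min lexx orbT.
have n1 : nsq (q + m *: d) <= nsq q by apply: nq => //; rewrite !pairE dx mulr0 addr0.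
have n2 : nsq (q + m *: (- d)) <= nsq q by apply: nq => //; rewrite !pairE dx oppr0 mulr0 addr0.
have dn := nsq_gt0 d0.
have := mulr_gt0 (exprn_gt0 2 m0) dn; have := nsq_parallelogram q (m *: d).
by rewrite -scalerN nsqZ; move: n1 n2; lra.
Qed.

End Cells.

(** * Delaunay decompositions and secondary cones *)

Section Determined.
Context {R : realType}.
Implicit Types (x y z q : 'cV[R]_3).

(** Minus the Gram determinant; it shows that three distinct null directions are independent. *)
Lemma det3_light x y z : form x x = 0 -> form y y = 0 -> form z z = 0 ->
  det3 x y z ^+ 2 = 2 * (pair x y * pair y z * pair x z).
Proof.
move=> xx yy zz.
have -> : det3 x y z ^+ 2 = - (form x x * (form y y * form z z - form y z ^+ 2)
   - form x y * (form x y * form z z - form y z * form x z)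
   + form x z * (form x y * form y z - form y y * form x z)).
  by rewrite /det3 /form; ring.
by rewrite xx yy zz /pair; ring.
Qed.

Lemma form_det3 q x y z : det3 x y z *: q =
  form q x *: cross y z + form q y *: cross z x + form q z *: cross x y.
Proof. by apply: cV3P; rewrite !mxE /= /det3 /form; ring. Qed.

Lemma pair_determined q q' x y z : det3 x y z != 0 ->
  pair q x = pair q' x -> pair q y = pair q' y -> pair q z = pair q' z -> q = q'.
Proof.
move=> D qx qy qz; apply/eqP; rewrite -subr_eq0; apply/eqP.
apply: (scalerI D); rewrite scaler0 form_det3.
have E u : pair q u = pair q' u -> form (q - q') u = 0.
  by rewrite /pair !formE => /oppr_inj ->; rewrite subrr.
by rewrite !E // !scale0r !addr0.
Qed.

Lemma plane_pair q : exists a : 'rV[R]_3, forall x, (a *m x) 0 0 = pair q x.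
Proof.
exists (\row_i [:: - q 0 0; - q 1 0; q 2 0]`_i) => x.
by rewrite mulmx3E !mxE /= /pair /form; ring.
Qed.

Lemma pair_plane (a : 'rV[R]_3) : exists q, forall x, (a *m x) 0 0 = pair q x.
Proof.
exists (vec3 (- a 0 0) (- a 0 1) (a 0 2)) => x.
by rewrite mulmx3E /pair /form !vec3E; ring.
Qed.

End Determined.

(** * Delaunay cells as cones over tight sets *)

Section Delaunay.
Context {R : realType} (n : nat) (G : set 'M[R]_3) (K : 'I_n -> set 'cV[R]_3).
Hypothesis hR : punctured_surface G K.
Implicit Types (v x y z q d u t : 'cV[R]_3) (w : 'rV[R]_n) (i j : 'I_n).
Notation V := (unit_cusp G K).
Notation feasible := (feasible G K).
Notation tight := (tight G K).
Notation cell := (cell G K).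
Notation decorated_tight := (decorated_tight G K).

Lemma pair_min w q q' x : feasible w q' -> cone (tight w q) x -> pair q x <= pair q' x.
Proof.
move=> fq' cx; rewrite -subr_ge0 -pairNl -pairDl; apply: cone_ge0 cx => u [i Vu qu].
by rewrite pairDl pairNl qu subr_ge0 fq'.
Qed.

Lemma sum_hyp w q x y z : tight w q x -> tight w q y -> tight w q z -> x <> y -> y <> z ->
  exists2 r : R, 0 < r & hyperboloid (r *: (x + y + z)).
Proof.
move=> Tx Ty Tz xy yz; have lx := tight_light hR Tx; have ly := tight_light hR Ty; have lz := tight_light hR Tz.
have p1 := tight_pair_gt0 hR Ty Tx xy; have p2 := tight_pair_gt0 hR Tz Ty yz.
have p3 := pair_light_ge0 lx lz.
have xx : form (x + y + z) (x + y + z) < 0.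
  have [xx _] := lx; have [yy _] := ly; have [zz _] := lz; rewrite !formE xx yy zz.
  move: p1 p2 p3; rewrite /pair (formC z y) (formC y x) (formC z x); lra.
have x2 : 0 < (x + y + z) 2 0.
  by have [_ x2] := lx; have [_ y2] := ly; have [_ z2] := lz; rewrite !mxE !addr_gt0.
by exists (Num.sqrt (- form (x + y + z) (x + y + z)))^-1; [rewrite invr_gt0 sqrtr_gt0 oppr_gt0|exact: hyp_scale].
Qed.

(* At the sum of three vertices, q' = q because both are minimal there, and then
   q' = q at each of the three vertices, which are linearly independent. *)
Lemma cell_center w q : feasible w q -> three (tight w q) ->
  exists2 x, cell w q x & forall q', feasible w q' -> cell w q' x -> q' = q.
Proof.
move=> fq [x [y [z [Tx Ty Tz [xy yz xz]]]]]; have [r r0 hx] := sum_hyp Tx Ty Tz xy yz.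
have cx : cone (tight w q) (r *: (x + y + z)).
  by apply: coneZ; [exact: ltW|apply: coneD; [apply: coneD|]; exact: coneP].
exists (r *: (x + y + z)); first by [].
move=> q' fq' [_ cx'].
have := pair_min fq' cx; have := pair_min fq cx'; rewrite !pairZr !(ler_pM2l r0) !pairDr => h1 h2.
have L u : tight w q u -> pair q u <= pair q' u by case=> i Vu ->; exact: fq'.
have := L _ Tx; have := L _ Ty; have := L _ Tz => lz ly lx.
suff D : det3 x y z != 0.
  by apply: (pair_determined D); move: h1 h2 lx ly lz; lra.
have [xx _] := tight_light hR Tx; have [yy _] := tight_light hR Ty; have [zz _] := tight_light hR Tz.
rewrite -sqrf_eq0 det3_light //.
have := tight_pair_gt0 hR Ty Tx xy; have := tight_pair_gt0 hR Tz Ty yz; have := tight_pair_gt0 hR Tz Tx xz.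
by rewrite (pairC z x) (pairC z y) (pairC y x) => p1 p2 p3; rewrite gt_eqF // !mulr_gt0.
Qed.

Lemma all_horo_pointsE w v : all_horo_points G K w v <-> exists i, 0 < w 0 i /\ V i (w 0 i *: v).
Proof.
split=> [[i _ /(horo_pointsE hR)]|[i]]; first by exists i.
by exists i => //; apply/(horo_pointsE hR).
Qed.

Lemma horo_plane w q (a : 'rV[R]_3) : (forall x, (a *m x) 0 0 = pair q x) -> forall v,
  (all_horo_points G K w `&` plane a) v <->
  exists i, [/\ 0 < w 0 i, V i (w 0 i *: v) & pair q (w 0 i *: v) = w 0 i].
Proof.
move=> aq v; split.
  move=> [/all_horo_pointsE [i [wi Vi]]]; rewrite /plane /= aq => qv; exists i; split=> //.
  by rewrite pairZr qv mulr1.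
move=> [i [wi Vi qv]]; split; first by apply/all_horo_pointsE; exists i.
by rewrite /plane /= aq; apply: (mulfI (lt0r_neq0 wi)); rewrite -pairZr qv mulr1.
Qed.

(** Horocycle points give the inequalities at decorated cusps; at the undecorated ones [light_ge0]
    supplies 0 <= [pair q u]. *)
Lemma horo_feasible w q (a : 'rV[R]_3) : weight w -> (forall x, (a *m x) 0 0 = pair q x) ->
  (forall x, all_horo_points G K w x -> 1 <= (a *m x) 0 0) <-> feasible w q.
Proof.
move=> ww aq; split=> H.
  have D i u : V i u -> 0 < w 0 i -> w 0 i <= pair q u.
    move=> Vu wi; have := H ((w 0 i)^-1 *: u); rewrite aq pairZr mulrC ler_pdivlMr // mul1r; apply.
    by apply/all_horo_pointsE; exists i; rewrite scalerA mulfV ?scale1r ?gt_eqF.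
  move=> i u Vu; have := proj1 ww i; rewrite le_eqVlt => /orP[/eqP <-|]; last exact: D.
  have /weightP[_ [j wj]] := ww.
  by apply: (light_ge0 hR _ wj (unit_cusp_light hR Vu)) => z Vz; exact: D.
move=> v /all_horo_pointsE [i [wi Vi]]; rewrite aq -(ler_pM2l wi) mulr1 -pairZr; exact: H.
Qed.

Lemma horo_three w q (a : 'rV[R]_3) : weight w -> feasible w q -> (forall x, (a *m x) 0 0 = pair q x) ->
  (exists x y z, [/\ (all_horo_points G K w `&` plane a) x, (all_horo_points G K w `&` plane a) y,
     (all_horo_points G K w `&` plane a) z & [/\ x <> y, y <> z & x <> z]]) <-> three (tight w q).
Proof.
move=> ww fq aq; have HP := horo_plane w aq; split.
  move=> [x [y [z [/HP[i [wi Vi qi]] /HP[j [wj Vj qj]] /HP[k [wk Vk qk]] [xy yz xz]]]]].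
  have inj (a' b : 'I_n) (u v : 'cV[R]_3) : 0 < w 0 a' -> V a' (w 0 a' *: u) -> V b (w 0 b *: v) -> u <> v ->
      w 0 a' *: u <> w 0 b *: v.
    move=> wa Va Vb uv E; apply: uv; rewrite -E in Vb.
    by move: E; rewrite (cusp_index_eq hR Va Vb) => /scalerI; apply; rewrite -(cusp_index_eq hR Va Vb) gt_eqF.
  exists (w 0 i *: x), (w 0 j *: y), (w 0 k *: z); split; [by exists i|by exists j|by exists k|].
  by split; [exact: inj Vi Vj xy|exact: inj Vj Vk yz|exact: inj Vi Vk xz].
move=> /(three_decorated hR ww fq)[x [y [z [[i [Vi wi qi]] [j [Vj wj qj]] [k [Vk wk qk]] [xy yz xz]]]]].
have D a' u : V a' u -> 0 < w 0 a' -> pair q u = w 0 a' -> (all_horo_points G K w `&` plane a) ((w 0 a')^-1 *: u).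
  by move=> Va wa qa; apply/HP; exists a'; rewrite scalerA mulfV ?gt_eqF // scale1r.
have inj a' b u v : 0 < w 0 a' -> 0 < w 0 b -> V a' u -> V b v -> u <> v -> (w 0 a')^-1 *: u <> (w 0 b)^-1 *: v.
  move=> wa wb Va Vb uv E; apply: uv.
  have uE : u = (w 0 a' * (w 0 b)^-1) *: v by rewrite -scalerA -E scalerA mulfV ?gt_eqF // scale1r.
  have c0 : 0 < w 0 a' * (w 0 b)^-1 by rewrite divr_gt0.
  by rewrite uE in Va *; have [-> _] := unit_cusp_unique hR Vb c0 Va; rewrite scale1r.
exists ((w 0 i)^-1 *: x), ((w 0 j)^-1 *: y), ((w 0 k)^-1 *: z).
by split; [exact: D|exact: D|exact: D|split; [exact: inj Vi Vj xy|exact: inj Vj Vk yz|exact: inj Vi Vk xz]].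
Qed.

(** The two generating sets differ by positive scaling and by undecorated vertices, which [absorb]
    removes. *)
Lemma horo_cell w q (a : 'rV[R]_3) : weight w -> feasible w q -> (forall x, (a *m x) 0 0 = pair q x) ->
  radial_proj (conv_hull (all_horo_points G K w `&` plane a)) = cell w q.
Proof.
move=> ww fq aq; have HP := horo_plane w aq; apply/seteqP; split=> x.
  move=> /conv_hull_cone[hx cx]; split=> //; apply: cone_idem cx => v /HP[i [wi Vi qi]].
  have -> : v = (w 0 i)^-1 *: (w 0 i *: v) by rewrite scalerA mulVf ?gt_eqF // scale1r.
  by apply: coneZ; [rewrite invr_ge0 ltW|apply: coneP; exists i].
move=> [hx /(absorb hR ww fq hx) cx]; apply/conv_hull_cone; split=> //.
apply: cone_idem cx => u [i [Vu wi qu]].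
have -> : u = w 0 i *: ((w 0 i)^-1 *: u) by rewrite scalerA mulfV ?gt_eqF // scale1r.
apply: coneZ; first exact: ltW.
by apply: coneP; apply/HP; exists i; rewrite scalerA mulfV ?gt_eqF // scale1r.
Qed.

Lemma delaunayE w P : weight w -> delaunay G K w P <->
  exists q, [/\ feasible w q, three (tight w q) & P = cell w q].
Proof.
move=> ww; split.
  move=> [a [a3 aB] <-]; have [q aq] := pair_plane a; exists q.
  have fq : feasible w q by apply/(horo_feasible ww aq).
  by split; [|apply/(horo_three ww fq aq)|rewrite (horo_cell ww fq aq)].
move=> [q [fq t3 ->]]; have [a aq] := plane_pair q; exists a; last exact: horo_cell.
by split; [apply/(horo_three ww fq aq)|apply/(horo_feasible ww aq)].
Qed.

(** An edge lies in a 2-cell of S and goes where that cell goes; conversely, what lies in an edge of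
    T lies in a 2-cell of T. *)
Lemma refinesP (S T : set (set 'cV[R]_3)) :
  refines S T <-> forall P, S P -> exists2 Q, T Q & P `<=` Q.
Proof.
split=> H P.
  move=> SP; have [Q [TQ|[Q1 [Q2 [TQ1 _ _ QE _]]]] PQ] := H P (or_introl SP); first by exists Q.
  by exists Q1 => //; rewrite QE in PQ => x /PQ[].
move=> [/H[Q TQ PQ]|[P1 [P2 [/H[Q TQ PQ] _ _ -> _]]]]; first by exists Q => //; left.
by exists Q; [left|move=> x [/PQ]].
Qed.

Lemma refines_trans (S T U : set (set 'cV[R]_3)) : refines S T -> refines T U -> refines S U.
Proof.
move=> /refinesP ST /refinesP TU; apply/refinesP => P /ST[Q /TU[X UX QX] PQ].
by exists X => // x /PQ /QX.
Qed.

(** A cell P lies in some Q, which lies in a cell P' of the first decomposition. The point given by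
    [cell_center] belongs to both P and P', so P = P' = Q. *)
Lemma delaunay_refines_anti w w' : weight w -> weight w' ->
  refines (delaunay G K w) (delaunay G K w') -> refines (delaunay G K w') (delaunay G K w) ->
  delaunay G K w = delaunay G K w'.
Proof.
have H a b : weight a -> weight b -> refines (delaunay G K a) (delaunay G K b) ->
    refines (delaunay G K b) (delaunay G K a) -> delaunay G K a `<=` delaunay G K b.
  move=> wa wb /refinesP ab /refinesP ba P DP; have [Q DQ PQ] := ab P DP; have [P' DP' QP'] := ba Q DQ.
  have /(delaunayE _ wa)[q [fq t3 PE]] := DP; have /(delaunayE _ wa)[q' [fq' _ PE']] := DP'.
  have [x cx xq] := cell_center fq t3.
  have qq' : q' = q by apply: xq => //; rewrite -PE'; apply: QP'; apply: PQ; rewrite PE.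
  suff -> : P = Q by [].
  by apply/seteqP; split=> // x0 /QP'; rewrite PE' qq' PE.
by move=> ww ww' r r'; apply/seteqP; split; exact: H.
Qed.

(* Test against a feasible b that is tight at the vertex t ([feasible_at]), along
   points of the cell converging to t. *)
Lemma tight_sub w w' q q' : weight w' -> feasible w q -> feasible w' q' -> three (tight w q) ->
  cell w q `<=` cell w' q' -> tight w q `<=` tight w' q'.
Proof.
move=> ww' fq fq' [x [y [z [Tx Ty Tz [xy yz xz]]]]] sub t Tt; have [i Vt qt] := Tt; exists i => //.
apply/eqP; rewrite eq_le fq' // andbT.
have [b fb bt] := feasible_at hR ww' Vt; rewrite -bt.
have [s Ts st] : exists2 s, tight w q s & s <> t.
  by case: (pselect (x = t)) => [xt|]; [exists y => //; rewrite -xt => /esym|exists x].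
have lt := tight_light hR Tt; have ls := tight_light hR Ts; have ts := tight_pair_gt0 hR Tt Ts st.
have D (e : R) : 0 < e -> pair q' t + e * pair q' s <= pair b t + e * pair b s.
  move=> e0; rewrite -!pairZr -!pairDr.
  have tl : form (t + e *: s) (t + e *: s) < 0.
    have [tt _] := lt; have [ss _] := ls; rewrite !formE tt ss (formC s t) -[form t s]opprK -/(pair t s).
    by have := mulr_gt0 e0 ts; lra.
  have t2 : 0 < (t + e *: s) 2 0.
    by have [_ t2] := lt; have [_ s2] := ls; rewrite !mxE addr_gt0 // mulr_gt0.
  have hx := hyp_scale tl t2; set r := (_)^-1 in hx; have r0 : 0 < r by rewrite invr_gt0 sqrtr_gt0 oppr_gt0.
  have [_ cx] : cell w' q' (r *: (t + e *: s)).
    apply: sub; split=> //; apply: coneZ; first exact: ltW.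
    by apply: coneD; [exact: coneP|apply: coneZ; [exact: ltW|exact: coneP]].
  by have := pair_min fb cx; rewrite !pairZr ler_pM2l.
rewrite leNgt; apply/negP => lt'.
(* With this e the difference at s, scaled by e, is at most half of the difference at t. *)
pose e := (pair q' t - pair b t) / (2 * (`|pair b s - pair q' s| + 1)).
have c0 : 0 < 2 * (`|pair b s - pair q' s| + 1) by have := normr_ge0 (pair b s - pair q' s); lra.
have e0 : 0 < e by rewrite divr_gt0 // subr_gt0.
have := D e e0; have := ler_norm (pair b s - pair q' s).
have eE : e * (2 * (`|pair b s - pair q' s| + 1)) = pair q' t - pair b t by rewrite divfK ?gt_eqF.
move=> h1 h2; have h3 : e * (pair b s - pair q' s) <= e * `|pair b s - pair q' s| by rewrite ler_pM2l.
by move: e0 eE h2 h3 lt'; lra.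
Qed.

End Delaunay.

(** * Relative interior of a convex cone *)

Section RelativeInterior.
Context {R : realType} (n : nat).
Variable X : set 'rV[R]_n.
Hypothesis XD : forall a b, X a -> X b -> X (a + b).
Hypothesis XZ : forall (c : R) a, 0 < c -> X a -> X (c *: a).

(** A tuple in X is extended as long as it fails to span; m bounds the missing dimensions. It is
    kept nonempty because X need not contain 0. *)
Lemma spanning_tuple a : X a ->
  exists k (t : k.+1.-tuple 'rV[R]_n), (forall i, X (tnth t i)) /\ forall b, X b -> b \in <<t>>%VS.
Proof.
move=> Xa.
suff H m : forall k (t : k.+1.-tuple 'rV[R]_n), (forall i, X (tnth t i)) -> (n <= \dim <<t>> + m)%N ->
    exists k (t : k.+1.-tuple 'rV[R]_n), (forall i, X (tnth t i)) /\ forall b, X b -> b \in <<t>>%VS.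
  apply: (H n 0%N [tuple a]); last exact: leq_addl.
  by move=> i; rewrite (tnth_nth 0) /=; case: i => -[].
have dlt b k (t : k.+1.-tuple 'rV[R]_n) : b \notin <<t>>%VS -> (\dim <<t>> < \dim <<b :: t>>)%N.
  move=> bt; have sub : (<<t>> <= <<b :: t>>)%VS by rewrite span_cons addvSr.
  rewrite ltn_neqAle (dimvS sub) andbT; apply: contra bt => /eqP dE.
  have /eqP -> : <<t>>%VS == <<b :: t>>%VS by rewrite eqEdim sub dE leqnn.
  by rewrite memv_span // mem_head.
elim: m => [|m IH] k t Xt nm;
  have [sp|/existsNP[b /not_implyP[Xb /negP/dlt bt]]] := pselect (forall b, X b -> b \in <<t>>%VS);
  try by exists k, t.
  have := dimvS (subvf <<b :: t>>%VS); rewrite dimvf /dim /= mul1n leqNgt => /negP[].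
  by rewrite (leq_ltn_trans _ bt) // -(addn0 (\dim _)).
apply: (IH _ [tuple of b :: t]).
  by move=> i; case: (unliftP ord0 i) => [j ->|->]; rewrite ?tnth0 ?tnthS.
by rewrite (leq_trans nm) // addnS -addSn leq_add2r.
Qed.

Lemma relative_interior a : X a ->
  exists2 w, X w & forall b, X b -> exists2 e : R, 0 < e & X (w - e *: b).
Proof.
move=> Xa; have [k [t [Xt sp]]] := spanning_tuple Xa.
have pos (c : 'I_k.+1 -> R) : (forall i, 0 < c i) -> X (\sum_i c i *: tnth t i).
  move=> c0; rewrite big_ord_recl.
  have [->|//] : \sum_(i < k) c (lift ord0 i) *: tnth t (lift ord0 i) = 0 \/
      X (\sum_(i < k) c (lift ord0 i) *: tnth t (lift ord0 i)).
    apply: (big_ind (fun z => z = 0 \/ X z)); [by left| |by move=> i _; right; exact: XZ].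
    by move=> u v [->|Xu] [->|Xv]; rewrite ?add0r ?addr0; [left|right|right|right; exact: XD].
  - by rewrite addr0; exact: XZ.
  - by move=> Xs; apply: XD => //; exact: XZ.
exists (\sum_i tnth t i).
  by rewrite (eq_bigr (fun i => 1 *: tnth t i)) => [|i _]; [apply: pos|rewrite scale1r].
(* M exceeds all coordinates of b, so subtracting b / M from the sum leaves only positive
   coefficients. *)
move=> b /sp bt; pose c i := coord t i b; pose M := \sum_i `|c i| + 1.
have cM i : c i < M.
  rewrite /M (bigD1 i) //=; apply: le_lt_trans (ler_norm _) _; rewrite -addrA ltrDl ltr_wpDl //.
  exact: sumr_ge0.
have M0 : 0 < M by rewrite ltr_wpDl // sumr_ge0.
exists M^-1; first by rewrite invr_gt0.
have -> : \sum_i tnth t i - M^-1 *: b = \sum_i (1 - M^-1 * c i) *: tnth t i.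
  rewrite {1}(coord_span bt) scaler_sumr -sumrB; apply: eq_bigr => i _.
  by rewrite scalerBl scale1r scalerA (tnth_nth 0).
by apply: pos => i; rewrite subr_gt0 mulrC ltr_pdivrMr // mul1r.
Qed.
End RelativeInterior.

(** * Adding weights *)

Section Coarsenings.
Context {R : realType} (n : nat) (G : set 'M[R]_3) (K : 'I_n -> set 'cV[R]_3).
Hypothesis hR : punctured_surface G K.
Implicit Types (x q u : 'cV[R]_3) (w : 'rV[R]_n).
Notation V := (unit_cusp G K).
Notation feasible := (feasible G K).
Notation tight := (tight G K).
Notation cell := (cell G K).
Notation D := (delaunay G K).

Lemma weightD w w' : weight w -> weight w' -> weight (w + w').
Proof.
move=> /weightP[w0 [i wi]] /weightP[w'0 _]; apply/weightP; split=> [j|]; first by rewrite mxE addr_ge0.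
by exists i; rewrite mxE ltr_pwDl.
Qed.

Lemma weightZ (c : R) w : 0 < c -> weight w -> weight (c *: w).
Proof.
move=> c0 /weightP[w0 [i wi]]; apply/weightP; split=> [j|]; first by rewrite mxE mulr_ge0 // ltW.
by exists i; rewrite mxE mulr_gt0.
Qed.

Lemma threeS (S T : set 'cV[R]_3) : S `<=` T -> three S -> three T.
Proof. by move=> ST [x [y [z [Sx Sy Sz d]]]]; exists x, y, z; split=> //; exact: ST. Qed.

Lemma cellS w1 w2 q1 q2 : tight w1 q1 `<=` tight w2 q2 -> cell w1 q1 `<=` cell w2 q2.
Proof. by move=> T x [hx cx]; split=> //; exact: coneS cx. Qed.

Lemma delaunayZ (c : R) w : 0 < c -> weight w -> D (c *: w) = D w.
Proof.
suff H (a : R) z : 0 < a -> weight z -> D z `<=` D (a *: z).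
  move=> c0 ww; apply/seteqP; split; last exact: H.
  have := H c^-1 (c *: w); rewrite scalerA mulVf ?gt_eqF // scale1r invr_gt0; apply=> //; exact: weightZ.
move=> a0 wz P /(delaunayE hR _ wz)[q [fq [x [y [u [Tx Ty Tu dist]]]] ->]].
have TE : tight (a *: z) (a *: q) = tight z q.
  apply/seteqP; split=> v [i Vi qi]; exists i => //; move: qi; rewrite pairZl mxE; last by move=> ->.
  by apply: mulfI; rewrite gt_eqF.
apply/(delaunayE hR _ (weightZ a0 wz)); exists (a *: q); split.
- by move=> i v Vi; rewrite pairZl mxE ler_pM2l //; exact: fq.
- by rewrite TE; exists x, y, u.
- by apply/seteqP; split; apply: cellS; rewrite TE.
Qed.

Lemma feasibleD w w' q q' : feasible w q -> feasible w' q' -> feasible (w + w') (q + q').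
Proof. by move=> fq fq' i u Vu; rewrite mxE pairDl lerD ?fq ?fq'. Qed.

Lemma tightD w w' q q' : feasible w q -> feasible w' q' ->
  tight (w + w') (q + q') = tight w q `&` tight w' q'.
Proof.
move=> fq fq'; apply/seteqP; split=> u.
  move=> [i Vu]; have := fq _ _ Vu; have := fq' _ _ Vu; rewrite mxE pairDl => h1 h2 h3.
  by split; exists i => //; lra.
move=> [[i Vu qu] [j Vu' qu']]; exists i => //; rewrite mxE pairDl qu.
by rewrite qu' (cusp_index_eq hR Vu Vu').
Qed.

Section Common.
Variables (w0 w w' : 'rV[R]_n).
Hypotheses (ww0 : weight w0) (ww : weight w) (ww' : weight w').
Hypotheses (rw : refines (D w0) (D w)) (rw' : refines (D w0) (D w')).

Lemma common_cell q0 : feasible w0 q0 -> three (tight w0 q0) -> exists q q',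
  [/\ [/\ feasible w q & feasible w' q'], three (tight w q),
      tight w0 q0 `<=` tight (w + w') (q + q') & tight (w + w') (q + q') `<=` tight w q].
Proof.
move=> fq0 t0; have DP : D w0 (cell w0 q0) by apply/(delaunayE hR _ ww0); exists q0.
have /refinesP /(_ _ DP)[Q /(delaunayE hR _ ww)[q [fq t3 ->]] sub] := rw.
have /refinesP /(_ _ DP)[Q' /(delaunayE hR _ ww')[q' [fq' _ ->]] sub'] := rw'.
exists q, q'; rewrite tightD //; split=> // u Tu; split; first exact: (tight_sub hR ww fq0 fq t0 sub).
exact: (tight_sub hR ww' fq0 fq' t0 sub').
Qed.

Lemma refines_add : refines (D w0) (D (w + w')).
Proof.
apply/refinesP => P /(delaunayE hR _ ww0)[q0 [fq0 t0 ->]].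
have [q [q' [[fq fq'] _ T _]]] := common_cell fq0 t0; exists (cell (w + w') (q + q')); last exact: cellS.
apply/(delaunayE hR _ (weightD ww ww')); exists (q + q'); split=> //; [exact: feasibleD|exact: threeS t0].
Qed.

(** The centre of a cell of the sum lies in a cell of [w0]. The functional q + q' attached to that
    cell is tight over the centre, so [cell_center] identifies it with the given one, whose tight
    set is then contained in that of q. *)
Lemma add_refines : refines (D (w + w')) (D w).
Proof.
apply/refinesP => P /(delaunayE hR _ (weightD ww ww'))[q1 [fq1 t1 ->]].
have [x cx xq] := cell_center hR fq1 t1.
have [q0 [fq0 t0 cx0]] := covering hR ww0 (proj1 cx).
have [q [q' [[fq fq'] t3 T T']]] := common_cell fq0 t0.
have E : q + q' = q1 by apply: xq; [exact: feasibleD|exact: cellS cx0].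
exists (cell w q); first by apply/(delaunayE hR _ ww); exists q.
by rewrite -E; exact: cellS.
Qed.
End Common.
End Coarsenings.

(** * Finest common coarsenings *)

Section Main.
Context {R : realType} (n : nat) (G : set 'M[R]_3) (K : 'I_n -> set 'cV[R]_3).
Hypothesis hR : punctured_surface G K.
Variables D1 D2 : set (set 'cV[R]_3).
Hypotheses (hD1 : is_delaunay G K D1) (hD2 : is_delaunay G K D2).

(** For w in the relative interior, w - e w' is still in the intersection. So w is a sum of two
    weights of the intersection, one of them proportional to w', and the decomposition of a sum
    refines that of each summand. *)
Lemma cone_interior : secondary_cone G K D1 `&` secondary_cone G K D2 !=set0 ->
  exists2 w, (secondary_cone G K D1 `&` secondary_cone G K D2) w &
    forall w', (secondary_cone G K D1 `&` secondary_cone G K D2) w' ->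
      refines (delaunay G K w) (delaunay G K w').
Proof.
have [w1 ww1 D1E] := hD1; have [w2 ww2 D2E] := hD2; rewrite D1E D2E.
set X := _ `&` _ => -[a Xa].
have XD u v : X u -> X v -> X (u + v).
  move=> [[wu u1] [_ u2]] [[wv v1] [_ v2]]; have wuv := weightD wu wv.
  by split; split=> //; apply: (refines_add hR).
have XZ (c : R) u : 0 < c -> X u -> X (c *: u).
  move=> c0 [[wu u1] [_ u2]]; have wcu := weightZ c0 wu.
  by split; split=> //; rewrite delaunayZ.
have [w Xw wI] := relative_interior XD XZ Xa; exists w => // w' Xw'.
have [e e0 Xe] := wI _ Xw'; have [[ww' _] _] := Xw'.
rewrite -(delaunayZ hR e0 ww') -(subrK (e *: w') w) addrC.
have [[wu u1] _] := XZ _ _ e0 Xw'; have [[wv v1] _] := Xe.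
exact: (add_refines hR ww1).
Qed.

Lemma finest_of_interior w : (secondary_cone G K D1 `&` secondary_cone G K D2) w ->
  (forall w', (secondary_cone G K D1 `&` secondary_cone G K D2) w' ->
    refines (delaunay G K w) (delaunay G K w')) ->
  [/\ finest_common_coarsening G K D1 D2 (delaunay G K w),
    forall D, finest_common_coarsening G K D1 D2 D -> D = delaunay G K w
  & secondary_cone G K D1 `&` secondary_cone G K D2 = secondary_cone G K (delaunay G K w)].
Proof.
move=> [[ww r1] [_ r2]] wI.
have cI D : common_coarsening G K D1 D2 D ->
    exists w', [/\ weight w', D = delaunay G K w' & refines (delaunay G K w) D].
  by move=> [[w' ww' ->] r1' r2']; exists w'; split=> //; apply: wI.
have cc : common_coarsening G K D1 D2 (delaunay G K w) by split=> //; exists w.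
split.
- split=> // D cD rD; have [w' [ww' DE wD]] := cI D cD; rewrite DE in wD rD *.
  exact: (delaunay_refines_anti hR).
- move=> D [cD minD]; have [w' [ww' DE wD]] := cI D cD; apply/esym; exact: minD.
- apply/seteqP; split=> [w' Xw'|w' [ww' r]].
    by split; [case: Xw' => -[]|exact: wI].
  by split; split=> //; exact: refines_trans r.
Qed.
End Main.

Theorem corollary5p6 (R : realType) (n : nat) (hn : (0 < n)%N)
  (G : set 'M[R]_3) (K : 'I_n -> set 'cV[R]_3)
  (hR : punctured_surface G K)
  (D1 D2 : set (set 'cV[R]_3))
  (hD1 : is_delaunay G K D1) (hD2 : is_delaunay G K D2) :
  (secondary_cone G K D1 `&` secondary_cone G K D2 !=set0 ->
    exists D3, [/\ finest_common_coarsening G K D1 D2 D3,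
      forall D, finest_common_coarsening G K D1 D2 D -> D = D3
      & secondary_cone G K D1 `&` secondary_cone G K D2
          = secondary_cone G K D3]) /\
  (forall D3, finest_common_coarsening G K D1 D2 D3 ->
    secondary_cone G K D1 `&` secondary_cone G K D2 = secondary_cone G K D3).
Proof.
have main : secondary_cone G K D1 `&` secondary_cone G K D2 !=set0 ->
    exists D3, [/\ finest_common_coarsening G K D1 D2 D3,
      forall D, finest_common_coarsening G K D1 D2 D -> D = D3
      & secondary_cone G K D1 `&` secondary_cone G K D2 = secondary_cone G K D3].
  move=> /(cone_interior hR hD1 hD2)[w Xw wI]; exists (delaunay G K w).
  exact: finest_of_interior.
(* The weight defining the given coarsening lies in both secondary cones, so they meet. *)
split=> // D3 fD3; have [[[w ww DE] r1 r2] _] := fD3.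
have [|D [_ U ->]] := main; first by exists w; rewrite DE in r1 r2; split.
by rewrite (U _ fD3).
Qed.
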